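(* Suppose that for some constants $0<c_1<C_1$ we have $c_1\le\bar{\mathrm E}[x_{ij}^2]\le C_1$ for all $1\le j\le p$. Then there is a constant $C_2>0$ depending only on $c_1$ and $C_1$ such that, with $\pi(\vartheta):=C_2\vartheta^{1/3}(1\vee\log(p/\vartheta))^{2/3}$, for every $\vartheta>0$, $$\rho_\ominus:=\sup_{\alpha\in(0,1)}\mathrm P\big(\{T_0\le c_{W_0}(\alpha)\}\ominus\{T_0\le c_{Z_0}(\alpha)\}\big)\le 2\big(\rho+\pi(\vartheta)+\mathrm P(\Delta>\vartheta)\big).$$ In addition, $\sup_{\alpha\in(0,1)}|\mathrm P(T_0\le c_{W_0}(\alpha))-\alpha|\le\rho_\ominus+\rho$.
   Context: Let $n\ge 1$ and $p\ge 3$ be integers. Let $x_1,\dots,x_n$ be independent random vectors in $\mathbb R^p$, $x_i=(x_{i1},\dots,x_{ip})'$, with $\mathrm E[x_i]=0$ and finite covariance matrices. Let $y_1,\dots,y_n$ be independent Gaussian vectors, $y_i\sim N(0,\mathrm E[x_ix_i'])$, and let $e_1,\dots,e_n$ be i.i.d. $N(0,1)$ variables independent of $(x_i)_{i=1}^n$. Put $$T_0=\max_{1\le j\le p}\frac1{\sqrt n}\sum_{i=1}^n x_{ij},\quad Z_0=\max_{1\le j\le p}\frac1{\sqrt n}\sum_{i=1}^n y_{ij},\quad W_0=\max_{1\le j\le p}\frac1{\sqrt n}\sum_{i=1}^n x_{ij}e_i,$$ $\rho:=\sup_{t\in\mathbb R}|\mathrm P(T_0\le t)-\mathrm P(Z_0\le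 t)|$. Notation: $\mathbb E_n[\cdot]=n^{-1}\sum_{i=1}^n[\cdot]$, $\bar{\mathrm E}[\cdot]=n^{-1}\sum_{i=1}^n\mathrm E[\cdot]$, $a\vee b=\max\{a,b\}$, $A\ominus B=(A\setminus B)\cup(B\setminus A)$, and $\Delta:=\max_{1\le j,k\le p}|\mathbb E_n[x_{ij}x_{ik}]-\bar{\mathrm E}[x_{ij}x_{ik}]|$. $\mathrm P_e$ denotes probability with respect to $(e_i)_{i=1}^n$ conditional on $(x_i)_{i=1}^n$. Quantiles: $c_{Z_0}(\alpha):=\inf\{t\in\mathbb R:\mathrm P(Z_0\le t)\ge\alpha\}$, and $c_{W_0}(\alpha):=\inf\{t\in\mathbb R:\mathrm P_e(W_0\le t)\ge\alpha\}$ (a random variable depending on the data). *)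

(* Defs.v *)
From HB Require Import structures.
From mathcomp Require Import all_boot all_order all_algebra.
From mathcomp Require Import all_classical all_reals all_analysis.

Set Implicit Arguments.
Unset Strict Implicit.
Unset Printing Implicit Defensive.
Import Order.TTheory GRing.Theory Num.Theory.
Import numFieldNormedType.Exports.
Local Open Scope classical_set_scope.
Local Open Scope ring_scope.

(* Random vectors of R^p are measurable maps to p.-tuple R, which carries the
   product sigma-algebra. *)

Section finite_max.
Context {R : realType} (p : nat).
Implicit Type f : 'I_p -> R.

(* The starting value of the iterated maximum is one of the f j when 0 < p
   (and 0 when p = 0), so that negative maxima are not truncated. *)
Definition vmax f : R := \big[Num.max/head 0 (codom f)]_(j < p) f j.

Lemma vmax_ub f j : f j <= vmax f.
Proof. by rewrite /vmax; exact: le_bigmax. Qed.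

Lemma vmax_attained f : (0 < p)%N -> exists j, vmax f = f j.
Proof.
move=> p0; rewrite /vmax; apply: (big_ind (fun z => exists j, z = f j)).
- have : (0 < size (codom f))%N by rewrite size_codom card_ord.
  case E : (codom f) => [//|z s] _ /=.
  have /codomP[j ->] : z \in codom f by rewrite E mem_head.
  by exists j.
- by move=> _ _ [j ->] [k ->]; case: (leP (f j) (f k)) => _; eexists.
- by move=> j _; exists j.
Qed.

End finite_max.

Section probability_notions.
Context d (T : measurableType d) (R : realType) (P : probability T R).

Definition has_law d' (T' : measurableType d') (X : T -> T')
    (mu : set T' -> \bar R) : Prop :=
  forall A, measurable A -> P (X @^-1` A) = mu A.

Definition mutually_independent d' (T' : measurableType d') (I : finType)
    (X : I -> T -> T') : Prop :=
  forall (J : {set I}) (A : I -> set T'),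
    (forall i, measurable (A i)) ->
    P (\bigcap_(i in [set` J]) (X i @^-1` A i)) =
    (\prod_(i in J) P (X i @^-1` A i))%E.

Definition independent d1 d2 (T1 : measurableType d1) (T2 : measurableType d2)
    (X : T -> T1) (Y : T -> T2) : Prop :=
  forall A B, measurable A -> measurable B ->
    P ((X @^-1` A) `&` (Y @^-1` B)) = (P (X @^-1` A) * P (Y @^-1` B))%E.

Definition component p (X : T -> p.-tuple R) (j : 'I_p) : T -> R :=
  fun w => tnth (X w) j.

Definition second_moment p (X : T -> p.-tuple R) (j k : 'I_p) : R :=
  fine 'E_P[component X j \* component X k].

(* N(m, v) with v the variance. The library's normal_prob takes the standard
   deviation and is not a point mass when the latter is 0. *)
Definition normal_law (m v : R) : set R -> \bar R :=
  fun A => if v == 0 then \d_m A else normal_prob m (Num.sqrt v) A.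

(* X ~ N(0, S), S possibly singular: each linear form a.X is N(0, a S a'). *)
Definition centered_gaussian p (X : T -> p.-tuple R) (S : 'M[R]_p) : Prop :=
  forall a : 'rV[R]_p,
    has_law (fun w => \sum_(j < p) a 0 j * tnth (X w) j)
            (normal_law 0 ((a *m S *m a^T) 0 0)).

(* The distance sup_t |P(X <= t) - P(Y <= t)|. *)
Definition kolmogorov_dist (X Y : T -> R) : \bar R :=
  ereal_sup [set `|P [set w | (X w <= t)%R] - P [set w | (Y w <= t)%R]|%E
            | t in [set: R]].

End probability_notions.

(* For a distribution function F and 0 < alpha < 1 the set below is nonempty
   and bounded below, so that inf is a genuine infimum. *)
Definition quantile (R : realType) (F : R -> \bar R) (alpha : R) : R :=
  inf [set t | (alpha%:E <= F t)%E].

Definition average (R : realType) n (f : 'I_n -> R) : R :=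
  n%:R^-1 * \sum_(i < n) f i.

Definition max_scaled_sum (R : realType) n p (v : 'I_n -> 'I_p -> R) : R :=
  vmax (fun j => (Num.sqrt n%:R)^-1 * \sum_(i < n) v i j).

Section multiplier_bootstrap.
Context d (T : measurableType d) (R : realType) (P : probability T R).
Context (n p : nat).
Implicit Types (x y : 'I_n -> T -> p.-tuple R) (e : 'I_n -> T -> R).

(* This is T_0 for the data x, and Z_0 for its Gaussian analogue y. *)
Definition max_stat x (w : T) : R :=
  max_scaled_sum (fun i j => tnth (x i w) j).

(* W_0 with the data and the multipliers taken at separate sample points. *)
Definition W0 x e (w w' : T) : R :=
  max_scaled_sum (fun i j => tnth (x i w) j * e i w').

(* P_e(W_0 <= t) given the data at w: the data are held fixed at w and only
   the multipliers are random; e being independent of x, this is the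
   conditional probability of W_0 <= t given x. *)
Definition Pe_W0_le x e (w : T) (t : R) : \bar R :=
  P [set w' | W0 x e w w' <= t].

Definition cZ0 y (alpha : R) : R :=
  quantile (fun t => P [set w | max_stat y w <= t]) alpha.

Definition cW0 x e (alpha : R) (w : T) : R := quantile (Pe_W0_le x e w) alpha.

Definition Delta x (w : T) : R :=
  \big[Num.max/0]_(j < p) \big[Num.max/0]_(k < p)
    `|average (fun i => tnth (x i w) j * tnth (x i w) k)
      - average (fun i => second_moment P (x i) j k)|.

Definition rho x y : \bar R := kolmogorov_dist P (max_stat x) (max_stat y).

Definition rho_ominus x y e : \bar R :=
  ereal_sup [set P ([set w | max_stat x w <= cW0 x e alpha w] `+`
                    [set w | max_stat x w <= cZ0 y alpha])
            | alpha in [set alpha : R | 0 < alpha < 1]].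

End multiplier_bootstrap.

Definition pi_bound (R : realType) (C2 : R) (p : nat) (theta : R) : R :=
  C2 * theta `^ (1 / 3) * (Num.max 1 (ln (p%:R / theta))) `^ (2 / 3).

(* Main.v *)
(* Gaussian vectors enter only through E cos(a.X + b) = cos b exp(-a'Sa / 2).
   On trigonometric polynomials f this makes the interpolation between N(0, S1)
   and N(0, S2), and Stein's identity E[X.grad f] = sum_jk S_jk E[d_jk f],
   explicit computations.  Both pass to C^2-uniform limits, in particular to
   smooth functions of L sin(x_j / L), and then, letting L tend to infinity, to
   H_s(x) = b^-1 log(1 + sum_j exp(b (x_j - s))), a smoothing of (max x - s)^+.

   Since sum_jk |d_jk H_s| <= 2b, interpolation bounds |E H_s(X) - E H_s(Y)| by
   b max|S1 - S2|.  With unit variances, sum_jk S_jk d_jk H_s dominates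
   b E / (1 + E)^2 with E = sum_j exp(b (x_j - s)), which is a smoothed density
   of max x at s, so Stein's identity yields anti-concentration: P(t < max X <=
   t + h) is at most h E[(max X)^+], up to a constant, and comparing X with 0
   gives E[(max X)^+] = O(sqrt(log p)).  The averages (H_s - H_{s+d}) / d are
   almost sandwiched between indicators of {max x > s + d} and {max x > s}; with
   b d of order log(p / theta) and d = theta^(1/3) (log(p / theta))^(1/6), they
   give |P(max X <= t) - P(max Y <= t)| <= pi(theta) when max|S1 - S2| <= theta.

   On {Delta <= theta} the conditional law of W0 is therefore within pi(theta)
   of that of Z0, so c_W0(alpha) lies between the (alpha - pi)- and
   (alpha + pi)-quantiles of Z0, and the symmetric difference lies in a set
   {c_Z0(alpha - pi) < T0 <= c_Z0(alpha + pi)}. *)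
Require Import Defs.
From HB Require Import structures.
From mathcomp Require Import all_boot all_order all_algebra.
From mathcomp Require Import all_classical all_reals all_analysis.
From mathcomp Require Import measurable_realfun.
From mathcomp Require Import ring lra.

Set Implicit Arguments.
Unset Strict Implicit.
Unset Printing Implicit Defensive.
Import Order.TTheory GRing.Theory Num.Theory.
Import numFieldNormedType.Exports.
Local Open Scope classical_set_scope.
Local Open Scope ring_scope.

(** Given the data, the covariance matrix of the multiplier sum has rank at most n, so it is
    singular once n < p, and its diagonal need not stay away from 0. This shapes the proof: no
    density in R^p appears, and anti-concentration is asked only of Z0, whose variances are at least
    c1. Trigonometric polynomials serve as test functions because their Gaussian expectations are
    finite sums of explicit exponentials in S, so interpolating between two laws is calculus in one
    real variable.

    The scales come from a balance. Write l = max(1, log(p / theta)). Replacing an indicator by a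
    ramp of width d costs d sqrt(l) by anti-concentration; comparing the expectations of two ramps
    costs theta b / d; and b d = l brings the softmax error, of order p exp(- b d), down to theta.
    Equating d sqrt(l) with theta l / d^2 gives d^3 = theta sqrt(l), and both costs become
    theta^(1/3) l^(2/3). The factor sqrt(l) stems from E[(max X)^+] <= log(1 + p) / b' + b', valid
    for every b' > 0 and used with b' = sqrt(l). *)

Lemma Rintegral_dominated d (T : measurableType d) (R : realType)
    (mu : {measure set T -> \bar R}) (f_ : nat -> T -> R) (f g : T -> R) :
  (forall n, measurable_fun setT (f_ n)) ->
  (forall x, f_ n x @[n --> \oo] --> f x) ->
  mu.-integrable setT (EFin \o g) -> (forall n x, `|f_ n x| <= g x) ->
  mu.-integrable setT (EFin \o f) /\
  \int[mu]_x f_ n x @[n --> \oo] --> \int[mu]_x f x.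
Proof.
move=> mf ff ig fg.
have mf' : measurable_fun setT f.
  by apply: measurable_fun_cvg (fun x _ => ff x) => n; exact: mf.
have [|||||intf _ lim] := @dominated_convergence _ _ _ mu setT measurableT
    (fun n => EFin \o f_ n) (EFin \o f) (EFin \o g).
- by move=> n; exact/measurable_EFinP.
- exact/measurable_EFinP.
- by apply: aeW => x _; apply: cvg_EFin; [exact: nearW|exact: ff].
- exact: ig.
- by apply: aeW => x n _; rewrite /= lee_fin.
split=> //; apply: fine_cvg; rewrite fineK//.
exact: integrable_fin_num.
Qed.

(** * Normal variables and independence *)

Section normal_integrals.
Context {R : realType}.
Notation mu := (@lebesgue_measure R).
Implicit Types (s r a : R).

(** Both functions have the same integral over every measurable set. This makes the abstract change
    of variables an integral against the explicit density. *)
Lemma normal_RN_ae s :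
  ae_eq mu setT (Radon_Nikodym_SigmaFinite.f (normal_prob 0 s) mu)
    (EFin \o normal_pdf 0 s).
Proof.
apply: integral_ae_eq => //.
- by apply: Radon_Nikodym_SigmaFinite.f_integrable; exact: normal_prob_dominates.
- by apply/measurable_EFinP; exact: measurable_normal_pdf.
- move=> A _ mA; rewrite -Radon_Nikodym_SigmaFinite.f_integral//.
  exact: normal_prob_dominates.
Qed.

Lemma ge0_integral_normal_prob s (f : R -> \bar R) :
  (forall x, 0 <= f x)%E -> measurable_fun setT f ->
  (\int[normal_prob 0 s]_x f x = \int[mu]_x (f x * (normal_pdf 0 s x)%:E))%E.
Proof.
move=> f0 mf.
have dom := @normal_prob_dominates R 0 s.
rewrite -(Radon_Nikodym_SigmaFinite.change_of_variables dom)//.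
have mg : measurable_fun setT (Radon_Nikodym_SigmaFinite.f (normal_prob 0 s) mu).
  apply: measurable_int; exact: Radon_Nikodym_SigmaFinite.f_integrable dom.
apply: ae_eq_integral => //.
- exact: emeasurable_funM.
- apply: emeasurable_funM => //.
  by apply/measurable_EFinP; exact: measurable_normal_pdf.
- by apply: ae_eqe_mul2l; exact: normal_RN_ae.
Qed.

Lemma integral_normal_prob s (f : R -> R) : measurable_fun setT f ->
  mu.-integrable setT (fun x => (f x * normal_pdf 0 s x)%:E) ->
  (normal_prob 0 s).-integrable setT (EFin \o f) /\
  \int[normal_prob 0 s]_x f x = \int[mu]_x (f x * normal_pdf 0 s x).
Proof.
move=> mf intf.
have dom := @normal_prob_dominates R 0 s.
have mp := @measurable_normal_pdf R 0 s.
have int1 : (normal_prob 0 s).-integrable setT (EFin \o f).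
  apply/integrableP; split; first exact/measurable_EFinP.
  rewrite ge0_integral_normal_prob//; last first.
    by apply: measurableT_comp => //; exact/measurable_EFinP.
  case/integrableP : intf => _; congr (_ < _)%E; apply: eq_integral => x _ /=.
  by rewrite normrM EFinM (ger0_norm (normal_pdf_ge0 _ _ _)).
split=> //; rewrite /Rintegral; congr fine.
rewrite -(Radon_Nikodym_change_of_variables dom)//.
have mg : measurable_fun setT (Radon_Nikodym_SigmaFinite.f (normal_prob 0 s) mu).
  apply: measurable_int; exact: Radon_Nikodym_SigmaFinite.f_integrable dom.
have mEf : measurable_fun setT (fun x => (f x)%:E) by exact/measurable_EFinP.
transitivity (\int[mu]_x ((f x)%:E * Radon_Nikodym_SigmaFinite.f (normal_prob 0 s) mu x))%E.
  apply: ae_eq_integral => //.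
  - exact: emeasurable_funM.
  - exact: emeasurable_funM.
  - by apply: ae_eqe_mul2l; apply: ae_eq_sym; exact: ae_eq_Radon_Nikodym_SigmaFinite.
under [RHS]eq_integral do rewrite EFinM.
apply: ae_eq_integral => //.
- exact: emeasurable_funM.
- by apply: emeasurable_funM => //; exact/measurable_EFinP.
- by apply: ae_eqe_mul2l; exact: normal_RN_ae.
Qed.

(** On [-n, n] the fundamental theorem gives F(n) - F(-n), which tends to 0, while dominated
    convergence recovers the integral over the line. It serves integration by parts with vanishing
    boundary terms. *)
Lemma integral_derive_eq0 (F f : R -> R) :
  (forall x, is_derive x (1:R) F (f x)) -> continuous f ->
  mu.-integrable setT (EFin \o f) ->
  F x @[x --> +oo] --> (0:R) -> F x @[x --> -oo] --> (0:R) ->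
  \int[mu]_x f x = 0.
Proof.
move=> dF cf intf Fy FNy.
have mf : measurable_fun setT f by exact: continuous_measurable_fun.
pose g n (x : R) : R := (f \_ `[- n%:R, n%:R]) x.
have mg n : measurable_fun setT (g n).
  by apply/(measurable_restrictT _ _).1 => //; exact: measurable_funTS.
have gf x : g n x @[n --> \oo] --> f x.
  apply: cvg_near_cst; near=> n; rewrite /g patchE mem_set//= in_itv/=.
  by rewrite -ler_norml; near: n; exact: nbhs_infty_ger.
have gub n x : `|g n x| <= `|f x|.
  by rewrite /g patchE; case: ifP => // _; rewrite normr0.
have intf' : mu.-integrable setT (EFin \o (fun x => `|f x|)).
  exact: (integrable_norm intf).
have [_ lim] := @Rintegral_dominated _ _ _ mu g f _ mg gf intf' gub.
have gE n : (0 < n)%N -> \int[mu]_x g n x = F n%:R - F (- n%:R).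
  move=> n0; rewrite /g -Rintegral_mkcond /Rintegral.
  have nn : - n%:R < n%:R :> R by rewrite gtrN// ltr0n.
  rewrite (@continuous_FTC2 _ f F)//.
  - exact: continuous_subspaceT.
  - have cF x : F x' @[x' --> x] --> F x.
      by apply: differentiable_continuous; apply/derivable1_diffP; apply: ex_derive.
    split=> //.
    + exact/cvg_at_right_filter.
    + exact/cvg_at_left_filter.
  - by move=> x _; rewrite derive1E; exact: derive_val.
have lim0 : F n%:R - F (- n%:R) @[n --> \oo] --> (0:R).
  rewrite -[X in _ --> X](subrr (0:R)).
  have nb : (n%:R : R) @[n --> \oo] --> +oo by exact: cvgr_idn.
  apply: cvgB.
    exact: (cvg_comp _ _ nb Fy).
  by apply: cvg_comp FNy; apply/cvgNrNy; exact: nb.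
apply: (cvg_unique _ lim) => //.
apply: cvg_trans lim0; apply: near_eq_cvg; near=> n.
by rewrite gE//; near: n; exact: nbhs_infty_gt.
Unshelve. all: by end_near.
Qed.

End normal_integrals.

Section derivatives.
Context {R : realType}.
Implicit Types a b r : R.

Lemma is_derive_affine a b r : is_derive r (1:R) (fun u => u * a + b) a.
Proof.
have -> : (fun u : R => u * a + b) = a \*: id + cst b.
  by apply/funext => u; rewrite /= mulrC.
by apply: is_derive_eq; rewrite addr0 /GRing.scale /= mulr1.
Qed.

Lemma is_derive_comp (f g : R -> R) r df dg :
  is_derive (g r) (1:R) f df -> is_derive r (1:R) g dg ->
  is_derive r (1:R) (fun u => f (g u)) (df * dg).
Proof. exact: is_derive1_comp. Qed.

Lemma is_derive_cos_affine a b r :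
  is_derive r (1:R) (fun u => cos (u * a + b)) (- (a * sin (r * a + b))).
Proof.
have H := is_derive_affine a b r.
by apply: (is_derive_eq (is_derive_comp _ H)); rewrite mulNr mulrC.
Qed.

Lemma is_derive_sin_affine a b r :
  is_derive r (1:R) (fun u => sin (u * a + b)) (a * cos (r * a + b)).
Proof.
have H := is_derive_affine a b r.
by apply: (is_derive_eq (is_derive_comp _ H)); rewrite mulrC.
Qed.

Lemma is_derive_expR_affine a b r :
  is_derive r (1:R) (fun u => expR (u * a + b)) (a * expR (r * a + b)).
Proof.
have H := is_derive_affine a b r.
by apply: (is_derive_eq (is_derive_comp _ H)); rewrite mulrC.
Qed.

Lemma is_derive_expR_sqr a r :
  is_derive r (1:R) (fun u => expR (u ^+ 2 * a)) (2 * r * a * expR (r ^+ 2 * a)).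
Proof.
have H : is_derive r (1:R) (fun u : R => u ^+ 2 * a) (2 * r * a).
  have -> : (fun u : R => u ^+ 2 * a) = a \*: (id ^+ 2).
    by apply/funext => u; rewrite /= mulrC.
  by apply: is_derive_eq; rewrite /GRing.scale /=; ring.
by apply: (is_derive_eq (is_derive_comp _ H)); rewrite mulrC.
Qed.

Lemma is_derive_mul (f g : R -> R) r (df dg : R) :
  is_derive r (1:R) f df -> is_derive r (1:R) g dg ->
  is_derive r (1:R) (fun u => f u * g u) (df * g r + f r * dg).
Proof.
move=> Hf Hg; apply: is_derive_eq (is_deriveM Hf Hg) _.
by rewrite /GRing.scale /=; ring.
Qed.

Lemma measurable_cos_affine d (T : measurableType d) (X : T -> R) a b :
  measurable_fun setT X -> measurable_fun setT (fun w => cos (a * X w + b)).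
Proof.
move=> mX; apply: (@measurableT_comp _ _ _ _ _ _ cos).
  by apply: continuous_measurable_fun; exact: continuous_cos.
by apply: measurable_funD => //; exact: measurable_funM.
Qed.

Lemma measurable_sin_affine d (T : measurableType d) (X : T -> R) a b :
  measurable_fun setT X -> measurable_fun setT (fun w => sin (a * X w + b)).
Proof.
move=> mX; apply: (@measurableT_comp _ _ _ _ _ _ sin).
  by apply: continuous_measurable_fun; exact: continuous_sin.
by apply: measurable_funD => //; exact: measurable_funM.
Qed.

End derivatives.

Section expectation_tools.
Context d (T : measurableType d) (R : realType) (P : probability T R).
Implicit Types f g X : T -> R.

Lemma integrable_ub f (M : R) : measurable_fun setT f ->
  (forall w, `|f w| <= M) -> P.-integrable setT (EFin \o f).
Proof.
move=> mf fM; apply: measurable_bounded_integrable => //.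
  by rewrite (le_lt_trans (probability_le1 _ _))// ltry.
exists M; split; first by rewrite num_real.
by move=> z Mz w _ /=; rewrite (le_trans (fM w))// ltW.
Qed.

Lemma integrable_cst (c : R) : P.-integrable setT (EFin \o (fun=> c)).
Proof. by apply: (@integrable_ub _ `|c|). Qed.

Lemma Rintegral_prob_cst (c : R) : \int[P]_w c = c.
Proof. by rewrite Rintegral_cst//; have := probability_setT P; rewrite /= => ->; rewrite mulr1. Qed.

Lemma integrableZ f (c : R) : P.-integrable setT (EFin \o f) ->
  P.-integrable setT (EFin \o (fun w => c * f w)).
Proof.
by move=> If; have := integrableZl measurableT c If; apply: eq_integrable.
Qed.

Lemma integrableDR f g : P.-integrable setT (EFin \o f) ->
  P.-integrable setT (EFin \o g) ->
  P.-integrable setT (EFin \o (fun w => f w + g w)).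
Proof. by move=> If Ig; have := integrableD measurableT If Ig; apply: eq_integrable. Qed.

Lemma integrable_sum_seq (I : Type) (s : seq I) (F : I -> T -> R) :
  (forall i, P.-integrable setT (EFin \o F i)) ->
  P.-integrable setT (EFin \o (fun w => \sum_(i <- s) F i w)).
Proof.
move=> IF; elim: s => [|i s IH].
  have -> : (fun w => \sum_(j <- [::]) F j w) = (fun=> 0).
    by apply/funext => w; rewrite big_nil.
  exact: integrable_cst.
have -> : (fun w => \sum_(j <- i :: s) F j w) =
          (fun w => F i w + \sum_(j <- s) F j w).
  by apply/funext => w; rewrite big_cons.
exact: integrableDR.
Qed.

Lemma Rintegral_sum (I : Type) (s : seq I) (F : I -> T -> R) :
  (forall i, P.-integrable setT (EFin \o F i)) ->
  \int[P]_w (\sum_(i <- s) F i w) = \sum_(i <- s) \int[P]_w F i w.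
Proof.
move=> IF; elim: s => [|i s IH].
  rewrite big_nil -[RHS](Rintegral_prob_cst 0).
  by apply: eq_Rintegral => w _; rewrite big_nil.
rewrite big_cons -IH -RintegralD//; last exact: integrable_sum_seq.
by apply: eq_Rintegral => w _; rewrite big_cons.
Qed.

Lemma Rintegral_le_cst f (c : R) : P.-integrable setT (EFin \o f) ->
  (forall w, f w <= c) -> \int[P]_w f w <= c.
Proof.
move=> If fc; rewrite -[leRHS]Rintegral_prob_cst.
by apply: le_Rintegral => //; exact: integrable_cst.
Qed.

(** The derivative of the integrand in [u] is bounded by |X| uniformly in [u], so a first moment
    suffices to differentiate under the integral. *)
Lemma is_derive_Rintegral_cos X r b : measurable_fun setT X ->
  P.-integrable setT (EFin \o X) ->
  is_derive r (1:R) (fun u => \int[P]_w cos (u * X w + b))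
    (- \int[P]_w (X w * sin (r * X w + b))).
Proof.
move=> mX iX.
have part x w : derive1 (fun u : R => cos (u * X w + b)) x = - (X w * sin (x * X w + b)).
  by rewrite derive1E; have H := is_derive_cos_affine (X w) b x; exact: derive_val.
have H : h^-1 *: ((\int[P]_w cos ((h + r) * X w + b)) - \int[P]_w cos (r * X w + b))
    @[h --> 0^'] --> \int[P]_w derive1 (fun u : R => cos (u * X w + b)) r.
  have ri : r \in `]r - 1, r + 1[ by rewrite in_itv/= ltrBlDr ltrDl ltr01.
  apply: (@cvg_differentiation_under_integral _ _ _ P (fun u w => cos (u * X w + b))
    setT measurableT r (r - 1) (r + 1) _ _ _ (fun w => `|X w|)) => //.
  - move=> x _; apply: (@integrable_ub _ 1); first exact: measurable_cos_affine.
    by move=> w; exact: cos_max.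
  - exact: integrable_norm.
  - move=> x w _ _; rewrite /partial1of2 part normrN normrM ler_piMr//.
    exact: sin_max.
have intE : \int[P]_w derive1 (fun u : R => cos (u * X w + b)) r =
    - \int[P]_w (X w * sin (r * X w + b)).
  rewrite -mulN1r -RintegralZl//; last first.
    apply: (le_integrable measurableT _ _ iX) => /=.
      apply/measurable_EFinP; apply: measurable_funM => //.
      exact: measurable_sin_affine.
    by move=> w _; rewrite lee_fin normrM ler_piMr// sin_max.
  by apply: eq_Rintegral => w _; rewrite part mulN1r.
rewrite intE in H.
set F := (fun u => \int[P]_w cos (u * X w + b)) in H *.
have H' : h^-1 *: (F (h *: (1:R) + r) - F r) @[h --> 0^'] -->
    - \int[P]_w (X w * sin (r * X w + b)).
  by under eq_fun do rewrite scaler1.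
by split; [apply/cvg_ex; eexists; exact: H'|exact/cvg_lim].
Qed.

End expectation_tools.

(** * Characteristic function of a normal variable *)

Section normal_characteristic_function.
Context {R : realType}.
Notation mu := (@lebesgue_measure R).
Implicit Types s r b : R.

Lemma normal_pdf0E s : s != 0 ->
  normal_pdf 0 s = (fun x => normal_peak s * expR (x ^+ 2 * (- (2 * s ^+ 2)^-1))).
Proof.
move=> s0; rewrite normal_pdfE//; apply/funext => x.
by rewrite /normal_fun subr0 mulNr mulrN -mulr_natl.
Qed.

(** Half of the exponent absorbs |x|, since y <= exp(y^2) for y = |x| / (2|s|); the other half is
    the density of scale sqrt(2) s. The bound yields both the first moment and the decay at
    infinity. *)
Lemma normal_pdf_norm_le s x : s != 0 ->
  `|x| * normal_pdf 0 s x <=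
  2 * `|s| * normal_peak s / normal_peak (Num.sqrt 2 * s) *
  normal_pdf 0 (Num.sqrt 2 * s) x.
Proof.
move=> s0.
have t0 : Num.sqrt 2 * s != 0 :> R by rewrite mulf_neq0// sqrtr_eq0 -ltNge.
have p0 := normal_peak_gt0 s0; have q0 := normal_peak_gt0 t0.
have a0 : 0 < `|s| by rewrite normr_gt0.
rewrite !normal_pdf0E// exprMn sqr_sqrtr//.
set e2 := expR (x ^+ 2 * - (2 * (2 * s ^+ 2))^-1).
have -> : expR (x ^+ 2 * - (2 * s ^+ 2)^-1) = e2 * e2.
  by rewrite -expRD; congr expR; field.
have -> : 2 * `|s| * normal_peak s / normal_peak (Num.sqrt 2 * s) *
    (normal_peak (Num.sqrt 2 * s) * e2) = normal_peak s * (2 * `|s| * e2).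
  by field; rewrite gt_eqF.
rewrite mulrCA ler_pM2l// mulrA ler_pM2r ?expR_gt0//.
have -> : e2 = (expR ((`|x| / (2 * `|s|)) ^+ 2))^-1.
  rewrite -expRN; congr expR; rewrite exprMn exprVn exprMn !real_normK ?num_real//.
  by field.
rewrite ler_pdivrMr ?expR_gt0//.
set y := `|x| / _; have -> : `|x| = 2 * `|s| * y by rewrite /y; field; rewrite gt_eqF.
rewrite ler_pM2l ?mulr_gt0//; apply: le_trans (expR_ge1Dx _).
have : 0 <= (y - 1) ^+ 2 by exact: sqr_ge0.
have : 0 <= y ^+ 2 by exact: sqr_ge0.
have : (y - 1) ^+ 2 = y ^+ 2 - 2 * y + 1 by ring.
by move=> ->; lra.
Qed.

Lemma cvg0_div_bound (f : R -> R) (K : R) : (forall x, `|x| * `|f x| <= K) ->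
  f x @[x --> +oo] --> (0:R) /\ f x @[x --> -oo] --> (0:R).
Proof.
move=> fK.
have K0 : 0 <= K by apply: le_trans (fK 0); rewrite normr0 mul0r.
have fe e x : 0 < e -> K / e < `|x| -> `|f x| < e.
  move=> e0 Kx; have x0 : 0 < `|x| by apply: le_lt_trans Kx; rewrite divr_ge0// ltW.
  rewrite -(ltr_pM2l x0) (le_lt_trans (fK x))//.
  by rewrite -ltr_pdivrMr.
split; apply/cvgr0Pnorm_lt => e e0; near=> x; apply: fe => //.
  apply: lt_le_trans (ler_norm x); near: x; apply: nbhs_pinfty_gt; exact: num_real.
rewrite -normrN; apply: lt_le_trans (ler_norm _); rewrite ltrNr.
by near: x; apply: nbhs_ninfty_lt; exact: num_real.
Unshelve. all: by end_near.
Qed.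

Lemma integrable_normal_id s : s != 0 ->
  (normal_prob 0 s).-integrable setT (EFin \o (fun x : R => x)).
Proof.
move=> s0.
suff [] : (normal_prob 0 s).-integrable setT (EFin \o (fun x : R => x)) /\
    \int[normal_prob 0 s]_x x = \int[mu]_x (x * normal_pdf 0 s x) by [].
apply: integral_normal_prob => //.
set c := 2 * `|s| * normal_peak s / normal_peak (Num.sqrt 2 * s).
apply: (le_integrable measurableT _ _ (integrableZl measurableT c
   (integrable_normal_pdf 0 (Num.sqrt 2 * s)))).
  by apply/measurable_EFinP; apply: measurable_funM => //; exact: measurable_normal_pdf.
move=> x _ /=; rewrite lee_fin normrM (ger0_norm (normal_pdf_ge0 _ _ _)).
by rewrite (le_trans (normal_pdf_norm_le x s0))// ler_norm.
Qed.

Lemma is_derive_normal_pdf s x : s != 0 ->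
  is_derive x (1:R) (normal_pdf 0 s) (- (x / s ^+ 2) * normal_pdf 0 s x).
Proof.
move=> s0; rewrite normal_pdf0E//.
have -> : (fun x => normal_peak s * expR (x ^+ 2 * (- (2 * s ^+ 2)^-1))) =
  normal_peak s \*: (fun x => expR (x ^+ 2 * (- (2 * s ^+ 2)^-1))) by [].
have H := is_derive_expR_sqr (- (2 * s ^+ 2)^-1) x.
apply: is_derive_eq; rewrite /GRing.scale /=.
by field.
Qed.

(** Let phi be the density. Since phi' = - x phi / s^2, the derivative of sin(r x + b) phi(x) is r
    cos(r x + b) phi - s^-2 x sin(r x + b) phi, whose integral vanishes. *)
Lemma integral_normal_ibp s r b : s != 0 ->
  \int[normal_prob 0 s]_x (x * sin (r * x + b)) =
  r * s ^+ 2 * \int[normal_prob 0 s]_x cos (r * x + b).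
Proof.
move=> s0.
have msin := @measurable_sin_affine R _ R id r b (@measurable_id _ _ _).
have mcos := @measurable_cos_affine R _ R id r b (@measurable_id _ _ _).
have mp := @measurable_normal_pdf R 0 s.
have icos := integrable_ub (normal_prob 0 s) mcos (fun w => cos_max _).
have ixsin : (normal_prob 0 s).-integrable setT (EFin \o (fun x => x * sin (r * x + b))).
  apply: (le_integrable measurableT _ _ (integrable_normal_id s0)).
    by apply/measurable_EFinP; exact: measurable_funM.
  by move=> x _; rewrite /= lee_fin normrM ler_piMr// sin_max.
have sub : forall f : R -> R, measurable_fun setT f ->
    (normal_prob 0 s).-integrable setT (EFin \o f) ->
    mu.-integrable setT (fun x => (f x * normal_pdf 0 s x)%:E).
  move=> f mf /integrableP[_]; rewrite ge0_integral_normal_prob//; last first.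
    by apply: measurableT_comp => //; exact/measurable_EFinP.
  move=> fin; apply/integrableP; split.
    by apply/measurable_EFinP; exact: measurable_funM.
  move: fin; congr (_ < _)%E; apply: eq_integral => x _ /=.
  by rewrite normrM EFinM (ger0_norm (normal_pdf_ge0 _ _ _)).
have mxsin : measurable_fun setT (fun x : R => x * sin (r * x + b)).
  exact: measurable_funM.
have [_ ->] := integral_normal_prob mxsin (sub _ mxsin ixsin).
have [_ ->] := integral_normal_prob mcos (sub _ mcos icos).
pose f x := r * (cos (r * x + b) * normal_pdf 0 s x)
   - (s ^+ 2)^-1 * (x * sin (r * x + b) * normal_pdf 0 s x).
have i1 := integrableZl measurableT r (sub _ mcos icos).
have i2 := integrableZl measurableT (s ^+ 2)^-1 (sub _ mxsin ixsin).
have H : \int[mu]_x f x = 0.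
  have cpdf := continuous_normal_pdf (m:=0) s0.
  have caff : continuous (fun x : R => r * x + b).
    move=> x; apply: cvgD; last exact: cvg_cst.
    by apply: cvgM; [exact: cvg_cst|exact: cvg_id].
  have ccos : continuous (fun x : R => cos (r * x + b)).
    by move=> x; apply: continuous_comp; [exact: caff|exact: continuous_cos].
  have csin : continuous (fun x : R => sin (r * x + b)).
    by move=> x; apply: continuous_comp; [exact: caff|exact: continuous_sin].
  have Fb x : `|x| * `|sin (r * x + b) * normal_pdf 0 s x| <=
      2 * `|s| * normal_peak s / normal_peak (Num.sqrt 2 * s) *
       normal_peak (Num.sqrt 2 * s).
     rewrite normrM mulrCA -[leRHS]mul1r ler_pM ?sin_max//.
    rewrite (ger0_norm (normal_pdf_ge0 _ _ _)) (le_trans (normal_pdf_norm_le x s0))//.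
    rewrite ler_wpM2l//; last first.
      by apply: normal_pdf_ub; rewrite mulf_neq0// sqrtr_eq0 -ltNge.
    by rewrite divr_ge0 ?mulr_ge0 ?normal_peak_ge0.
  have [F1 F2] := cvg0_div_bound Fb.
  apply: (@integral_derive_eq0 R (fun x => sin (r * x + b) * normal_pdf 0 s x)) => //.
  - move=> x; have H1 : is_derive x (1:R) (fun x => sin (r * x + b)) (r * cos (r * x + b)).
      have -> : (fun x => sin (r * x + b)) = (fun x => sin (x * r + b)).
        by apply/funext => y; rewrite (mulrC r).
      by rewrite (mulrC r x); exact: is_derive_sin_affine.
    apply: (is_derive_eq (is_derive_mul H1 (is_derive_normal_pdf x s0))).
    by rewrite /f; field.
  - move=> x; apply: cvgB; apply: cvgM; try exact: cvg_cst.
      by apply: cvgM; [exact: ccos|exact: cpdf].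
    apply: cvgM; last exact: cpdf.
    by apply: cvgM; [exact: cvg_id|exact: csin].
  - have := integrableB measurableT i1 i2; apply: eq_integrable => //.
move: H; rewrite /f RintegralB// ?RintegralZl//; [|exact: sub..] => /eqP.
rewrite subr_eq0 => /eqP H.
by rewrite [RHS]mulrAC H; field.
Qed.

(** As a function of r the integral solves psi' = - r s^2 psi, so psi exp(r^2 s^2 / 2) is constant,
    equal to its value cos b at 0. The free phase [b] stands in for the real and imaginary parts of
    the complex exponential. *)
Lemma cf_normal_prob s r b : s != 0 ->
  \int[normal_prob 0 s]_x cos (r * x + b) = cos b * expR (r ^+ 2 * (- (s ^+ 2 / 2))).
Proof.
move=> s0.
pose psi r := \int[normal_prob 0 s]_x cos (r * x + b).
have dpsi u : is_derive u (1:R) psi (- (u * s ^+ 2 * psi u)).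
  rewrite /psi -integral_normal_ibp//.
  exact: (@is_derive_Rintegral_cos _ _ _ (normal_prob 0 s) id u b (@measurable_id _ _ _) (integrable_normal_id s0)).
have dg u : is_derive u (1:R) (fun u => psi u * expR (u ^+ 2 * (s ^+ 2 / 2))) 0.
  apply: is_derive_eq (is_derive_mul (dpsi u) (is_derive_expR_sqr (s ^+ 2 / 2) u)) _.
  by field.
have := is_derive_0_is_cst r 0 dg.
rewrite /= expr0n/= mul0r expR0 mulr1 {2}/psi.
under eq_Rintegral do rewrite mul0r add0r.
rewrite Rintegral_prob_cst => <-.
by rewrite mulrN expRN -mulrA divff ?mulr1// gt_eqF// expR_gt0.
Qed.

End normal_characteristic_function.

Section normal_variables.
Context d (T : measurableType d) (R : realType) (P : probability T R).

Lemma has_law_integral d' (T' : measurableType d') (X : T -> T')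
    (Q : probability T' R) (f : T' -> R) :
  measurable_fun setT X -> has_law P X Q -> measurable_fun setT f ->
  Q.-integrable setT (EFin \o f) ->
  P.-integrable setT (EFin \o (f \o X)) /\
  \int[P]_w f (X w) = \int[Q]_x f x.
Proof.
move=> mX lX mf iQ.
have E (g : T' -> \bar R) : (\int[Q]_x g x = \int[pushforward P X]_x g x)%E.
  by apply: eq_measure_integral => A mA _; exact/esym/lX.
have iX : P.-integrable setT (EFin \o (f \o X)).
  apply/integrableP; split.
    by apply/measurable_EFinP; exact: measurableT_comp.
  case/integrableP : iQ => _; rewrite E ge0_integral_pushforward//.
  by do 2 apply: measurableT_comp => //; exact/measurable_EFinP.
split=> //; rewrite /Rintegral; congr fine.
rewrite E integral_pushforward//; exact/measurable_EFinP.
Qed.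

Lemma normal_law_integral (X : T -> R) (v r b : R) : measurable_fun setT X ->
  0 <= v -> has_law P X (normal_law 0 v) ->
  P.-integrable setT (EFin \o X) /\
  \int[P]_w cos (r * X w + b) = cos b * expR (- (r ^+ 2 * v / 2)).
Proof.
(* Linear forms of a singular Gaussian vector may have variance 0; their law is then a point mass
   and not a [normal_prob]. *)
move=> mX v0 lX; have [vE|vN0] := eqVneq v 0.
  have lX0 : has_law P X (\d_(0:R)).
    by move=> A mA; rewrite lX// /normal_law vE eqxx.
  have fact (f : R -> R) : measurable_fun setT f ->
      P.-integrable setT (EFin \o (f \o X)) /\ \int[P]_w f (X w) = f 0.
    move=> mf.
    have idir : (\d_(0:R)).-integrable setT (EFin \o f).
      apply/integrableP; split; first exact/measurable_EFinP.
      rewrite integral_dirac//=; last first.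
        by do 2 apply: measurableT_comp => //; exact/measurable_EFinP.
      by rewrite /dirac indicT mul1e ltry.
    have [iX ->] := has_law_integral mX lX0 mf idir; split=> //.
    rewrite /Rintegral integral_dirac//=; last exact/measurable_EFinP.
    by rewrite /dirac indicT /= mul1r.
  split; first by have [] := fact id (@measurable_id _ _ _).
  have [_ ->] := fact (fun x => cos (r * x + b)) (measurable_cos_affine _ _ (@measurable_id _ _ _)).
  by rewrite vE !(mulr0, mul0r) oppr0 expR0 mulr1 add0r.
have s0 : Num.sqrt v != 0 by rewrite sqrtr_eq0 -ltNge lt_neqAle eq_sym vN0.
have lX0 : has_law P X (normal_prob 0 (Num.sqrt v)).
  by move=> A mA; rewrite lX// /normal_law (negbTE vN0).
split.
  by have [] := @has_law_integral _ (measurableTypeR R) X (normal_prob 0 (Num.sqrt v)) id mX lX0 (@measurable_id _ _ _) (integrable_normal_id s0).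
have mc := measurable_cos_affine r b (@measurable_id _ (measurableTypeR R) setT).
have [_ ->] := @has_law_integral _ (measurableTypeR R) X (normal_prob 0 (Num.sqrt v)) _ mX lX0 mc (integrable_ub _ mc (fun w => cos_max _)).
by rewrite cf_normal_prob// sqr_sqrtr// mulrN mulrA.
Qed.

End normal_variables.

Definition bounded_measurable d (T : measurableType d) (R : realType)
    (f : T -> R) : Prop :=
  measurable_fun setT f /\ exists M, forall x, `|f x| <= M.

(** * Expectations of products of independent variables *)

Section independent_products.
Context d (T : measurableType d) (R : realType) (P : probability T R).

Lemma bounded_measurable_comp d' (T' : measurableType d') (f : T' -> R)
    (Y : T -> T') :
  measurable_fun setT Y -> bounded_measurable f -> bounded_measurable (f \o Y).
Proof.
by move=> mY [mf [M fM]]; split; [exact: measurableT_comp|exists M => x; exact: fM].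
Qed.

Lemma bounded_measurableM (f g : T -> R) :
  bounded_measurable f -> bounded_measurable g ->
  bounded_measurable (fun w => f w * g w).
Proof.
move=> [mf [M fM]] [mg [N gN]]; split; first exact: measurable_funM.
by exists (M * N) => x; rewrite normrM ler_pM.
Qed.

Lemma bounded_measurable_prod (I : Type) (s : seq I) (F : I -> T -> R) :
  (forall i, bounded_measurable (F i)) ->
  bounded_measurable (fun w => \prod_(i <- s) F i w).
Proof.
move=> bF; elim: s => [|i s IH].
  split; first by under eq_fun do rewrite big_nil; exact: measurable_cst.
  by exists 1 => x; rewrite big_nil normr1.
have -> : (fun w => \prod_(j <- i :: s) F j w) =
          (fun w => F i w * \prod_(j <- s) F j w).
  by apply/funext => w; rewrite big_cons.
exact: bounded_measurableM.
Qed.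

Lemma bounded_measurable_integrable (f : T -> R) : bounded_measurable f ->
  P.-integrable setT (EFin \o f).
Proof. by move=> [mf [M fM]]; exact: integrable_ub fM. Qed.

Import HBNNSimple.

(** The identity is linear in [g] and survives bounded pointwise limits, so it passes from
    indicators to simple functions and then to the nonnegative function g + M. The constant M is
    removed at the end because the case A = setT says that H has integral c. *)
Lemma Rintegral_indic_extend d' (T' : measurableType d') (Y : T -> T')
    (H : T -> R) (c : R) (g : T' -> R) :
  measurable_fun setT Y -> bounded_measurable H ->
  (forall A, measurable A ->
    \int[P]_w (H w * \1_A (Y w)) = c * \int[P]_w \1_A (Y w)) ->
  bounded_measurable g ->
  \int[P]_w (H w * g (Y w)) = c * \int[P]_w g (Y w).
Proof.
move=> mY bH HA [mg [M gM]].
have [mH [K HK]] := bH.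
have bindic A : measurable A -> bounded_measurable (fun w => \1_A (Y w) : R).
  move=> mA; apply: (bounded_measurable_comp mY); split; first exact: measurable_indic.
  by exists 1 => x; rewrite indicE; case: (_ \in _); rewrite ?normr1 ?normr0.
pose g' x := g x + M.
have g'0 x : (0 <= (g' x)%:E)%E.
  by rewrite lee_fin /g'; have := gM x; rewrite ler_norml => /andP[]; lra.
have mg' : measurable_fun setT (EFin \o g').
  by apply/measurable_EFinP; exact: measurable_funD.
pose h := nnsfun_approx measurableT mg'.
have hE n : \int[P]_w (H w * h n (Y w)) = c * \int[P]_w h n (Y w).
  pose s : seq R := finmap.enum_fset (fset_set (range (h n))).
  have hsum x : h n x = \sum_(y <- s) (y * \1_(h n @^-1` [set y]) x).
    by rewrite fimfunE fsbig_finite.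
  have bi y : bounded_measurable (fun w => \1_(h n @^-1` [set y]) (Y w) : R).
    by apply: bindic; exact: measurable_funPTI.
  have iY y : P.-integrable setT (EFin \o (fun w => \1_(h n @^-1` [set y]) (Y w) : R)).
    exact: bounded_measurable_integrable.
  have iHY y : P.-integrable setT (EFin \o (fun w => H w * \1_(h n @^-1` [set y]) (Y w))).
    by apply: bounded_measurable_integrable; exact: bounded_measurableM.
  under eq_Rintegral do rewrite hsum mulr_sumr.
  under [in RHS]eq_Rintegral do rewrite hsum.
  rewrite !Rintegral_sum; first last.
  - move=> y; under [in X in EFin \o X]eq_fun do rewrite mulrCA.
    exact: integrableZ.
  - by move=> y; exact: integrableZ.
  rewrite mulr_sumr; apply: eq_bigr => y _.
  under eq_Rintegral do rewrite mulrCA.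
  rewrite !RintegralZl// HA; first by rewrite mulrCA.
  exact: measurable_funPTI.
have hub n x : `|h n x| <= 2 * M.
  rewrite ger0_norm//; apply: (@le_trans _ _ (g' x)).
    have := @le_approx _ _ _ setT (EFin \o g') n x (fun x _ => g'0 x) I.
    by rewrite /h nnsfun_approxE lee_fin.
  by rewrite /g'; have := gM x; rewrite ler_norml => /andP[]; lra.
have hlim x : h n x @[n --> \oo] --> g' x.
  have := @cvg_nnsfun_approx _ _ _ setT measurableT (EFin \o g') mg' (fun x _ => g'0 x) x I.
  by move/fine_cvg.
have K0 : 0 <= K by apply: le_trans (HK point).
have [i1 l1] := @Rintegral_dominated _ _ _ P (fun n w => h n (Y w)) (fun w => g' (Y w))
  (fun=> 2 * M) (fun n => measurableT_comp (measurable_funPT (h n)) mY)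
  (fun w => hlim (Y w)) (integrable_cst _ _) (fun n w => hub n (Y w)).
have [i2 l2] : P.-integrable setT (EFin \o (fun w => H w * g' (Y w))) /\
   \int[P]_w (H w * h n (Y w)) @[n --> \oo] --> \int[P]_w (H w * g' (Y w)).
  apply: (@Rintegral_dominated _ _ _ P _ _ (fun=> K * (2 * M))).
  - move=> n; apply: measurable_funM => //.
    exact: measurableT_comp (measurable_funPT (h n)) mY.
  - by move=> w; apply: cvgM; [exact: cvg_cst|exact: hlim].
  - exact: integrable_cst.
  - by move=> n w; rewrite normrM ler_pM.
have E : \int[P]_w (H w * g' (Y w)) = c * \int[P]_w g' (Y w).
  have l3 : \int[P]_w (H w * h n (Y w)) @[n --> \oo] --> c * \int[P]_w g' (Y w).
    rewrite (_ : (fun n => _) = (fun n => c * \int[P]_w h n (Y w))); last first.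
      by apply/funext => n; rewrite hE.
    by apply: cvgM => //; exact: cvg_cst.
  exact: (cvg_unique _ l2 l3).
have EH : \int[P]_w H w = c.
  have := HA _ (@measurableT _ T').
  under eq_Rintegral do rewrite indicT mulr1.
  by under [in RHS]eq_Rintegral do rewrite indicT; rewrite Rintegral_prob_cst mulr1.
have bgY : bounded_measurable (fun w => g (Y w)).
  by apply: (bounded_measurable_comp mY); split => //; exists M.
have ig := bounded_measurable_integrable bgY.
have iHg := bounded_measurable_integrable (bounded_measurableM bH bgY).
have iH := bounded_measurable_integrable bH.
move: E; rewrite /g'.
under eq_Rintegral do rewrite mulrDr.
have iHM : P.-integrable setT (EFin \o (fun w => H w * M)).
  apply: bounded_measurable_integrable; apply: bounded_measurableM => //.
  by split=> //; exists `|M|.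
rewrite (RintegralD measurableT iHg iHM) (RintegralD measurableT ig (integrable_cst P M)).
rewrite RintegralZr// EH Rintegral_prob_cst mulrDr.
exact: addIr.
Qed.

(** When every [g i] is an indicator this is independence itself. The induction is on a bound for
    the size of a set [K] of indices outside which the functions are indicators. *)
Lemma independent_Rintegral_prod d' (T' : measurableType d') (I : finType)
    (X : I -> T -> T') (g : I -> T' -> R) :
  mutually_independent P X -> (forall i, measurable_fun setT (X i)) ->
  (forall i, bounded_measurable (g i)) ->
  \int[P]_w (\prod_i g i (X i w)) = \prod_i \int[P]_w g i (X i w).
Proof.
move=> indX mX.
suff main n (K : {set I}) : (#|K| <= n)%N -> forall g : I -> T' -> R,
    (forall i, bounded_measurable (g i)) ->
    (forall i, i \notin K -> exists2 A, measurable A & g i = \1_A) ->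
    \int[P]_w (\prod_i g i (X i w)) = \prod_i \int[P]_w g i (X i w).
  by move=> bg; apply: (main _ [set: I]%SET (leqnn _) g bg) => i; rewrite inE.
elim: n K => [|n IH] K.
  rewrite leqn0 cards_eq0 => /eqP -> {}g bg gA.
  have /choice[A mA] : forall i, exists A, measurable A /\ g i = \1_A.
    by move=> i; have [|A mA gi] := gA i; [rewrite inE|exists A].
  have mXA i : measurable (X i @^-1` A i).
    by rewrite -[X in measurable X]setTI; apply: mX => //; exact: (mA i).1.
  transitivity (fine (P (\bigcap_(i in [set` [set: I]%SET]) (X i @^-1` A i)))).
    rewrite -[in RHS](setIT (\bigcap_(i in _) _)) -integral_indic//; last first.
      by apply: fin_bigcap_measurable => //; exact: finite_finset.
    apply: eq_Rintegral => w _.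
    under eq_bigr do rewrite (mA _).2.
    rewrite indicE; case: (boolP (w \in _)) => /=.
      rewrite inE => wA; rewrite big1// => i _; rewrite indicE mem_set//.
      by apply: wA; rewrite /= inE.
    move=> nw; apply/eqP; rewrite prodf_seq_eq0; apply: contraNT nw.
    rewrite -all_predC => /allP h; rewrite inE => i _ /=.
    have /= := h i (mem_index_enum _); rewrite indicE.
    by have [/set_mem//|] := boolP (X i w \in A i); rewrite eqxx.
  rewrite indX; last by move=> i; exact: (mA i).1.
  have -> : (\prod_(i in [set: I]%SET) P (X i @^-1` A i) =
     (\prod_i \int[P]_w g i (X i w))%:E)%E.
    rewrite -prodEFin; apply: eq_big => i; first by rewrite inE.
    move=> _; rewrite (mA i).2 /Rintegral.
    have -> : (\int[P]_w (\1_(A i) (X i w))%:E = P (X i @^-1` A i))%E.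
      by rewrite -[in RHS](setIT (_ @^-1` _)) -integral_indic.
    by rewrite fineK// fin_num_measure.
  by [].
move=> cK {}g bg gA.
have [K0|[k kK]] := set_0Vmem K.
  by apply: (IH K) => //; rewrite K0 cards0.
have bgX i : bounded_measurable (fun w => g i (X i w)).
  exact: bounded_measurable_comp (mX i) (bg i).
have split2 (f : I -> R) : \prod_i f i = (\prod_(i | i != k) f i) * f k.
  by rewrite (bigD1 k)//= mulrC.
under eq_Rintegral do rewrite split2.
rewrite split2.
apply: (@Rintegral_indic_extend _ _ (X k) (fun w => \prod_(i | i != k) g i (X i w))) => //.
  under eq_fun do rewrite -big_filter.
  exact: bounded_measurable_prod.
move=> A mA.
(* With [g k] replaced by an indicator, [k] leaves the exceptional set; the induction hypothesis
   then supplies the premise of [Rintegral_indic_extend]. *)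
pose g' i := if i == k then \1_A else g i.
have g'k : g' k = \1_A by rewrite /g' eqxx.
have g'i i : i != k -> g' i = g i by rewrite /g' => /negbTE ->.
have E w : \prod_(i | i != k) g' i (X i w) = \prod_(i | i != k) g i (X i w).
  by apply: eq_bigr => i ik; rewrite g'i.
have E2 : \prod_(i | i != k) \int[P]_w g i (X i w) =
    \prod_(i | i != k) \int[P]_w g' i (X i w).
  by apply: eq_bigr => i ik; rewrite g'i.
have E3 w : (\prod_(i | i != k) g i (X i w)) * \1_A (X k w) = \prod_i g' i (X i w).
  by rewrite split2 g'k E.
rewrite E2 -g'k -split2; under eq_Rintegral do rewrite g'k E3.
apply: (IH (K :\ k)%SET).
- by move: cK; rewrite (cardsD1 k) kK.
- move=> i; rewrite /g'; case: ifP => // _; split; first exact: measurable_indic.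
  by exists 1 => x; rewrite indicE; case: (_ \in _); rewrite ?normr1 ?normr0.
- move=> i; rewrite !inE negb_and negbK /g'; case: eqP => [_ _|_ /= /gA//].
  by exists A.
Qed.

End independent_products.

(** The law N(0, S) told by cosines of arbitrary phase, sines being cosines shifted by pi / 2.
    Nothing is asked of [S], so singular matrices are included; [gaussian_cf_qf_ge0] recovers that
    the quadratic form is nonnegative. *)
Definition gaussian_cf d (T : measurableType d) (R : realType)
    (P : probability T R) p (X : 'I_p -> T -> R) (S : 'I_p -> 'I_p -> R) : Prop :=
  [/\ forall j, measurable_fun setT (X j),
      forall j, P.-integrable setT (EFin \o X j) &
      forall (a : 'I_p -> R) b,
        \int[P]_w cos (\sum_j a j * X j w + b) =
        cos b * expR (- ((\sum_j \sum_k a j * a k * S j k) / 2))].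

Section independent_sums.
Context d (T : measurableType d) (R : realType) (P : probability T R).

Lemma sin_cosB (x : R) : sin x = cos (x - pi / 2).
Proof. by rewrite cosB cos_pihalf sin_pihalf mulr0 add0r mulr1. Qed.

(** A summand g is split off by cos(A + g) = cos A cos g - sin A sin g. The last term has mean 0,
    since E sin g = cos(- pi / 2) phi = 0. *)
Lemma cf_independent_sum d' (T' : measurableType d') (I : finType)
    (X : I -> T -> T') (g : I -> T' -> R) (phi : I -> R) (b : R) :
  mutually_independent P X -> (forall i, measurable_fun setT (X i)) ->
  (forall i, measurable_fun setT (g i)) ->
  (forall i b, \int[P]_w cos (g i (X i w) + b) = cos b * phi i) ->
  \int[P]_w cos (\sum_i g i (X i w) + b) = cos b * \prod_i phi i.
Proof.
move=> indX mX mg gphi.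
have bcos i c : bounded_measurable (fun x => cos (g i x + c)).
  split; last by exists 1 => x; exact: cos_max.
  have := measurable_cos_affine 1 c (mg i).
  by under eq_fun do rewrite mul1r.
(* Arbitrary bounded factors of the variables outside [s] make room for the cosine or sine of the
   summand that is split off. *)
suff main (s : seq I) : uniq s -> forall (h : I -> T' -> R) c,
    (forall i, bounded_measurable (h i)) ->
    \int[P]_w (cos (\sum_(i <- s) g i (X i w) + c) * \prod_(i | i \notin s) h i (X i w)) =
    cos c * \prod_(i <- s) phi i * \prod_(i | i \notin s) \int[P]_w h i (X i w).
  have b1 (i : I) : bounded_measurable (fun _ : T' => 1 : R).
    by split; [exact: measurable_cst|exists 1 => x; rewrite normr1].
  have E := main _ (index_enum_uniq I) (fun _ _ => 1) b b1.
  have none (F : I -> R) : \prod_(i | i \notin index_enum I) F i = 1.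
    by rewrite big1// => i; rewrite mem_index_enum.
  transitivity (\int[P]_w (cos (\sum_i g i (X i w) + b) *
      \prod_(i | i \notin index_enum I) (fun=> 1) (X i w))).
    by apply: eq_Rintegral => w _; rewrite none mulr1.
  by rewrite E none mulr1.
have bhX (h : I -> T' -> R) : (forall i, bounded_measurable (h i)) ->
    forall i, bounded_measurable (fun w => h i (X i w)).
  by move=> bh i; exact: bounded_measurable_comp (mX i) (bh i).
have bprod (h : I -> T' -> R) (Q : pred I) : (forall i, bounded_measurable (h i)) ->
    bounded_measurable (fun w => \prod_(i | Q i) h i (X i w)).
  move=> bh; under eq_fun do rewrite -big_filter.
  by apply: bounded_measurable_prod => i; exact: bhX.
elim: s => [_ h c bh|k s IH /= /andP[ks us] h c bh].
  under eq_Rintegral do rewrite big_nil add0r.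
  rewrite RintegralZl//; last first.
    by apply: bounded_measurable_integrable; exact: bprod.
  by rewrite big_nil mulr1 -(independent_Rintegral_prod indX mX bh).
pose h1 i := if i == k then (fun x => cos (g i x + 0)) else h i.
pose h2 i := if i == k then (fun x => cos (g i x + (- (pi / 2)))) else h i.
have bh1 i : bounded_measurable (h1 i) by rewrite /h1; case: ifP.
have bh2 i : bounded_measurable (h2 i) by rewrite /h2; case: ifP.
have prodk (F F' : I -> R) : (forall i, i != k -> F' i = F i) ->
    \prod_(i | i \notin s) F' i = F' k * \prod_(i | i \notin k :: s) F i.
  move=> FF'; rewrite (bigD1 k)//=; congr (_ * _).
  apply: eq_big => [i|i /andP[_ ik]]; last exact: FF'.
  by rewrite inE negb_or andbC.
have e1 w : \prod_(i | i \notin s) h1 i (X i w) =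
    cos (g k (X k w)) * \prod_(i | i \notin k :: s) h i (X i w).
  rewrite (prodk (fun i => h i (X i w))) ?/h1 ?eqxx ?addr0// => i /negbTE ->//.
have e2 w : \prod_(i | i \notin s) h2 i (X i w) =
    sin (g k (X k w)) * \prod_(i | i \notin k :: s) h i (X i w).
  rewrite (prodk (fun i => h i (X i w))) ?/h2 ?eqxx -?sin_cosB// => i /negbTE ->//.
have I1 := IH us h1 c bh1; have I2 := IH us h2 (c - pi / 2) bh2.
have E1 : \prod_(i | i \notin s) \int[P]_w h1 i (X i w) =
    phi k * \prod_(i | i \notin k :: s) \int[P]_w h i (X i w).
  rewrite (prodk (fun i => \int[P]_w h i (X i w))) ?/h1 ?eqxx.
    by rewrite gphi cos0 mul1r.
  by move=> i /negbTE ->.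
have E2 : \prod_(i | i \notin s) \int[P]_w h2 i (X i w) = 0.
  rewrite (prodk (fun i => \int[P]_w h i (X i w))) ?/h2 ?eqxx.
    by rewrite gphi cosN cos_pihalf !mul0r.
  by move=> i /negbTE ->.
have msum : measurable_fun setT (fun w => \sum_(i <- s) g i (X i w)).
  by apply: measurable_sum => i; exact: measurableT_comp.
have bsum e : bounded_measurable (fun w => cos (\sum_(i <- s) g i (X i w) + e)).
  split; last by exists 1 => x; exact: cos_max.
  have := measurable_cos_affine 1 e msum.
  by under eq_fun do rewrite mul1r.
have i1 : P.-integrable setT (EFin \o (fun w =>
    cos (\sum_(i <- s) g i (X i w) + c) * \prod_(i | i \notin s) h1 i (X i w))).
  by apply: bounded_measurable_integrable; apply: bounded_measurableM => //; exact: bprod.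
have i2 : P.-integrable setT (EFin \o (fun w =>
    cos (\sum_(i <- s) g i (X i w) + (c - pi / 2)) * \prod_(i | i \notin s) h2 i (X i w))).
  by apply: bounded_measurable_integrable; apply: bounded_measurableM => //; exact: bprod.
transitivity (\int[P]_w
   (cos (\sum_(i <- s) g i (X i w) + c) * \prod_(i | i \notin s) h1 i (X i w) -
    cos (\sum_(i <- s) g i (X i w) + (c - pi / 2)) * \prod_(i | i \notin s) h2 i (X i w))).
  apply: eq_Rintegral => w _; rewrite e1 e2 big_cons addrA -sin_cosB.
  by rewrite -addrA cosD; ring.
by rewrite RintegralB// I1 I2 E1 E2 big_cons; ring.
Qed.

Lemma independent_sum_gaussian_cf d' (T' : measurableType d') (I : finType) p
    (X : I -> T -> T') (g : I -> 'I_p -> T' -> R)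
    (S : I -> 'I_p -> 'I_p -> R) :
  mutually_independent P X -> (forall i, measurable_fun setT (X i)) ->
  (forall i j, measurable_fun setT (g i j)) ->
  (forall i, gaussian_cf P (fun j w => g i j (X i w)) (S i)) ->
  gaussian_cf P (fun j w => \sum_i g i j (X i w)) (fun j k => \sum_i S i j k).
Proof.
move=> indX mX mg G; split.
- by move=> j; apply: measurable_sum => i; exact: measurableT_comp.
- by move=> j; apply: integrable_sum_seq => i; have [_ /(_ j)] := G i.
- move=> a b.
  have -> : expR (- ((\sum_j \sum_k a j * a k * (\sum_i S i j k)) / 2)) =
      \prod_i expR (- ((\sum_j \sum_k a j * a k * S i j k) / 2)).
    rewrite -expR_sum; congr expR; rewrite sumrN -mulr_suml; congr (- (_ / 2)).
    rewrite [RHS]exchange_big; apply: eq_bigr => j _ /=.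
    by rewrite [RHS]exchange_big; apply: eq_bigr => k _; rewrite mulr_sumr.
  rewrite -(@cf_independent_sum _ _ _ X (fun i x => \sum_j a j * g i j x))//.
  + apply: eq_Rintegral => w _; congr (cos (_ + _)).
    by rewrite [RHS]exchange_big; apply: eq_bigr => j _; rewrite mulr_sumr.
  + by move=> i; apply: measurable_sum => j; exact: measurable_funM.
  + by move=> i c; have [_ _ ->] := G i.
Qed.

Lemma gaussian_cf_scale p (X : 'I_p -> T -> R) S (c : 'I_p -> R) :
  gaussian_cf P X S ->
  gaussian_cf P (fun j w => c j * X j w) (fun j k => c j * c k * S j k).
Proof.
move=> [mX iX cX]; split.
- by move=> j; exact: measurable_funM.
- by move=> j; exact: integrableZ.
- move=> a b; under eq_Rintegral do under eq_bigr do rewrite mulrA.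
  rewrite (cX (fun j => a j * c j)).
  rewrite (_ : \sum_j _ = \sum_j \sum_k a j * a k * (c j * c k * S j k))//.
  by apply: eq_bigr => j _; apply: eq_bigr => k _; ring.
Qed.

Lemma normal_law_gaussian_cf p (Y : 'I_p -> T -> R) (S : 'I_p -> 'I_p -> R) :
  (forall j, measurable_fun setT (Y j)) ->
  (forall a : 'I_p -> R, 0 <= \sum_j \sum_k a j * a k * S j k) ->
  (forall a : 'I_p -> R, has_law P (fun w => \sum_j a j * Y j w)
     (normal_law 0 (\sum_j \sum_k a j * a k * S j k))) ->
  gaussian_cf P Y S.
Proof.
move=> mY S0 lY.
have mlin a : measurable_fun setT (fun w => \sum_j a j * Y j w).
  by apply: measurable_sum => j; exact: measurable_funM.
split=> // [j|a b].
- have [+ _] := normal_law_integral 1 0 (mlin (fun k => (k == j)%:R)) (S0 _) (lY _).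
  apply: eq_integrable => // w _ /=; congr EFin.
  rewrite (bigD1 j)//= eqxx mul1r big1 ?addr0// => k /negbTE ->.
  by rewrite mul0r.
- have [_] := normal_law_integral 1 b (mlin a) (S0 _) (lY _).
  rewrite expr1n mul1r => <-.
  by apply: eq_Rintegral => w _; rewrite mul1r.
Qed.

End independent_sums.

(** * Polynomial and trigonometric approximation *)

Section polynomial_approximation.
Context {R : realType}.
Implicit Types (phi psi : nat -> R) (x y m M : R) (q : {poly R}).

(* The Bernstein polynomial sum_k phi(k) C(n,k) X^k (1-X)^(n-k), through the
   recursion given by Pascal's rule. *)
Fixpoint bernstein n phi : {poly R} :=
  if n is n'.+1 then
    'X * bernstein n' (phi \o S) + (1 - 'X) * bernstein n' phi
  else (phi 0%N)%:P.

Lemma bernsteinS n phi x : (bernstein n.+1 phi).[x] =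
  x * (bernstein n (phi \o S)).[x] + (1 - x) * (bernstein n phi).[x].
Proof. by rewrite /= !hornerE. Qed.

Lemma bernstein_le n phi psi x : 0 <= x <= 1 ->
  (forall k, (k <= n)%N -> phi k <= psi k) ->
  (bernstein n phi).[x] <= (bernstein n psi).[x].
Proof.
move=> /andP[x0 x1]; elim: n phi psi => [|n IH] phi psi H.
  by rewrite /= !hornerC H.
rewrite !bernsteinS lerD// ler_wpM2l// ?subr_ge0//; apply: IH => k kn.
  exact: (H k.+1).
exact/H/leqW.
Qed.

Lemma bernstein_lin n phi psi (a b : R) x :
  (bernstein n (fun k => a * phi k + b * psi k)).[x] =
  a * (bernstein n phi).[x] + b * (bernstein n psi).[x].
Proof.
elim: n phi psi => [|n IH] phi psi; first by rewrite /= !hornerC.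
rewrite !bernsteinS IH.
have := IH (phi \o S) (psi \o S).
rewrite (_ : (fun k => _) = (fun k => a * phi k + b * psi k) \o S)// => ->.
by ring.
Qed.

Lemma bernstein_cst n (c : R) x : (bernstein n (fun=> c)).[x] = c.
Proof.
elim: n => [|n IH]; first by rewrite /= hornerC.
rewrite bernsteinS (_ : _ \o S = (fun=> c))// IH; ring.
Qed.

(** This is E[(N - c)^2] for N binomial with parameters n and x. The centre [c] stays free because
    Pascal's rule replaces it by c - 1. *)
Lemma bernstein_variance n (c : R) x :
  (bernstein n (fun k => (k%:R - c) ^+ 2)).[x] =
  (n%:R * x - c) ^+ 2 + n%:R * x * (1 - x).
Proof.
elim: n c => [|n IH] c; first by rewrite /= hornerC !mul0r addr0.
rewrite bernsteinS IH.
rewrite (_ : _ \o S = (fun k => (k%:R - (c - 1)) ^+ 2)); last first.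
  by apply/funext => k /=; rewrite -natr1; ring.
by rewrite IH -natr1; ring.
Qed.

(** Bernstein's argument with |z| <= d + z^2 / d in place of Chebyshev's inequality: the operator is
    monotone, so the error at x is at most C (d + x (1 - x) / (d n)), by the variance formula. *)
Lemma weierstrass_lipschitz (f : R -> R) m M (K e : R) : m < M -> 0 < e ->
  (forall u v, m <= u <= M -> m <= v <= M -> `|f u - f v| <= K * `|u - v|) ->
  exists q, forall u, m <= u <= M -> `|f u - q.[u]| <= e.
Proof.
move=> mM e0 fK.
have D0 : 0 < M - m by rewrite subr_gt0.
have K0 : 0 <= K.
  have := fK M m; rewrite !lexx (ltW mM) => /(_ isT isT) /(le_trans (normr_ge0 _)).
  by rewrite pmulr_lge0// gtr0_norm.
pose C := K * (M - m) + 1.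
have C0 : 0 < C by rewrite ltr_wpDl// mulr_ge0// ltW.
(* Each of the two error terms, C d and at most C / (d n), gets half of [e]; hence n is taken above
   d^-2. *)
have [d dE] : exists d, d = e / (2 * C) by eexists.
have d0 : 0 < d by rewrite dE divr_gt0// mulr_gt0.
have [n [n0 nd]] : exists n, 0 < n%:R :> R /\ (d * n%:R)^-1 <= d.
  exists (Num.truncn (d ^- 2)).+1; split; first by rewrite ltr0n.
  rewrite -[leRHS]invrK lef_pV2 ?posrE ?invr_gt0 ?mulr_gt0//.
  by rewrite -ler_pdivrMl// -invfM -expr2 ltW// truncnS_gt.
pose phi k := f (m + (M - m) * (k%:R / n%:R)).
pose q := bernstein n phi.
apply: (ex_intro _ (q \Po ((M - m)^-1 *: ('X - m%:P)))) => u umM; case/andP: (umM) => mu uM.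
rewrite horner_comp !hornerE.
set x := (M - m)^-1 * (u - m).
have uE : u = m + (M - m) * x by rewrite /x mulVKf ?gt_eqF// addrC subrK.
have x01 : 0 <= x <= 1.
  by rewrite /x mulr_ge0 ?invr_ge0 ?subr_ge0 ?(ltW mM)//= ler_pdivrMl// mulr1 lerB.
have main (sg : R) : `|sg| = 1 -> sg * (f u - q.[x]) <= e.
  move=> sg1.
  have -> : sg * (f u - q.[x]) =
     (bernstein n (fun k => sg * (fun=> f u) k + (- sg) * phi k)).[x].
    by rewrite (bernstein_lin n (fun=> f u) phi) bernstein_cst; ring.
  apply: (@le_trans _ _ (bernstein n (fun k => C * d * (fun=> 1) k +
      C / (d * n%:R ^+ 2) * (k%:R - n%:R * x) ^+ 2)).[x]).
    apply: bernstein_le => // k kn.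
    have kn1 : 0 <= k%:R / n%:R :> R by rewrite divr_ge0.
    have kn2 : k%:R / n%:R <= 1 :> R by rewrite ler_pdivrMr// mul1r ler_nat.
    have H := fK _ (m + (M - m) * (k%:R / n%:R)) umM.
    have {}H : `|f u - phi k| <= K * `|u - (m + (M - m) * (k%:R / n%:R))|.
      apply: H; rewrite lerDl mulr_ge0 ?(ltW D0)//=.
      by rewrite -lerBrDl -[leRHS]mulr1 ler_wpM2l ?(ltW D0).
    rewrite mulNr -mulrBr.
    apply: (@le_trans _ _ `|f u - phi k|).
      by rewrite (le_trans (ler_norm _))// normrM sg1 mul1r.
    apply: (le_trans H).
    have -> : u - (m + (M - m) * (k%:R / n%:R)) = (M - m) * (x - k%:R / n%:R).
      by rewrite {1}uE; ring.
    rewrite normrM (gtr0_norm D0) mulrA.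
    have -> : C * d * 1 + C / (d * n%:R ^+ 2) * (k%:R - n%:R * x) ^+ 2 =
        C * (d + (x - k%:R / n%:R) ^+ 2 / d).
      by field; rewrite !gt_eqF.
    rewrite ler_pM ?mulr_ge0// ?(ltW D0)// ?lerDl//.
    set z := x - _; rewrite -(ler_pM2r d0) mulrDl mulfVK ?gt_eqF//.
    rewrite -(real_normK (num_real z)).
    have : 0 <= (`|z| - d) ^+ 2 by exact: sqr_ge0.
    have : 0 <= `|z| * d by rewrite mulr_ge0// ltW.
    by rewrite sqrrB expr2; lra.
  rewrite (bernstein_lin n (fun=> 1) (fun k => (k%:R - n%:R * x) ^+ 2)).
  rewrite bernstein_cst bernstein_variance subrr expr0n/= add0r mulr1.
  have -> : e = C * d + C * d by rewrite dE; field; rewrite gt_eqF.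
  rewrite lerD2l -mulrA ler_pM2l//.
  rewrite (_ : _ * _ = (d * n%:R)^-1 * (x * (1 - x))); last by field; rewrite !gt_eqF.
  rewrite -[leRHS]mulr1; case/andP: x01 => x0 x1.
  have xx0 : 0 <= x * (1 - x) by rewrite mulr_ge0 ?subr_ge0.
  have xx1 : x * (1 - x) <= 1 by rewrite mulr_ile1 ?subr_ge0// gerBl.
  by apply: ler_pM => //; rewrite invr_ge0 mulr_ge0// ltW.
rewrite ler_norml; apply/andP; split.
  by rewrite lerNl -mulN1r; apply: main; rewrite normrN1.
by rewrite -[leLHS]mul1r; apply: main; rewrite normr1.
Qed.

Lemma poly_antiderivative q : exists Q : {poly R}, Q^`() = q.
Proof.
exists (\sum_(i < size q) (q`_i / (nat_of_ord i).+1%:R) *: 'X^((nat_of_ord i).+1)).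
rewrite raddf_sum -[RHS]coefK poly_def; apply: eq_bigr => i _.
by rewrite /= derivZ derivXn /= -scalerMnr scalerMnl -[(_ / _) *+ _]mulr_natr divfK// pnatr_eq0.
Qed.

Lemma poly_lift_derivative (f0 f1 : R -> R) m M e q : m <= M ->
  (forall u, m <= u <= M -> is_derive u (1:R) f0 (f1 u)) ->
  (forall u, m <= u <= M -> `|f1 u - q.[u]| <= e) ->
  exists Q, Q^`() = q /\ forall u, m <= u <= M -> `|f0 u - Q.[u]| <= e * (M - m).
Proof.
move=> mM df fq; have [Q0 dQ0] := poly_antiderivative q.
pose Q := Q0 + (f0 m - Q0.[m])%:P.
have dQ : Q^`() = q by rewrite derivD derivC addr0.
exists Q; split=> // u /andP[mu uM].
have Qm : f0 m - Q.[m] = 0 by rewrite /Q hornerD hornerC; ring.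
have dg x : m <= x <= M -> is_derive x (1:R) (fun x => f0 x - Q.[x]) (f1 x - q.[x]).
  move=> xmM; have H := df _ xmM; have HQ := is_derive_poly Q x; rewrite dQ in HQ.
  exact: is_deriveB.
have [//|x||c cmu] := @MVT_segment R (fun x => f0 x - Q.[x]) (fun x => f1 x - q.[x]) m u.
- by rewrite in_itv/= => /andP[mx xu]; apply: dg; rewrite (ltW mx) (le_trans (ltW xu)).
- apply: derivable_within_continuous => x; rewrite in_itv/= => /andP[mx xu].
  by have H := dg x; apply: ex_derive; apply: H; rewrite mx (le_trans xu).
rewrite Qm subr0 => ->.
move: cmu; rewrite in_itv/= => /andP[mc cu].
have e0 : 0 <= e by apply: le_trans (fq m _); rewrite ?lexx// mM.
rewrite normrM (ger0_norm (_ : 0 <= u - m)) ?subr_ge0// ler_pM//.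
- by rewrite subr_ge0.
- by apply: fq; rewrite mc (le_trans cu).
- by rewrite lerB.
Qed.

(** Approximating the second derivative and integrating twice makes one polynomial good for all
    three functions. Each integration multiplies the error by at most D >= 1, hence the start at e /
    D^2. *)
Lemma poly_C2_approx (f0 f1 f2 : R -> R) m M (K e : R) : m < M -> 0 < e ->
  (forall u, m <= u <= M -> is_derive u (1:R) f0 (f1 u)) ->
  (forall u, m <= u <= M -> is_derive u (1:R) f1 (f2 u)) ->
  (forall u v, m <= u <= M -> m <= v <= M -> `|f2 u - f2 v| <= K * `|u - v|) ->
  exists q : {poly R}, forall u, m <= u <= M ->
    [/\ `|f0 u - q.[u]| <= e, `|f1 u - q^`().[u]| <= e &
        `|f2 u - q^`()^`().[u]| <= e].
Proof.
move=> mM e0 d0 d1 lip.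
pose D := M - m + 1.
have D1 : 1 <= D by rewrite /D lerDr subr_ge0 ltW.
have D0 : 0 < D by apply: lt_le_trans D1.
have DM : M - m <= D by rewrite lerDl.
pose e' := e / D ^+ 2.
have e'0 : 0 < e' by rewrite divr_gt0// exprn_gt0.
have [q2 H2] := weierstrass_lipschitz mM e'0 lip.
have [q1 [dq1 H1]] := poly_lift_derivative (ltW mM) d1 H2.
have [q0 [dq0 H0]] := poly_lift_derivative (ltW mM) d0 H1.
have eE : e' * D * D = e by rewrite /e'; field; rewrite gt_eqF.
have le1 : e' <= e' * D by rewrite ler_peMr// ltW.
have le2 : e' * D <= e by rewrite -eE ler_peMr// mulr_ge0// ltW.
exists q0 => u umM; rewrite dq0 dq1; split.
- apply: le_trans (H0 _ umM) _; rewrite -eE ler_pM//.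
  + by rewrite mulr_ge0 ?subr_ge0 ?(ltW mM) ?(ltW e'0).
  + by rewrite subr_ge0 (ltW mM).
  + by rewrite ler_wpM2l ?(ltW e'0).
- by apply: le_trans (H1 _ umM) (le_trans _ le2); rewrite ler_wpM2l ?(ltW e'0).
- exact: le_trans (H2 _ umM) (le_trans le1 le2).
Qed.

End polynomial_approximation.

(** * Trigonometric polynomials and their limits in C^2 *)

Section trigonometric_polynomials.
Context {R : realType} {p : nat}.
Implicit Types (x : 'I_p -> R) (s : seq (R * ('I_p -> R) * R)).

(* [(c, a, b)] stands for the function x |-> c cos(a . x + b). *)
Definition dotv (a x : 'I_p -> R) : R := \sum_j a j * x j.

Definition tp0 s x := \sum_(t <- s) t.1.1 * cos (dotv t.1.2 x + t.2).

(** Gradient and Hessian are carried along as formulas beside the value, so no derivative in several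
    variables is ever taken. *)
Definition tp1 s j x :=
  \sum_(t <- s) - (t.1.1 * t.1.2 j * sin (dotv t.1.2 x + t.2)).

Definition tp2 s j k x :=
  \sum_(t <- s) - (t.1.1 * t.1.2 j * t.1.2 k * cos (dotv t.1.2 x + t.2)).

(** The formula cos A cos B = (cos(A + B) + cos(A - B)) / 2, which makes trigonometric polynomials
    an algebra. *)
Definition tmul (t u : R * ('I_p -> R) * R) : seq (R * ('I_p -> R) * R) :=
  [:: (t.1.1 * u.1.1 / 2, (fun j => t.1.2 j + u.1.2 j), t.2 + u.2);
      (t.1.1 * u.1.1 / 2, (fun j => t.1.2 j - u.1.2 j), t.2 - u.2)].

Definition tpmul s s' :=
  flatten [seq flatten [seq tmul t u | u <- s'] | t <- s].

Lemma dotvD a a' x : dotv (fun j => a j + a' j) x = dotv a x + dotv a' x.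
Proof. by rewrite /dotv -big_split; apply: eq_bigr => j _; rewrite mulrDl. Qed.

Lemma dotvB a a' x : dotv (fun j => a j - a' j) x = dotv a x - dotv a' x.
Proof. by rewrite /dotv -sumrB; apply: eq_bigr => j _; rewrite mulrBl. Qed.

Lemma tpmul_sum (F : R * ('I_p -> R) * R -> R)
    (G : R * ('I_p -> R) * R -> R * ('I_p -> R) * R -> R) s s' :
  (forall t u, \sum_(v <- tmul t u) F v = G t u) ->
  \sum_(v <- tpmul s s') F v = \sum_(t <- s) \sum_(u <- s') G t u.
Proof.
move=> FG; rewrite /tpmul big_flatten big_map; apply: eq_bigr => t _.
by rewrite big_flatten big_map; apply: eq_bigr => u _; exact: FG.
Qed.

Let trig_prod (A B : R) :
  [/\ cos (A + B) + cos (A - B) = 2 * (cos A * cos B),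
      sin (A + B) + sin (A - B) = 2 * (sin A * cos B),
      sin (A + B) - sin (A - B) = 2 * (cos A * sin B) &
      cos (A + B) - cos (A - B) = - 2 * (sin A * sin B)].
Proof. by rewrite !cosB !cosD !sinB !sinD; split; ring. Qed.

Let phaseD (A B c d : R) : A + B + (c + d) = (A + c) + (B + d).
Proof. by ring. Qed.

Let phaseB (A B c d : R) : A - B + (c - d) = (A + c) - (B + d).
Proof. by ring. Qed.

Lemma tp0M s s' x : tp0 (tpmul s s') x = tp0 s x * tp0 s' x.
Proof.
rewrite /tp0 (@tpmul_sum _ (fun t u => t.1.1 * cos (dotv t.1.2 x + t.2) *
   (u.1.1 * cos (dotv u.1.2 x + u.2)))).
  by rewrite mulr_suml; apply: eq_bigr => t _; rewrite mulr_sumr.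
move=> t u; rewrite /tmul !big_cons big_nil /= dotvD dotvB phaseD phaseB.
have [+ _ _ _] := trig_prod (dotv t.1.2 x + t.2) (dotv u.1.2 x + u.2).
move=> /(canRL (addrK _)) ->; by field.
Qed.

Lemma tp1M s s' j x : tp1 (tpmul s s') j x =
  tp1 s j x * tp0 s' x + tp0 s x * tp1 s' j x.
Proof.
rewrite /tp1 (@tpmul_sum _ (fun t u =>
   - (t.1.1 * t.1.2 j * sin (dotv t.1.2 x + t.2)) * (u.1.1 * cos (dotv u.1.2 x + u.2)) +
   (t.1.1 * cos (dotv t.1.2 x + t.2)) *
   - (u.1.1 * u.1.2 j * sin (dotv u.1.2 x + u.2)))).
  rewrite /tp0 2!mulr_suml -big_split; apply: eq_bigr => t _.
  by rewrite 2!mulr_sumr -big_split.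
move=> t u; rewrite /tmul !big_cons big_nil /= dotvD dotvB phaseD phaseB.
have [_ e1 e2 _] := trig_prod (dotv t.1.2 x + t.2) (dotv u.1.2 x + u.2).
set sp := sin (_ + _) in e1 e2 *; set sm := sin (_ - _) in e1 e2 *.
have -> : sp = sin (dotv t.1.2 x + t.2) * cos (dotv u.1.2 x + u.2) +
    cos (dotv t.1.2 x + t.2) * sin (dotv u.1.2 x + u.2) by lra.
have -> : sm = sin (dotv t.1.2 x + t.2) * cos (dotv u.1.2 x + u.2) -
    cos (dotv t.1.2 x + t.2) * sin (dotv u.1.2 x + u.2) by lra.
by field.
Qed.

Lemma tp2M s s' j k x : tp2 (tpmul s s') j k x =
  tp2 s j k x * tp0 s' x + tp1 s j x * tp1 s' k x + tp1 s k x * tp1 s' j x +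
  tp0 s x * tp2 s' j k x.
Proof.
rewrite /tp2 (@tpmul_sum _ (fun t u =>
   - (t.1.1 * t.1.2 j * t.1.2 k * cos (dotv t.1.2 x + t.2)) *
     (u.1.1 * cos (dotv u.1.2 x + u.2)) +
   - (t.1.1 * t.1.2 j * sin (dotv t.1.2 x + t.2)) *
     - (u.1.1 * u.1.2 k * sin (dotv u.1.2 x + u.2)) +
   - (t.1.1 * t.1.2 k * sin (dotv t.1.2 x + t.2)) *
     - (u.1.1 * u.1.2 j * sin (dotv u.1.2 x + u.2)) +
   (t.1.1 * cos (dotv t.1.2 x + t.2)) *
   - (u.1.1 * u.1.2 j * u.1.2 k * cos (dotv u.1.2 x + u.2)))).
  rewrite /tp0 /tp1 4!mulr_suml -!big_split; apply: eq_bigr => t _.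
  by rewrite /= 4!mulr_sumr -!big_split.
move=> t u; rewrite /tmul !big_cons big_nil /= dotvD dotvB phaseD phaseB.
by rewrite cosB cosD; field.
Qed.

Lemma tp_cat s s' : [/\ forall x, tp0 (s ++ s') x = tp0 s x + tp0 s' x,
  forall j x, tp1 (s ++ s') j x = tp1 s j x + tp1 s' j x &
  forall j k x, tp2 (s ++ s') j k x = tp2 s j k x + tp2 s' j k x].
Proof. by split=> *; rewrite /tp0 /tp1 /tp2 big_cat. Qed.

Lemma tp_bounded s : exists M, forall x,
  [/\ `|tp0 s x| <= M, forall j, `|tp1 s j x| <= M & forall j k, `|tp2 s j k x| <= M].
Proof.
pose A (t : R * ('I_p -> R) * R) : R := 1 + \sum_j `|t.1.2 j|.
have A1 t : 1 <= A t by rewrite lerDl sumr_ge0.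
have aA t j : `|t.1.2 j| <= A t.
  by rewrite /A (bigD1 j)//= addrCA lerDl addr_ge0 ?sumr_ge0.
exists (\sum_(t <- s) `|t.1.1| * A t * A t) => x; split.
- apply: le_trans (ler_norm_sum _ _ _) _; apply: ler_sum => t _.
  rewrite normrM -mulrA ler_wpM2l// (le_trans (cos_max _))//.
  by rewrite -[leLHS]mulr1 ler_pM.
- move=> j; apply: le_trans (ler_norm_sum _ _ _) _; apply: ler_sum => t _.
  rewrite normrN !normrM ler_pM ?mulr_ge0//; first by rewrite ler_wpM2l.
  exact: le_trans (sin_max _) _.
- move=> j k; apply: le_trans (ler_norm_sum _ _ _) _; apply: ler_sum => t _.
  rewrite normrN !normrM -[leRHS]mulr1 ler_pM ?mulr_ge0//; last exact: cos_max.
  by rewrite ler_pM ?mulr_ge0// ler_wpM2l.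
Qed.

(* The 2-jet [(f, f1, f2)] is a uniform limit of 2-jets of trigonometric
   polynomials. *)
Definition trig_limit (f : ('I_p -> R) -> R) (f1 : 'I_p -> ('I_p -> R) -> R)
    (f2 : 'I_p -> 'I_p -> ('I_p -> R) -> R) : Prop :=
  forall e, 0 < e -> exists s, forall x,
    [/\ `|f x - tp0 s x| <= e, forall j, `|f1 j x - tp1 s j x| <= e &
        forall j k, `|f2 j k x - tp2 s j k x| <= e].

Lemma trig_limit_bounded f f1 f2 : trig_limit f f1 f2 -> exists M, forall x,
  [/\ `|f x| <= M, forall j, `|f1 j x| <= M & forall j k, `|f2 j k x| <= M].
Proof.
move=> /(_ 1 ltr01)[s H]; have [M HM] := tp_bounded s.
have tri (u v : R) : `|u - v| <= 1 -> `|v| <= M -> `|u| <= M + 1.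
  by move=> uv vM; rewrite -(subrK v u) addrC (le_trans (ler_normD _ _))// lerD.
exists (M + 1) => x; have [h0 h1 h2] := H x; have [k0 k1 k2] := HM x.
split; [exact: tri h0 k0|move=> j; exact: tri (h1 j) (k1 j)|].
by move=> j k; exact: tri (h2 j k) (k2 j k).
Qed.

Lemma trig_limit_ext f f1 f2 g g1 g2 : trig_limit f f1 f2 ->
  (forall x, f x = g x) -> (forall j x, f1 j x = g1 j x) ->
  (forall j k x, f2 j k x = g2 j k x) -> trig_limit g g1 g2.
Proof.
move=> H e0 e1 e2 e /H[s Hs]; exists s => x; have [h0 h1 h2] := Hs x.
by split=> [|j|j k]; rewrite -?e0 -?e1 -?e2.
Qed.

Lemma trig_limit_closed f f1 f2 :
  (forall e, 0 < e -> exists g g1 g2, trig_limit g g1 g2 /\ forall x,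
     [/\ `|f x - g x| <= e, forall j, `|f1 j x - g1 j x| <= e &
         forall j k, `|f2 j k x - g2 j k x| <= e]) ->
  trig_limit f f1 f2.
Proof.
move=> H e e0; have e20 : 0 < e / 2 by rewrite divr_gt0.
have [g [g1 [g2 [G fg]]]] := H _ e20; have [s Hs] := G _ e20.
have tri (u v w : R) : `|u - v| <= e / 2 -> `|v - w| <= e / 2 -> `|u - w| <= e.
  move=> uv vw; rewrite (splitr e) -(subrKA v).
  by rewrite (le_trans (ler_normD _ _))// lerD.
exists s => x; have [h0 h1 h2] := fg x; have [k0 k1 k2] := Hs x.
split; [exact: tri h0 k0|move=> j; exact: tri (h1 j) (k1 j)|].
by move=> j k; exact: tri (h2 j k) (k2 j k).
Qed.

Lemma trig_limit_tp s : trig_limit (tp0 s) (tp1 s) (tp2 s).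
Proof.
by move=> e e0; exists s => x; split=> *; rewrite subrr normr0 ltW.
Qed.

Lemma trig_limit_cst (c : R) : trig_limit (fun=> c) (fun _ _ => 0) (fun _ _ _ => 0).
Proof.
apply: (trig_limit_ext (trig_limit_tp [:: (c, fun=> 0, 0)])) => [x|j x|j k x];
  rewrite /tp0 /tp1 /tp2 big_seq1 /=.
- rewrite /dotv big1 ?addr0 ?cos0 ?mulr1// => j _; exact: mul0r.
- by rewrite mulr0 mul0r oppr0.
- by rewrite mulr0 mul0r oppr0.
Qed.

Lemma trig_limitD f f1 f2 g g1 g2 : trig_limit f f1 f2 -> trig_limit g g1 g2 ->
  trig_limit (fun x => f x + g x) (fun j x => f1 j x + g1 j x)
    (fun j k x => f2 j k x + g2 j k x).
Proof.
move=> F G e e0; have e20 : 0 < e / 2 by rewrite divr_gt0.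
have [s Hs] := F _ e20; have [t Ht] := G _ e20.
have tri (u v u' v' : R) : `|u - u'| <= e / 2 -> `|v - v'| <= e / 2 ->
    `|u + v - (u' + v')| <= e.
  by move=> uv vw; rewrite (splitr e) opprD addrACA (le_trans (ler_normD _ _))// lerD.
exists (s ++ t) => x; have [-> c1 c2] := tp_cat s t.
have [h0 h1 h2] := Hs x; have [k0 k1 k2] := Ht x.
split=> [|j|j k]; rewrite ?c1 ?c2; exact: tri.
Qed.

Lemma trig_limitM f f1 f2 g g1 g2 : trig_limit f f1 f2 -> trig_limit g g1 g2 ->
  trig_limit (fun x => f x * g x) (fun j x => f1 j x * g x + f x * g1 j x)
    (fun j k x => f2 j k x * g x + f1 j x * g1 k x + f1 k x * g1 j x + f x * g2 j k x).
Proof.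
move=> F G e e0.
have [M HM] := trig_limit_bounded F; have [N HN] := trig_limit_bounded G.
pose K := `|M| + `|N| + 1.
have K0 : 0 < K by rewrite ltr_wpDl// addr_ge0.
have MK : M <= K by rewrite (le_trans (ler_norm M))// /K -addrA lerDl addr_ge0.
have NK : N <= K.
  by have := ler_norm N; have := normr_ge0 M; rewrite /K; lra.
(* The Leibniz formula for the Hessian has four products, each off by at most d (2 K + 1); d <= 1
   keeps the approximants below K + 1. *)
pose d := Num.min 1 (e / (4 * (2 * K + 1))).
have K4 : 0 < 4 * (2 * K + 1) by rewrite mulr_gt0// addr_gt0// mulr_gt0.
have d0 : 0 < d by rewrite lt_min ltr01/= divr_gt0.
have de : d * (2 * K + 1) * 4 <= e.
  by rewrite -mulrA (mulrC _ 4) -ler_pdivlMr// ge_min lexx orbT.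
have d1 : d <= 1 by rewrite ge_min lexx.
have [s Hs] := F _ d0; have [t Ht] := G _ d0.
pose D := d * (2 * K + 1).
have tri (u v u' v' : R) : `|u| <= M -> `|v| <= N ->
   `|u - u'| <= d -> `|v - v'| <= d -> `|u * v - u' * v'| <= D.
  move=> uM vN uu vv.
  have -> : u * v - u' * v' = (u - u') * v + u' * (v - v') by ring.
  have uK : `|u'| <= K + 1.
    rewrite -(subrK u u') -opprB (le_trans (ler_normD _ _))// normrN addrC lerD//.
      exact: le_trans uM MK.
    exact: le_trans d1.
  have -> : D = d * K + (K + 1) * d by rewrite /D; ring.
  rewrite (le_trans (ler_normD _ _))// !normrM lerD// ler_pM//.
  exact: le_trans vN NK.
have D0 : 0 <= D by rewrite mulr_ge0 ?(ltW d0)// addr_ge0// mulr_ge0// ltW.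
have De : D + D + D + D <= e by rewrite /D; lra.
have n2 (a b : R) : `|a + b| <= `|a| + `|b| by exact: ler_normD.
exists (tpmul s t) => x; have [h0 h1 h2] := Hs x; have [k0 k1 k2] := Ht x.
have [m0 m1 m2] := HM x; have [l0 l1 l2] := HN x.
split=> [|j|j k].
- rewrite tp0M (le_trans (tri _ _ _ _ m0 l0 h0 k0))//; lra.
- rewrite tp1M opprD addrACA (le_trans (n2 _ _))//.
  have := tri _ _ _ _ (m1 j) l0 (h1 j) k0; have := tri _ _ _ _ m0 (l1 j) h0 (k1 j).
  lra.
- rewrite tp2M.
  rewrite [X in `|X|](_ : _ = (f2 j k x * g x - tp2 s j k x * tp0 t x) +
     (f1 j x * g1 k x - tp1 s j x * tp1 t k x) +
     (f1 k x * g1 j x - tp1 s k x * tp1 t j x) +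
     (f x * g2 j k x - tp0 s x * tp2 t j k x)); last by ring.
  have := tri _ _ _ _ (m2 j k) l0 (h2 j k) k0; have := tri _ _ _ _ m0 (l2 j k) h0 (k2 j k).
  have := tri _ _ _ _ (m1 j) (l1 k) (h1 j) (k1 k); have := tri _ _ _ _ (m1 k) (l1 j) (h1 k) (k1 j).
  move=> a1 a2 a3 a4.
  rewrite (le_trans (n2 _ _))// (le_trans (lerD (n2 _ _) (lexx _)))//.
  rewrite (le_trans (lerD (lerD (n2 _ _) (lexx _)) (lexx _)))//; lra.
Qed.

Lemma trig_limitZ (c : R) f f1 f2 : trig_limit f f1 f2 ->
  trig_limit (fun x => c * f x) (fun j x => c * f1 j x) (fun j k x => c * f2 j k x).
Proof.
move=> F; apply: (trig_limit_ext (trig_limitM (trig_limit_cst c) F)) => *; ring.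
Qed.

Lemma trig_limit_sum (I : Type) (r : seq I) (F : I -> ('I_p -> R) -> R)
   (F1 : I -> 'I_p -> ('I_p -> R) -> R) (F2 : I -> 'I_p -> 'I_p -> ('I_p -> R) -> R) :
  (forall i, trig_limit (F i) (F1 i) (F2 i)) ->
  trig_limit (fun x => \sum_(i <- r) F i x) (fun j x => \sum_(i <- r) F1 i j x)
    (fun j k x => \sum_(i <- r) F2 i j k x).
Proof.
move=> H; elim: r => [|i r IH].
  by apply: (trig_limit_ext (trig_limit_cst 0)) => *; rewrite big_nil.
by apply: (trig_limit_ext (trig_limitD (H i) IH)) => *; rewrite big_cons.
Qed.

Lemma trig_limit_poly (q : {poly R}) f f1 f2 : trig_limit f f1 f2 ->
  trig_limit (fun x => q.[f x]) (fun j x => q^`().[f x] * f1 j x)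
    (fun j k x => q^`()^`().[f x] * (f1 j x * f1 k x) + q^`().[f x] * f2 j k x).
Proof.
move=> F; elim/poly_ind: q => [|q c IH].
  apply: (trig_limit_ext (trig_limit_cst 0)) => *;
    by rewrite ?deriv0 !horner0 ?mul0r ?addr0.
have := trig_limitD (trig_limitM IH F) (trig_limit_cst c).
move=> /trig_limit_ext; apply => [x|j x|j k x].
- by rewrite !hornerE.
- by rewrite derivMXaddC !hornerE; ring.
- by rewrite derivMXaddC derivD derivM derivX mulr1 !(hornerD, hornerM, hornerX); ring.
Qed.

(** On the bounded range of [f] the function [h0] is C^2-close to a polynomial, and polynomials in
    [f] are limits by the algebra structure. The factor C dominates the products of derivatives of
    [f] that multiply the errors. *)
Lemma trig_limit_comp (h0 h1 h2 : R -> R) m M K f f1 f2 : m < M ->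
  trig_limit f f1 f2 -> (forall x, m <= f x <= M) ->
  (forall u, m <= u <= M -> is_derive u (1:R) h0 (h1 u)) ->
  (forall u, m <= u <= M -> is_derive u (1:R) h1 (h2 u)) ->
  (forall u v, m <= u <= M -> m <= v <= M -> `|h2 u - h2 v| <= K * `|u - v|) ->
  trig_limit (fun x => h0 (f x)) (fun j x => h1 (f x) * f1 j x)
    (fun j k x => h2 (f x) * (f1 j x * f1 k x) + h1 (f x) * f2 j k x).
Proof.
move=> mM F fmM d0 d1 lip; apply: trig_limit_closed => e e0.
have [B HB] := trig_limit_bounded F.
pose C := B ^+ 2 + `|B| + 1.
have B2 : 0 <= B ^+ 2 by exact: sqr_ge0.
have C1 : 1 <= C by rewrite lerDr addr_ge0.
have C0 : 0 < C by apply: lt_le_trans C1.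
have eC : 0 < e / C by rewrite divr_gt0.
have [q Hq] := poly_C2_approx mM eC d0 d1 lip.
do 3 eexists; split; first exact: (trig_limit_poly q F).
move=> x; have [q0 q1 q2] := Hq _ (fmM x); have [b0 b1 b2] := HB x.
have B0 : 0 <= B by apply: le_trans b0.
have eCE : e / C * C = e by rewrite divfK// gt_eqF.
have BN : `|B| = B by rewrite ger0_norm.
split.
- by rewrite (le_trans q0)// -[leRHS]eCE ler_peMr// ltW.
- move=> j; rewrite -mulrBl normrM -eCE ler_pM// (le_trans (b1 j))//.
  by rewrite /C BN -addrA addrCA lerDl addr_ge0.
- move=> j k; rewrite opprD addrACA -!mulrBl (le_trans (ler_normD _ _))//.
  rewrite !normrM.
  apply: (@le_trans _ _ (e / C * (B * B) + e / C * B)).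
    by rewrite lerD// ler_pM ?mulr_ge0// ler_pM.
  rewrite -[leRHS]eCE -mulrDr ler_wpM2l ?(ltW eC)//.
  by rewrite /C BN expr2 lerDl.
Qed.

End trigonometric_polynomials.

(** * The log-sum-exp function *)

Section log_sum_exp.
Context {R : realType} {p : nat}.
Implicit Types (b L : R) (mu x : 'I_p -> R).

Definition expsum b mu x : R := \sum_j expR (b * (x j + mu j)).

(** The 1 acts as an extra coordinate fixed at 0, whence the positive part. Shifts differ between
    coordinates because a common threshold t becomes t / sigma_j after each coordinate is scaled to
    unit variance. *)
Definition lse b mu x : R := b^-1 * ln (1 + expsum b mu x).

Definition softmax b mu x j : R :=
  expR (b * (x j + mu j)) / (1 + expsum b mu x).

(** A single trigonometric term per coordinate, bounded by L. It is also at most |x j| in absolute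
    value, which provides the dominating function when L grows. *)
Definition clip L x : 'I_p -> R := fun j => L * sin (x j / L).

Lemma expsum_ge0 b mu x : 0 <= expsum b mu x.
Proof. by apply: sumr_ge0 => j _; exact: expR_ge0. Qed.

Lemma expsum1_gt0 b mu x : 0 < 1 + expsum b mu x.
Proof. by rewrite ltr_pwDl// expsum_ge0. Qed.

Lemma softmax_ge0 b mu x j : 0 <= softmax b mu x j.
Proof. by rewrite divr_ge0 ?expR_ge0// ltW// expsum1_gt0. Qed.

Lemma sum_softmax b mu x :
  \sum_j softmax b mu x j = 1 - (1 + expsum b mu x)^-1.
Proof.
rewrite -mulr_suml -/(expsum b mu x).
by field; rewrite gt_eqF// expsum1_gt0.
Qed.

Lemma sum_softmax_le1 b mu x : \sum_j softmax b mu x j <= 1.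
Proof. by rewrite sum_softmax gerBl invr_ge0 ltW// expsum1_gt0. Qed.

Lemma sum_delta (F : 'I_p -> R) j : \sum_i (i == j)%:R * F i = F j.
Proof.
by rewrite (bigD1 j)//= eqxx mul1r big1 ?addr0// => i /negbTE ->; rewrite mul0r.
Qed.

Lemma trig_limit_clip L j : L != 0 ->
  trig_limit (fun x => clip L x j) (fun i x => (j == i)%:R * cos (x j / L))
    (fun i k x => (j == i)%:R * ((j == k)%:R * - (sin (x j / L) / L))).
Proof.
move=> L0.
pose s : seq (R * ('I_p -> R) * R) := [:: (L, fun i => (j == i)%:R / L, - (pi / 2))].
have dE x : dotv (fun i => (j == i)%:R / L) x = x j / L.
  rewrite /dotv -[RHS](sum_delta (fun i => x i / L)); apply: eq_bigr => i _.
  by rewrite eq_sym; ring.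
have c1 (u : R) : cos (u - pi / 2) = sin u.
  by rewrite cosB cos_pihalf sin_pihalf mulr0 add0r mulr1.
have c2 (u : R) : sin (u - pi / 2) = - cos u.
  by rewrite sinB cos_pihalf sin_pihalf mulr0 add0r mulr1.
apply: (trig_limit_ext (trig_limit_tp s)) => [x|i x|i k x];
  rewrite /tp0 /tp1 /tp2 big_seq1 /= dE ?c1 ?c2//.
- by field.
- by field.
Qed.

Lemma expR_lipschitz M (u v : R) : u <= M -> v <= M ->
  `|expR u - expR v| <= expR M * `|u - v|.
Proof.
wlog uv : u v / v <= u => [H uM vM|uM _].
  have [vu|/ltW uv] := leP v u; first exact: H.
  by rewrite distrC (distrC u) H.
rewrite !ger0_norm ?subr_ge0 ?ler_expR//.
have -> : expR u - expR v = expR u * (1 - expR (v - u)).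
  by rewrite mulrBr mulr1 -expRD (_ : u + (v - u) = v)//; ring.
rewrite ler_pM ?expR_ge0 ?ler_expR//.
- by rewrite subr_ge0 -[leRHS]expR0 ler_expR subr_le0.
- by rewrite lerBlDl -lerBlDr; apply: le_trans (expR_ge1Dx _); lra.
Qed.

Lemma invsqr_lipschitz (u v : R) : 1 <= u -> 1 <= v ->
  `|- u ^- 2 - - v ^- 2| <= 2 * `|u - v|.
Proof.
move=> u1 v1.
have u0 : 0 < u by apply: lt_le_trans u1.
have v0 : 0 < v by apply: lt_le_trans v1.
have -> : - u ^- 2 - - v ^- 2 = ((u * v ^+ 2)^-1 + (u ^+ 2 * v)^-1) * (u - v).
  by field; rewrite !gt_eqF.
rewrite normrM ler_wpM2r// ger0_norm; last first.
  by rewrite addr_ge0// invr_ge0 ltW// mulr_gt0// exprn_gt0.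
have le1 (a c : R) : 1 <= a -> 1 <= c -> (a * c)^-1 <= 1.
  by move=> a1 c1; rewrite invf_le1 ?mulr_ege1// mulr_gt0// (lt_le_trans ltr01).
by rewrite -[leRHS]/(1 + 1) lerD// le1// exprn_ege1.
Qed.

(** Clipping confines the exponents to [-B, B] and the argument of the logarithm to [1, M + 1],
    where [trig_limit_comp] applies. In the Hessian, the term with sin(x j / L) / L is the curvature
    of the clipping. *)
Lemma trig_limit_lse b mu L : 0 < b -> 0 < L ->
  trig_limit (fun x => lse b mu (clip L x))
    (fun j x => softmax b mu (clip L x) j * cos (x j / L))
    (fun j k x => b * ((k == j)%:R * (softmax b mu (clip L x) j * cos (x j / L) ^+ 2)
        - softmax b mu (clip L x) j * softmax b mu (clip L x) k *
          (cos (x j / L) * cos (x k / L)))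
      - (k == j)%:R * (softmax b mu (clip L x) j * (sin (x j / L) / L))).
Proof.
move=> b0 L0.
have E j := trig_limitZ b (trig_limitD (trig_limit_clip j (lt0r_neq0 L0)) (trig_limit_cst (mu j))).
pose B := b * (L + \sum_j `|mu j|) + 1.
have sm0 : 0 <= \sum_j `|mu j| by exact: sumr_ge0.
have B0 : 0 < B by rewrite ltr_wpDl// mulr_ge0 ?(ltW b0)// addr_ge0// ltW.
have EB j x : - B <= b * (clip L x j + mu j) <= B.
  rewrite -ler_norml normrM (gtr0_norm b0) /B ler_wpDr// ler_wpM2l ?(ltW b0)//.
  rewrite (le_trans (ler_normD _ _))// lerD//.
    by rewrite normrM (gtr0_norm L0) ler_piMr ?(ltW L0)// sin_max.
  by rewrite (bigD1 j)//= lerDl sumr_ge0.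
have BB : - B < B by rewrite gtrN.
have lipE u v : - B <= u <= B -> - B <= v <= B ->
    `|expR u - expR v| <= expR B * `|u - v|.
  by move=> /andP[_ uB] /andP[_ vB]; exact: expR_lipschitz.
have X j := trig_limit_comp BB (E j) (EB j) (fun u _ => is_derive_expR u)
  (fun u _ => is_derive_expR u) lipE.
have S := trig_limitD (trig_limit_cst 1) (trig_limit_sum (index_enum 'I_p) X).
have [M HM] := trig_limit_bounded S.
have SM x : 1 <= 1 + expsum b mu (clip L x) <= M + 1.
  rewrite lerDl expsum_ge0/=; have [H _ _] := HM x.
  rewrite ler_wpDr// (le_trans _ H)// ger0_norm// addr_ge0//.
  exact: expsum_ge0.
have M1 : 1 < M + 1.
  have [H _ _] := HM (fun=> 0); rewrite ltrDr (lt_le_trans _ H)// normr_gt0 gt_eqF//.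
  exact: expsum1_gt0.
have dln u : 1 <= u <= M + 1 -> is_derive u (1:R) (@ln R) (u^-1).
  by move=> /andP[u1 _]; apply: is_derive1_ln; exact: lt_le_trans u1.
have dinv u : 1 <= u <= M + 1 -> is_derive u (1:R) (fun u => u^-1) (- u ^- 2).
  move=> /andP[u1 _]; have u0 : u != 0 by rewrite gt_eqF// (lt_le_trans ltr01).
  apply: (is_derive_eq (is_deriveV (f := id) u0 (is_derive_id _ _))).
  by rewrite /GRing.scale /= mulr1.
have lipI u v : 1 <= u <= M + 1 -> 1 <= v <= M + 1 ->
    `|- u ^- 2 - - v ^- 2| <= 2 * `|u - v|.
  by move=> /andP[u1 _] /andP[v1 _]; exact: invsqr_lipschitz.
have F := trig_limitZ b^-1 (trig_limit_comp M1 S SM dln dinv lipI).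
have bn0 : b != 0 by rewrite gt_eqF.
have sd1 x j : 0 + \sum_i expR (b * (clip L x i + mu i)) *
      (b * ((i == j)%:R * cos (x i / L) + 0)) =
    b * (expR (b * (clip L x j + mu j)) * cos (x j / L)).
  rewrite add0r -[RHS](sum_delta (fun i => b * (expR (b * (clip L x i + mu i)) * cos (x i / L)))).
  by apply: eq_bigr => i _; ring.
apply: (trig_limit_ext F) => // [j x|j k x].
  by rewrite sd1 /softmax -/(expsum b mu (clip L x)); field; rewrite bn0 gt_eqF// expsum1_gt0.
rewrite !sd1.
set s2 := (X in _ + _^-1 * X).
have -> : s2 = (k == j)%:R * (expR (b * (clip L x j + mu j)) *
    (b ^+ 2 * cos (x j / L) ^+ 2 - b * (sin (x j / L) / L))).
  rewrite /s2 add0r.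
  transitivity (\sum_i (i == j)%:R * ((i == k)%:R * (expR (b * (clip L x i + mu i)) *
    (b ^+ 2 * cos (x i / L) ^+ 2 - b * (sin (x i / L) / L))))).
    by apply: eq_bigr => i _; ring.
  by rewrite sum_delta eq_sym.
rewrite /softmax -/(expsum b mu (clip L x)).
by field; rewrite bn0 !gt_eqF// expsum1_gt0.
Qed.

(** Softmax weights are nonnegative with sum at most 1, so the diagonal part and the rank-one part
    each add at most b to the sum of the absolute entries, whatever p is. *)
Lemma lse_hessian_le b mu L x (D : 'I_p -> 'I_p -> R) t : 0 < b -> 0 < L ->
  0 <= t -> (forall j k, `|D j k| <= t) ->
  \sum_j \sum_k D j k * (b * ((k == j)%:R * (softmax b mu (clip L x) j * cos (x j / L) ^+ 2)
        - softmax b mu (clip L x) j * softmax b mu (clip L x) k *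
          (cos (x j / L) * cos (x k / L)))
      - (k == j)%:R * (softmax b mu (clip L x) j * (sin (x j / L) / L))) <=
  t * (2 * b + L^-1).
Proof.
move=> b0 L0 t0 Dt; set s := softmax b mu (clip L x).
have s0 j : 0 <= s j by exact: softmax_ge0.
have cc j : `|cos (x j / L)| <= 1 by exact: cos_max.
have Li : 0 < L^-1 by rewrite invr_gt0.
have bnd (a z : R) : 0 <= a -> `|z| <= 1 -> `|a * z| <= a.
  by move=> a0 z1; rewrite normrM (ger0_norm a0) ler_piMr.
apply: (@le_trans _ _ (\sum_j \sum_k t * ((k == j)%:R * ((b + L^-1) * s j) + b * (s j * s k)))).
  apply: ler_sum => j _; apply: ler_sum => k _.
  apply: le_trans (ler_norm _) _; rewrite normrM ler_pM//.
  set u := _ * (s j * _ ^+ 2) - _; set v := _ * (s j * (sin _ / L)).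
  apply: le_trans (ler_normB _ _) _.
  have vE : `|v| <= (k == j)%:R * (s j * L^-1).
    rewrite /v; case: eqP => _; last by rewrite !mul0r normr0.
    rewrite !mul1r (_ : s j * (sin (x j / L) / L) = s j * L^-1 * sin (x j / L)); last by ring.
    by apply: bnd; [rewrite mulr_ge0 ?(ltW Li)|exact: sin_max].
  have uE : `|u| <= (k == j)%:R * s j + s j * s k.
    apply: le_trans (ler_normB _ _) _; rewrite lerD//.
      case: eqP => _; last by rewrite !mul0r normr0.
      by rewrite !mul1r bnd// normrX exprn_ile1.
    by apply: bnd; [rewrite mulr_ge0|rewrite normrM mulr_ile1].
  rewrite normrM (gtr0_norm b0).
  apply: le_trans (lerD (ler_wpM2l (ltW b0) uE) vE) _.
  by rewrite le_eqVlt; apply/orP; left; apply/eqP; ring.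
have -> : \sum_j \sum_k t * ((k == j)%:R * ((b + L^-1) * s j) + b * (s j * s k)) =
   t * ((b + L^-1) * (\sum_j s j) + b * ((\sum_j s j) * (\sum_j s j))).
  have inner j : \sum_k t * ((k == j)%:R * ((b + L^-1) * s j) + b * (s j * s k)) =
      t * ((b + L^-1) * s j + b * (s j * \sum_k s k)).
    rewrite -mulr_sumr big_split /= (sum_delta (fun=> (b + L^-1) * s j)).
    by rewrite [in RHS]mulr_sumr [in RHS]mulr_sumr.
  under eq_bigr do rewrite inner.
  by rewrite -mulr_sumr big_split /= -!mulr_sumr -mulr_suml.
have S0 : 0 <= \sum_j s j by exact: sumr_ge0.
have S1 : \sum_j s j <= 1 by exact: sum_softmax_le1.
rewrite ler_wpM2l// (_ : 2 * b + L^-1 = (b + L^-1) * 1 + b * (1 * 1)); last by ring.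
rewrite lerD// ler_wpM2l// ?addr_ge0 ?(ltW b0) ?(ltW Li)//.
by rewrite ler_pM.
Qed.

(** Let s_j be the weights and A = sum_j s_j cos^2(x_j / L). The unit diagonal of S yields b A. By
    |S j k| <= 1 and |u v| <= (u^2 + v^2) / 2 the rank-one part takes away at most b (sum_j s_j) A,
    and 1 - sum_j s_j = 1 / (1 + E), with E the sum of exponentials. *)
Lemma lse_hessian_ge b mu L x (S : 'I_p -> 'I_p -> R) : 0 < b -> 0 < L ->
  (forall j, S j j = 1) -> (forall j k, `|S j k| <= 1) ->
  b * ((1 + expsum b mu (clip L x))^-1 *
    \sum_j softmax b mu (clip L x) j * cos (x j / L) ^+ 2) - L^-1 <=
  \sum_j \sum_k S j k * (b * ((k == j)%:R * (softmax b mu (clip L x) j * cos (x j / L) ^+ 2)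
        - softmax b mu (clip L x) j * softmax b mu (clip L x) k *
          (cos (x j / L) * cos (x k / L)))
      - (k == j)%:R * (softmax b mu (clip L x) j * (sin (x j / L) / L))).
Proof.
move=> b0 L0 Sjj S1; set s := softmax b mu (clip L x).
have s0 j : 0 <= s j by exact: softmax_ge0.
have Li : 0 < L^-1 by rewrite invr_gt0.
pose A := \sum_j s j * cos (x j / L) ^+ 2.
apply: (@le_trans _ _ (\sum_j \sum_k ((k == j)%:R * (b * (s j * cos (x j / L) ^+ 2) - s j * L^-1)
   - b / 2 * (s j * s k * (cos (x j / L) ^+ 2 + cos (x k / L) ^+ 2))))); last first.
  apply: ler_sum => j _; apply: ler_sum => k _.
  have -> : forall X Y Z : R, S j k * (b * ((k == j)%:R * X - Y) - (k == j)%:R * Z) =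
     (k == j)%:R * (b * X - Z) - b * (S j k * Y).
    by move=> X Y Z; case: eqP => [->|_]; rewrite ?Sjj ?mul1r ?mul0r; ring.
  apply: lerB.
    apply: ler_wpM2l; first exact: ler0n.
    apply: lerB => //; apply: ler_wpM2l => //.
    rewrite -[leRHS]mul1r; apply: ler_wpM2r; first exact: ltW.
    exact: le_trans (ler_norm _) (sin_max _).
  rewrite (_ : b / 2 * _ = b * (s j * s k * ((cos (x j / L) ^+ 2 + cos (x k / L) ^+ 2) / 2))); last by field.
  apply: ler_wpM2l; first exact: ltW.
  have ss : 0 <= s j * s k by rewrite mulr_ge0.
  rewrite [leLHS]mulrCA; apply: ler_wpM2l => //.
  set u := cos (x j / L); set v := cos (x k / L).
  apply: le_trans (ler_norm _) _; rewrite normrM.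
  apply: (@le_trans _ _ `|u * v|); first by rewrite ler_piMl.
  rewrite normrM -(real_normK (num_real u)) -(real_normK (num_real v)).
  have : 0 <= (`|u| - `|v|) ^+ 2 by exact: sqr_ge0.
  by rewrite sqrrB; lra.
have -> : \sum_j \sum_k ((k == j)%:R * (b * (s j * cos (x j / L) ^+ 2) - s j * L^-1)
   - b / 2 * (s j * s k * (cos (x j / L) ^+ 2 + cos (x k / L) ^+ 2))) =
   b * A - (\sum_j s j) * L^-1 - b * ((\sum_j s j) * A).
  under eq_bigr do rewrite sumrB (sum_delta (fun=> _)).
  rewrite !sumrB; congr (_ - _ - _).
  - by rewrite -mulr_sumr.
  - by rewrite mulr_suml.
  - transitivity (\sum_j \sum_k (b / 2 * (s j * cos (x j / L) ^+ 2 * s k) +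
       b / 2 * (s j * (s k * cos (x k / L) ^+ 2)))).
      by apply: eq_bigr => j _; apply: eq_bigr => k _; ring.
    under eq_bigr do rewrite big_split /= -!mulr_sumr.
    rewrite big_split /= -!mulr_sumr -!mulr_suml -/A; field.
    by rewrite gt_eqF// expsum1_gt0.
have -> : \sum_j s j = 1 - (1 + expsum b mu (clip L x))^-1 by exact: sum_softmax.
have -> : forall E : R, b * A - (1 - E) * L^-1 - b * ((1 - E) * A) =
   b * (E * A) - L^-1 + E * L^-1 by move=> E; ring.
by rewrite lerDl mulr_ge0 ?(ltW Li)// invr_ge0 ltW// expsum1_gt0.
Qed.

End log_sum_exp.

(** * Comparison and Stein identities *)

Section gaussian_trigonometric.
Context {R : realType} {p : nat}.
Implicit Types (s : seq (R * ('I_p -> R) * R)) (S : 'I_p -> 'I_p -> R).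

Definition qf S (a : 'I_p -> R) : R := \sum_j \sum_k a j * a k * S j k.

Lemma qfB S1 S2 a : qf (fun j k => S1 j k - S2 j k) a = qf S1 a - qf S2 a.
Proof.
rewrite /qf -sumrB; apply: eq_bigr => j _; rewrite -sumrB.
by apply: eq_bigr => k _; ring.
Qed.

Lemma tp2_contract S s x : \sum_j \sum_k S j k * tp2 s j k x =
  \sum_(t <- s) - (t.1.1 * qf S t.1.2 * cos (dotv t.1.2 x + t.2)).
Proof.
under eq_bigr do under eq_bigr do rewrite /tp2 mulr_sumr.
under eq_bigr do rewrite exchange_big.
rewrite exchange_big; apply: eq_bigr => t _ /=.
rewrite /qf mulr_sumr mulr_suml -sumrN; apply: eq_bigr => j _.
by rewrite mulr_sumr mulr_suml -sumrN; apply: eq_bigr => k _; ring.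
Qed.

Section one_vector.
Context d (T : measurableType d) (P : probability T R) (X : 'I_p -> T -> R) S.
Hypothesis gX : gaussian_cf P X S.

Let mX j : measurable_fun setT (X j). Proof. by case: gX. Qed.

Lemma measurable_dotv a : measurable_fun setT (fun w => dotv a (X ^~ w)).
Proof. by apply: measurable_sum => j; exact: measurable_funM. Qed.

Lemma measurable_cos_dotv a b : measurable_fun setT (fun w => cos (dotv a (X ^~ w) + b)).
Proof.
have := measurable_cos_affine 1 b (measurable_dotv a).
by under eq_fun do rewrite mul1r.
Qed.

Lemma integrable_tp0 s (u : 'I_p -> R) r :
  P.-integrable setT (EFin \o (fun w => tp0 s (fun j => u j + r * X j w))).
Proof.
apply: integrable_sum_seq => t; apply: integrableZ.
apply: (@integrable_ub _ _ _ _ _ 1); last by move=> w; exact: cos_max.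
have := measurable_cos_affine r (dotv t.1.2 u + t.2) (measurable_dotv t.1.2).
congr measurable_fun; apply/funext => w; congr cos.
rewrite addrA; congr (_ + _); rewrite /dotv mulr_sumr -big_split.
by apply: eq_bigr => j _; rewrite /=; ring.
Qed.

Lemma Rintegral_tp0 s (u : 'I_p -> R) r :
  \int[P]_w tp0 s (fun j => u j + r * X j w) =
  \sum_(t <- s) t.1.1 * (cos (dotv t.1.2 u + t.2) * expR (- (r ^+ 2 * qf S t.1.2 / 2))).
Proof.
have [_ _ cf] := gX.
have ic t : P.-integrable setT (EFin \o (fun w =>
    cos (dotv t.1.2 (fun j => u j + r * X j w) + t.2))).
  have := integrable_tp0 [:: (1, t.1.2, t.2)] u r.
  by apply: eq_integrable => // w _; rewrite /= /tp0 big_seq1 mul1r.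
rewrite /tp0 Rintegral_sum; last by move=> t; exact: integrableZ.
apply: eq_bigr => t _; rewrite RintegralZl//; congr (_ * _).
rewrite (_ : r ^+ 2 * qf S t.1.2 = qf S (fun j => r * t.1.2 j)); last first.
  rewrite /qf mulr_sumr; apply: eq_bigr => j _; rewrite mulr_sumr.
  by apply: eq_bigr => k _; ring.
rewrite -cf; apply: eq_Rintegral => w _; congr cos.
rewrite addrA; congr (_ + _); rewrite /dotv -big_split.
by apply: eq_bigr => j _; rewrite /=; ring.
Qed.

(** Two computations of the derivative at r = 1 of E cos(r a.X + b) = cos b exp(- r^2 qf(a) / 2):
    under the integral, and from the closed form. *)
Lemma gaussian_mul_sin a b :
  \int[P]_w (dotv a (X ^~ w) * sin (dotv a (X ^~ w) + b)) =
  qf S a * (cos b * expR (- (qf S a / 2))).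
Proof.
have [_ iX cf] := gX.
have iD : P.-integrable setT (EFin \o (fun w => dotv a (X ^~ w))).
  by apply: integrable_sum_seq => j; exact: integrableZ.
have D := is_derive_Rintegral_cos 1 b (measurable_dotv a) iD.
have E r : \int[P]_w cos (r * dotv a (X ^~ w) + b) = cos b * expR (r ^+ 2 * (- (qf S a / 2))).
  have -> : r ^+ 2 * (- (qf S a / 2)) = - (qf S (fun j => r * a j) / 2).
    rewrite mulrN mulrA; congr (- (_ / _)); rewrite /qf mulr_sumr.
    by apply: eq_bigr => j _; rewrite mulr_sumr; apply: eq_bigr => k _; ring.
  rewrite -cf; apply: eq_Rintegral => w _; congr (cos (_ + _)).
  by rewrite mulr_sumr; apply: eq_bigr => j _; rewrite mulrA.
have D2 : is_derive (1:R) (1:R) (fun r => \int[P]_w cos (r * dotv a (X ^~ w) + b))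
    (cos b * (2 * 1 * (- (qf S a / 2)) * expR (1 ^+ 2 * (- (qf S a / 2))))).
  rewrite (_ : (fun r => _) = (fun r => cos b * expR (r ^+ 2 * (- (qf S a / 2))))); last first.
    by apply/funext.
  have H := is_derive_expR_sqr (- (qf S a / 2)) (1:R).
  by apply: is_derive_eq (is_deriveZ (cos b) H) _.
have := @derive_val _ _ _ _ _ _ _ D; rewrite (@derive_val _ _ _ _ _ _ _ D2).
under eq_Rintegral do rewrite mul1r.
by rewrite expr1n !mul1r mulr1 => /eqP; rewrite -eqr_oppLR => /eqP <-; field.
Qed.

Lemma integrable_mul_bounded j (f : T -> R) M : measurable_fun setT f ->
  (forall w, `|f w| <= M) -> P.-integrable setT (EFin \o (fun w => X j w * f w)).
Proof.
move=> mf fM; have [_ iX _] := gX.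
apply: (le_integrable measurableT _ _ (integrableZ M (iX j))).
  by apply/measurable_EFinP; exact: measurable_funM.
move=> w _; rewrite /= lee_fin !normrM mulrC ler_wpM2r//.
by rewrite (le_trans (fM w))// ler_norm.
Qed.

Lemma tp_stein s :
  \int[P]_w (\sum_j X j w * tp1 s j (X ^~ w)) =
  \int[P]_w (\sum_j \sum_k S j k * tp2 s j k (X ^~ w)).
Proof.
have msin a b : measurable_fun setT (fun w => sin (dotv a (X ^~ w) + b)).
  have := measurable_sin_affine 1 b (measurable_dotv a).
  by under eq_fun do rewrite mul1r.
have isin a b : P.-integrable setT (EFin \o (fun w =>
    dotv a (X ^~ w) * sin (dotv a (X ^~ w) + b))).
  rewrite /dotv; under [X in EFin \o X]eq_fun do rewrite mulr_suml.
  apply: integrable_sum_seq => j.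
  under [X in EFin \o X]eq_fun do rewrite -mulrA.
  apply: integrableZ; apply: (@integrable_mul_bounded _ _ 1); first exact: msin.
  by move=> w; exact: sin_max.
have icos a b : P.-integrable setT (EFin \o (fun w => cos (dotv a (X ^~ w) + b))).
  apply: (@integrable_ub _ _ _ _ _ 1); first exact: measurable_cos_dotv.
  by move=> w; exact: cos_max.
transitivity (\sum_(t <- s) - t.1.1 * (qf S t.1.2 * (cos t.2 * expR (- (qf S t.1.2 / 2))))).
  transitivity (\int[P]_w (\sum_(t <- s) - t.1.1 *
      (dotv t.1.2 (X ^~ w) * sin (dotv t.1.2 (X ^~ w) + t.2)))).
    apply: eq_Rintegral => w _; rewrite /tp1.
    under eq_bigr do rewrite mulr_sumr.
    rewrite exchange_big; apply: eq_bigr => t _ /=.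
    rewrite {2}/dotv mulr_suml mulr_sumr; apply: eq_bigr => j _; ring.
  rewrite Rintegral_sum; last by move=> t; exact: integrableZ.
  by apply: eq_bigr => t _; rewrite RintegralZl// gaussian_mul_sin.
have [_ _ cf] := gX.
under [RHS]eq_Rintegral do rewrite tp2_contract.
transitivity (\int[P]_w (\sum_(t <- s) - (t.1.1 * qf S t.1.2) *
   cos (dotv t.1.2 (X ^~ w) + t.2))); last first.
  by apply: eq_Rintegral => w _; apply: eq_bigr => t _; rewrite mulNr.
rewrite Rintegral_sum; last by move=> t; exact: integrableZ.
by apply: eq_bigr => t _; rewrite RintegralZl// cf -/(qf S _); ring.
Qed.

End one_vector.

Section two_vectors.
Context d1 (T1 : measurableType d1) (P1 : probability T1 R).
Context d2 (T2 : measurableType d2) (P2 : probability T2 R).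
Context (X : 'I_p -> T1 -> R) (Y : 'I_p -> T2 -> R) (S1 S2 : 'I_p -> 'I_p -> R).
Hypotheses (gX : gaussian_cf P1 X S1) (gY : gaussian_cf P2 Y S2).

(* The expectation of [tp0 s] under N(0, t S1 + (1 - t) S2). *)
Let Phi s (t : R) : R := \sum_(u <- s)
  u.1.1 * (cos u.2 * expR (t * (- ((qf S1 u.1.2 - qf S2 u.1.2) / 2)) + - (qf S2 u.1.2 / 2))).

(** An iterated expectation of [tp0 s] at sqrt(t) X + sqrt(1 - t) Y: integrating over Y with x
    frozen damps the coefficients and gives [s'], still bounded by B, which is then integrated over
    X. So X and Y may live on different spaces. *)
Let Phi_le s t B : 0 <= t <= 1 -> (forall x, tp0 s x <= B) -> Phi s t <= B.
Proof.
move=> /andP[t0 t1] sB.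
pose s' : seq (R * ('I_p -> R) * R) :=
  [seq (u.1.1 * expR (- ((1 - t) * qf S2 u.1.2 / 2)), u.1.2, u.2) | u <- s].
have s'B x : tp0 s' (fun j => 0 + Num.sqrt t * x j) <= B.
  have -> : tp0 s' (fun j => 0 + Num.sqrt t * x j) =
      \int[P2]_w tp0 s (fun j => Num.sqrt t * x j + Num.sqrt (1 - t) * Y j w).
    rewrite (Rintegral_tp0 gY) sqr_sqrtr ?subr_ge0// /tp0 big_map.
    apply: eq_bigr => u _ /=; under [in LHS]eq_fun do rewrite add0r; ring.
  by apply: Rintegral_le_cst => //; exact: integrable_tp0 gY _ _ _.
have -> : Phi s t = \int[P1]_w tp0 s' (fun j => 0 + Num.sqrt t * X j w).
  rewrite (Rintegral_tp0 gX) sqr_sqrtr// big_map; apply: eq_bigr => u _ /=.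
  have -> : dotv u.1.2 (fun=> 0) = 0 by rewrite /dotv big1// => j _; rewrite mulr0.
  rewrite add0r -mulrA (mulrCA (expR _)) -expRD; congr (_ * (_ * expR _)).
  by field.
by apply: Rintegral_le_cst => //; exact: integrable_tp0 gX _ _ _.
Qed.

Let Phi_derive s t : is_derive t (1:R) (Phi s)
  (Phi [seq (- (u.1.1 * (qf S1 u.1.2 - qf S2 u.1.2)), u.1.2, u.2) | u <- s] t / 2).
Proof.
rewrite /Phi big_map; elim: s => [|u r IH].
  rewrite big_nil mul0r (_ : (fun t => _) = cst 0); first exact: is_derive_cst.
  by apply/funext => v; rewrite big_nil.
rewrite (_ : (fun t => _) = (u.1.1 * cos u.2) \*: (fun t => expR (t * (- ((qf S1 u.1.2 - qf S2 u.1.2) / 2)) + - (qf S2 u.1.2 / 2))) + (fun t => \sum_(u <- r)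
u.1.1 * (cos u.2 * expR (t * (- ((qf S1 u.1.2 - qf S2 u.1.2) / 2)) + - (qf S2 u.1.2 / 2))))); last first.
  by apply/funext => v; rewrite big_cons /= fctE mulrA.
have H := is_derive_expR_affine (- ((qf S1 u.1.2 - qf S2 u.1.2) / 2)) (- (qf S2 u.1.2 / 2)) t.
apply: is_derive_eq (is_deriveD (is_deriveZ (u.1.1 * cos u.2) H) IH) _.
by rewrite big_cons /GRing.scale /=; ring.
Qed.

(** Along the interpolation the derivative is half the expectation of [Ls], the contraction of S1 -
    S2 with the Hessian, which is again a trigonometric polynomial. The mean value theorem does the
    rest. *)
Lemma tp_comparison s B :
  (forall x, \sum_j \sum_k (S1 j k - S2 j k) * tp2 s j k x <= B) ->
  \int[P1]_w tp0 s (X ^~ w) - \int[P2]_w tp0 s (Y ^~ w) <= B / 2.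
Proof.
move=> HB.
pose Ls : seq (R * ('I_p -> R) * R) :=
  [seq (- (u.1.1 * (qf S1 u.1.2 - qf S2 u.1.2)), u.1.2, u.2) | u <- s].
have LB x : tp0 Ls x <= B.
  apply: le_trans (HB x); rewrite tp2_contract /tp0 big_map.
  by rewrite le_eqVlt; apply/orP; left; apply/eqP; apply: eq_bigr => u _; rewrite qfB mulNr.
have dPhi t : is_derive t (1:R) (Phi s) (Phi Ls t / 2) by exact: Phi_derive.
have E1 : \int[P1]_w tp0 s (X ^~ w) = Phi s 1.
  transitivity (\int[P1]_w tp0 s (fun j => 0 + 1 * X j w)).
    by apply: eq_Rintegral => w _; congr tp0; apply/funext => j; rewrite add0r mul1r.
  rewrite (Rintegral_tp0 gX); apply: eq_bigr => u _.
  have -> : dotv u.1.2 (fun=> 0) = 0 by rewrite /dotv big1// => j _; rewrite mulr0.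
  by rewrite add0r; congr (_ * (_ * expR _)); field.
have E2 : \int[P2]_w tp0 s (Y ^~ w) = Phi s 0.
  transitivity (\int[P2]_w tp0 s (fun j => 0 + 1 * Y j w)).
    by apply: eq_Rintegral => w _; congr tp0; apply/funext => j; rewrite add0r mul1r.
  rewrite (Rintegral_tp0 gY); apply: eq_bigr => u _.
  have -> : dotv u.1.2 (fun=> 0) = 0 by rewrite /dotv big1// => j _; rewrite mulr0.
  by rewrite add0r; congr (_ * (_ * expR _)); field.
rewrite E1 E2.
have cPhi : {within `[0, 1], continuous (Phi s)}.
  by apply: derivable_within_continuous => t _; have H := dPhi t; exact: ex_derive.
have [c c01 ->] := @MVT R (Phi s) (fun t => Phi Ls t / 2) 0 1 ltr01 (fun t _ => dPhi t) cPhi.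
rewrite subr0 mulr1 ler_pM2r ?invr_gt0//; apply: Phi_le => //.
by move: c01; rewrite in_itv/= => /andP[c0 c1]; rewrite !ltW.
Qed.

End two_vectors.
End gaussian_trigonometric.

(** * From trigonometric polynomials to log-sum-exp *)

Section gaussian_limits.
Context {R : realType} {p : nat}.
Implicit Types (S : 'I_p -> 'I_p -> R).

Lemma trig_limit_integrable d (T : measurableType d) (P : probability T R)
    (X : 'I_p -> T -> R) f f1 f2 : trig_limit f f1 f2 ->
  measurable_fun setT (fun w => f (X ^~ w)) ->
  P.-integrable setT (EFin \o (fun w => f (X ^~ w))).
Proof.
move=> F mf; have [M HM] := trig_limit_bounded F.
by apply: (@integrable_ub _ _ _ _ _ M) => // w; have [] := HM (X ^~ w).
Qed.

Lemma trig_limit_comparison d1 (T1 : measurableType d1) (P1 : probability T1 R)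
    d2 (T2 : measurableType d2) (P2 : probability T2 R)
    (X : 'I_p -> T1 -> R) (Y : 'I_p -> T2 -> R) S1 S2 f f1 f2 B :
  gaussian_cf P1 X S1 -> gaussian_cf P2 Y S2 -> trig_limit f f1 f2 ->
  measurable_fun setT (fun w => f (X ^~ w)) ->
  measurable_fun setT (fun w => f (Y ^~ w)) ->
  (forall x, \sum_j \sum_k (S1 j k - S2 j k) * f2 j k x <= B) ->
  \int[P1]_w f (X ^~ w) - \int[P2]_w f (Y ^~ w) <= B / 2.
Proof.
move=> gX gY F mX mY HB.
pose K := \sum_j \sum_k `|S1 j k - S2 j k|.
have K0 : 0 <= K by apply: sumr_ge0 => j _; exact: sumr_ge0.
(* The error e enters once in each of the two expectations, and as e K in the bound on the
   contracted Hessian, which is halved. *)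
apply/ler_addgt0Pr => e0 e00; pose e := e0 / (K / 2 + 2).
have K2 : 0 < K / 2 + 2 by rewrite ltr_wpDl// divr_ge0.
have ep : 0 < e by rewrite divr_gt0.
have eE : e * K / 2 + e + e = e0.
  rewrite (_ : e * K / 2 + e + e = e * (K / 2 + 2)); last by field.
  by rewrite /e divfK ?gt_eqF.
have [s Hs] := F _ ep.
have iX := trig_limit_integrable P1 F mX.
have iY := trig_limit_integrable P2 F mY.
have tpE d (T : measurableType d) (P : probability T R) (Z : 'I_p -> T -> R) S0 :
    gaussian_cf P Z S0 -> P.-integrable setT (EFin \o (fun w => tp0 s (Z ^~ w))).
  move=> gZ; have := integrable_tp0 gZ s (fun=> 0) 1.
  apply: eq_integrable => // w _ /=; congr (tp0 s _)%:E.
  by apply/funext => j; rewrite add0r mul1r.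
have tX := tpE _ _ _ _ _ gX; have tY := tpE _ _ _ _ _ gY.
have hX : \int[P1]_w f (X ^~ w) <= \int[P1]_w tp0 s (X ^~ w) + e.
  rewrite -lerBlDl -RintegralB//; apply: Rintegral_le_cst.
    by have := integrableB measurableT iX tX; apply: eq_integrable.
  by move=> w; have [h _ _] := Hs (X ^~ w); apply: le_trans (ler_norm _) h.
have hY : \int[P2]_w tp0 s (Y ^~ w) <= \int[P2]_w f (Y ^~ w) + e.
  rewrite -lerBlDl -RintegralB//; apply: Rintegral_le_cst.
    by have := integrableB measurableT tY iY; apply: eq_integrable.
  move=> w; have [h _ _] := Hs (Y ^~ w); rewrite distrC in h.
  exact: le_trans (ler_norm _) h.
have HB' x : \sum_j \sum_k (S1 j k - S2 j k) * tp2 s j k x <= B + e * K.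
  apply: (@le_trans _ _ (\sum_j \sum_k ((S1 j k - S2 j k) * f2 j k x + e * `|S1 j k - S2 j k|))).
    apply: ler_sum => j _; apply: ler_sum => k _; have [_ _ h2] := Hs x.
    rewrite -lerBlDl -mulrBr; apply: le_trans (ler_norm _) _.
    by rewrite normrM mulrC ler_wpM2r// distrC.
  under eq_bigr do rewrite big_split /= -mulr_sumr.
  by rewrite big_split /= -mulr_sumr lerD.
have := tp_comparison gX gY HB'; lra.
Qed.

Lemma trig_limit_stein d (T : measurableType d) (P : probability T R)
    (X : 'I_p -> T -> R) S f f1 f2 :
  gaussian_cf P X S -> trig_limit f f1 f2 ->
  (forall j, measurable_fun setT (fun w => f1 j (X ^~ w))) ->
  (forall j k, measurable_fun setT (fun w => f2 j k (X ^~ w))) ->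
  \int[P]_w (\sum_j \sum_k S j k * f2 j k (X ^~ w)) <=
  \int[P]_w (\sum_j X j w * f1 j (X ^~ w)).
Proof.
move=> gX F m1 m2; have [_ iX _] := gX.
have [M HM] := trig_limit_bounded F.
pose K := \sum_j \sum_k `|S j k|.
have K0 : 0 <= K by apply: sumr_ge0 => j _; exact: sumr_ge0.
pose A := \int[P]_w (\sum_j `|X j w|).
have A0 : 0 <= A by apply: Rintegral_ge0 => w _; exact: sumr_ge0.
(* An error e in the Hessian costs e K; in the gradient it is multiplied by the unbounded X j and
   costs e A. *)
apply/ler_addgt0Pr => e0 e00; pose e := e0 / (K + A + 1).
have K2 : 0 < K + A + 1 by rewrite ltr_wpDl// addr_ge0.
have ep : 0 < e by rewrite divr_gt0.
have eE : e * K + e * A <= e0.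
  rewrite -mulrDr /e mulrAC ler_pdivrMr// ler_wpM2l ?(ltW e00)//.
  by rewrite lerDl.
have [s Hs] := F _ ep.
have mtp1 j : measurable_fun setT (fun w => tp1 s j (X ^~ w)).
  apply: measurable_sum => t; apply: measurable_funN.
  apply: measurable_funM => //.
  have := measurable_sin_affine 1 t.2 (measurable_dotv gX t.1.2).
  by under eq_fun do rewrite mul1r.
have mtp2 j k : measurable_fun setT (fun w => tp2 s j k (X ^~ w)).
  apply: measurable_sum => t; apply: measurable_funN.
  by apply: measurable_funM => //; exact: measurable_cos_dotv gX _ _.
have [N HN] := tp_bounded s.
have i1 : P.-integrable setT (EFin \o (fun w => \sum_j X j w * f1 j (X ^~ w))).
  apply: integrable_sum_seq => j; apply: (integrable_mul_bounded gX) => // w.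
  by have [_ h _] := HM (X ^~ w); exact: h.
have it1 : P.-integrable setT (EFin \o (fun w => \sum_j X j w * tp1 s j (X ^~ w))).
  apply: integrable_sum_seq => j; apply: (integrable_mul_bounded gX) => // w.
  by have [_ h _] := HN (X ^~ w); exact: h.
have i2 : P.-integrable setT (EFin \o (fun w => \sum_j \sum_k S j k * f2 j k (X ^~ w))).
  apply: integrable_sum_seq => j; apply: integrable_sum_seq => k.
  apply: integrableZ; apply: (@integrable_ub _ _ _ _ _ M) => // w.
  by have [_ _ h] := HM (X ^~ w).
have it2 : P.-integrable setT (EFin \o (fun w => \sum_j \sum_k S j k * tp2 s j k (X ^~ w))).
  apply: integrable_sum_seq => j; apply: integrable_sum_seq => k.
  apply: integrableZ; apply: (@integrable_ub _ _ _ _ _ N) => // w.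
  by have [_ _ h] := HN (X ^~ w).
have iA : P.-integrable setT (EFin \o (fun w => \sum_j `|X j w|)).
  by apply: integrable_sum_seq => j; exact: integrable_norm (iX j).
have h2 : \int[P]_w (\sum_j \sum_k S j k * f2 j k (X ^~ w)) <=
    \int[P]_w (\sum_j \sum_k S j k * tp2 s j k (X ^~ w)) + e * K.
  rewrite -lerBlDl -RintegralB//; apply: Rintegral_le_cst.
    by have := integrableB measurableT i2 it2; apply: eq_integrable.
  move=> w; rewrite -sumrB /K mulr_sumr; apply: ler_sum => j _.
  rewrite -sumrB mulr_sumr; apply: ler_sum => k _; rewrite -mulrBr.
  have [_ _ h] := Hs (X ^~ w).
  by apply: le_trans (ler_norm _) _; rewrite normrM mulrC ler_wpM2r.
have h1 : \int[P]_w (\sum_j X j w * tp1 s j (X ^~ w)) <=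
    \int[P]_w (\sum_j X j w * f1 j (X ^~ w)) + e * A.
  rewrite -lerBlDl -RintegralB// /A -RintegralZl//.
  apply: le_Rintegral => //.
    by have := integrableB measurableT it1 i1; apply: eq_integrable.
    exact: integrableZ.
  move=> w _; rewrite -sumrB mulr_sumr; apply: ler_sum => j _; rewrite -mulrBr.
  have [_ h _] := Hs (X ^~ w).
  apply: le_trans (ler_norm _) _; rewrite normrM mulrC ler_wpM2r// distrC.
  exact: h.
have := tp_stein gX s; lra.
Qed.

Lemma norm_sin_le (u : R) : `|sin u| <= `|u|.
Proof.
wlog u0 : u / 0 <= u => [H|].
  have [u0|/ltW u0] := leP 0 u; first exact: H.
  by rewrite -normrN -sinN -(normrN u) H// oppr_ge0.
have csin : {within `[0, u], continuous (@sin R)}.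
  by apply: continuous_subspaceT; exact: continuous_sin.
have [c _] := MVT_segment u0 (fun x _ => is_derive_sin x) csin.
rewrite sin0 !subr0 => ->; rewrite normrM ler_piMl//; exact: cos_max.
Qed.

Lemma clip_norm_le L (x : 'I_p -> R) j : 0 < L -> `|clip L x j| <= `|x j|.
Proof.
move=> L0; rewrite /clip normrM (gtr0_norm L0) -ler_pdivlMl//.
by rewrite (le_trans (norm_sin_le _))// normrM normfV (gtr0_norm L0) mulrC.
Qed.

(** The clipped value is the difference quotient at 0 of u |-> sin(u x j), with increment 1 / (n +
    1). *)
Lemma clip_cvg (x : 'I_p -> R) j : clip n.+1%:R x j @[n --> \oo] --> x j.
Proof.
have H := is_derive_sin_affine (x j) 0 (0 : R).
pose f u := sin (u * x j + 0).
have D : h^-1 *: (f (h + 0) - f 0) @[h --> 0^'] --> x j * cos (0 * x j + 0).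
  have [/cvg_ex[l lP] <-] := H.
  have <- : l = 'D_1 f 0 by apply/esym/cvg_lim.
  by move: lP; rewrite /=; under eq_fun do rewrite scaler1.
have seq : (forall n, (n.+1%:R^-1 : R) != 0) /\ (n.+1%:R^-1 : R) @[n --> \oo] --> 0.
  by split; [move=> n; rewrite invr_neq0// pnatr_eq0|exact: cvg_harmonic].
move/cvgr_dnbhsP: D => /(_ _ seq).
rewrite mul0r addr0 cos0 mulr1 /f mul0r addr0 sin0.
by under eq_fun do rewrite !addr0 subr0 invrK (mulrC _ (x j)).
Qed.

Lemma cos_clip_cvg (x : 'I_p -> R) j : cos (x j / n.+1%:R) @[n --> \oo] --> (1 : R).
Proof.
rewrite -[X in _ --> X](@cos0 R).
apply: continuous_cvg; first exact: continuous_cos.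
rewrite -[X in _ --> X](mulr0 (x j)); apply: cvgM; first exact: cvg_cst.
exact: cvg_harmonic.
Qed.

Section measurability.
Context d (T : measurableType d) (Z : 'I_p -> T -> R).
Hypothesis mZ : forall j, measurable_fun setT (Z j).

Lemma measurable_expsum b mu : measurable_fun setT (fun w => expsum b mu (Z ^~ w)).
Proof.
apply: measurable_sum => j; apply: measurableT_comp => //.
by apply: measurable_funM => //; exact: measurable_funD.
Qed.

Lemma measurable_inv_expsum1 b mu :
  measurable_fun setT (fun w => (1 + expsum b mu (Z ^~ w))^-1).
Proof.
have mln : measurable_fun setT (fun w => expR (- ln (1 + expsum b mu (Z ^~ w)))).
  apply: measurableT_comp => //; apply: measurable_funN.
  by apply: measurableT_comp => //; apply: measurable_funD => //; exact: measurable_expsum.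
move: mln; congr measurable_fun; apply/funext => w.
by rewrite expRN lnK// posrE expsum1_gt0.
Qed.

Lemma measurable_lse b mu : measurable_fun setT (fun w => lse b mu (Z ^~ w)).
Proof.
apply: measurable_funM => //; apply: measurableT_comp => //.
by apply: measurable_funD => //; exact: measurable_expsum.
Qed.

Lemma measurable_softmax b mu j :
  measurable_fun setT (fun w => softmax b mu (Z ^~ w) j).
Proof.
apply: measurable_funM; last exact: measurable_inv_expsum1.
apply: measurableT_comp => //.
by apply: measurable_funM => //; exact: measurable_funD.
Qed.

Lemma measurable_clip L j : measurable_fun setT (fun w => clip L (Z ^~ w) j).
Proof.
apply: measurable_funM => //; have := measurable_sin_affine L^-1 0 (mZ j).
by under eq_fun do rewrite addr0 mulrC.
Qed.

Lemma measurable_cos_clip L j : measurable_fun setT (fun w => cos (Z j w / L)).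
Proof.
have := measurable_cos_affine L^-1 0 (mZ j).
by under eq_fun do rewrite addr0 mulrC.
Qed.

End measurability.

Lemma lse_ge0 b mu (x : 'I_p -> R) : 0 < b -> 0 <= lse b mu x.
Proof.
move=> b0; rewrite mulr_ge0 ?invr_ge0 ?(ltW b0)// ln_ge0//.
by rewrite lerDl expsum_ge0.
Qed.

Lemma lse_ge b mu (x : 'I_p -> R) j : 0 < b -> x j + mu j <= lse b mu x.
Proof.
move=> b0; rewrite /lse ler_pdivlMl// -ler_expR lnK ?posrE ?expsum1_gt0//.
rewrite /expsum (bigD1 j)//= addrCA lerDl addr_ge0//.
by apply: sumr_ge0 => i _; exact: expR_ge0.
Qed.

Lemma lse_le b mu (x : 'I_p -> R) : 0 < b ->
  lse b mu x <= b^-1 * ln (1 + p%:R) + (\sum_j `|mu j| + \sum_j `|x j|).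
Proof.
move=> b0; set A := _ + \sum_j _.
have A0 : 0 <= A by rewrite addr_ge0// sumr_ge0.
have p1 : 0 < 1 + p%:R :> R by rewrite ltr_pwDl.
rewrite /lse -(ler_pM2l b0) mulrDr !(mulVKf (lt0r_neq0 b0)).
rewrite -ler_expR expRD !lnK ?posrE ?expsum1_gt0// mulrDl lerD//.
  by rewrite mul1r -[leLHS]expR0 ler_expR mulr_ge0// ltW.
rewrite mulr_natl -[p in _ *+ p]card_ord -sumr_const; apply: ler_sum => j _.
rewrite ler_expR ler_pM2l// (le_trans (ler_norm _))// (le_trans (ler_normD _ _))//.
rewrite addrC lerD//.
  by rewrite (bigD1 j)//= lerDl sumr_ge0.
by rewrite (bigD1 j)//= lerDl sumr_ge0.
Qed.

Lemma cvg_sumr (I : Type) (r : seq I) (f : nat -> I -> R) (l : I -> R) :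
  (forall i, f n i @[n --> \oo] --> l i) ->
  \sum_(i <- r) f n i @[n --> \oo] --> \sum_(i <- r) l i.
Proof.
move=> fl; elim: r => [|i r IH].
  by rewrite big_nil; under eq_fun do rewrite big_nil; exact: cvg_cst.
by rewrite big_cons; under eq_fun do rewrite big_cons; exact: cvgD.
Qed.

Lemma expsum_cvg b mu (u : nat -> 'I_p -> R) (x : 'I_p -> R) :
  (forall j, u n j @[n --> \oo] --> x j) ->
  expsum b mu (u n) @[n --> \oo] --> expsum b mu x.
Proof.
move=> ux; apply: cvg_sumr => j.
apply: continuous_cvg; first exact: continuous_expR.
apply: cvgM; first exact: cvg_cst.
by apply: cvgD => //; exact: cvg_cst.
Qed.

Lemma lse_cvg b mu (u : nat -> 'I_p -> R) (x : 'I_p -> R) :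
  (forall j, u n j @[n --> \oo] --> x j) ->
  lse b mu (u n) @[n --> \oo] --> lse b mu x.
Proof.
move=> ux; apply: cvgM; first exact: cvg_cst.
apply: continuous_cvg.
  by apply: continuous_ln; exact: expsum1_gt0.
by apply: cvgD; [exact: cvg_cst|exact: expsum_cvg].
Qed.

Lemma softmax_cvg b mu (u : nat -> 'I_p -> R) (x : 'I_p -> R) j :
  (forall j, u n j @[n --> \oo] --> x j) ->
  softmax b mu (u n) j @[n --> \oo] --> softmax b mu x j.
Proof.
move=> ux; apply: cvgM.
  apply: continuous_cvg; first exact: continuous_expR.
  apply: cvgM; first exact: cvg_cst.
  by apply: cvgD => //; exact: cvg_cst.
apply: cvgV; first by rewrite gt_eqF// expsum1_gt0.
by apply: cvgD; [exact: cvg_cst|exact: expsum_cvg].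
Qed.

Lemma inv_expsum1_cvg b mu (u : nat -> 'I_p -> R) (x : 'I_p -> R) :
  (forall j, u n j @[n --> \oo] --> x j) ->
  (1 + expsum b mu (u n))^-1 @[n --> \oo] --> (1 + expsum b mu x)^-1.
Proof.
move=> ux; apply: cvgV; first by rewrite gt_eqF// expsum1_gt0.
by apply: cvgD; [exact: cvg_cst|exact: expsum_cvg].
Qed.

Lemma lse_clip_cvg d (T : measurableType d) (P : probability T R)
    (X : 'I_p -> T -> R) b mu : 0 < b ->
  (forall j, measurable_fun setT (X j)) ->
  (forall j, P.-integrable setT (EFin \o X j)) ->
  P.-integrable setT (EFin \o (fun w => lse b mu (X ^~ w))) /\
  \int[P]_w lse b mu (clip n.+1%:R (X ^~ w)) @[n --> \oo] -->
  \int[P]_w lse b mu (X ^~ w).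
Proof.
move=> b0 mX iX.
apply: (@Rintegral_dominated _ _ _ P (fun n w => lse b mu (clip n.+1%:R (X ^~ w))) _
  (fun w => b^-1 * ln (1 + p%:R) + (\sum_j `|mu j| + \sum_j `|X j w|))).
- move=> n; apply: (@measurable_lse _ _ (fun j w => clip n.+1%:R (X ^~ w) j)) => j.
  exact: measurable_clip.
- by move=> w; apply: lse_cvg => j; exact: clip_cvg.
- apply: integrableDR; first exact: integrable_cst.
  apply: integrableDR; first exact: integrable_cst.
  by apply: integrable_sum_seq => j; exact: integrable_norm (iX j).
- move=> n w; rewrite ger0_norm ?lse_ge0// (le_trans (lse_le _ _ b0))//.
  by rewrite !lerD2l; apply: ler_sum => j _; exact: clip_norm_le.
Qed.

Lemma lse_comparison d1 (T1 : measurableType d1) (P1 : probability T1 R)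
    d2 (T2 : measurableType d2) (P2 : probability T2 R)
    (X : 'I_p -> T1 -> R) (Y : 'I_p -> T2 -> R) S1 S2 b mu t :
  gaussian_cf P1 X S1 -> gaussian_cf P2 Y S2 -> 0 < b -> 0 <= t ->
  (forall j k, `|S1 j k - S2 j k| <= t) ->
  \int[P1]_w lse b mu (X ^~ w) - \int[P2]_w lse b mu (Y ^~ w) <= t * b.
Proof.
move=> gX gY b0 t0 St.
have [mX iX _] := gX; have [mY iY _] := gY.
have [_ lX] := lse_clip_cvg mu b0 mX iX.
have [_ lY] := lse_clip_cvg mu b0 mY iY.
have ub n : \int[P1]_w lse b mu (clip n.+1%:R (X ^~ w)) -
    \int[P2]_w lse b mu (clip n.+1%:R (Y ^~ w)) <= t * b + t / 2 * n.+1%:R^-1.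
  have n0 : 0 < n.+1%:R :> R by rewrite ltr0n.
  apply: le_trans (trig_limit_comparison gX gY (trig_limit_lse mu b0 n0) _ _ _) _.
  - apply: (@measurable_lse _ _ (fun j w => clip n.+1%:R (X ^~ w) j)) => j.
    exact: measurable_clip.
  - apply: (@measurable_lse _ _ (fun j w => clip n.+1%:R (Y ^~ w) j)) => j.
    exact: measurable_clip.
  - by move=> x; exact: (lse_hessian_le mu x b0 n0 t0 St).
  - by rewrite le_eqVlt; apply/orP; left; apply/eqP; set N := _^-1; field.
have lub : t * b + t / 2 * n.+1%:R^-1 @[n --> \oo] --> t * b.
  rewrite -[X in _ --> X]addr0; apply: cvgD; first exact: cvg_cst.
  rewrite -[X in _ --> X](mulr0 (t / 2)); apply: cvgM; first exact: cvg_cst.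
  exact: cvg_harmonic.
apply: (ler_cvg_to (cvgB lX lY) lub); exact: nearW.
Qed.

(** The zero vector is Gaussian with covariance 0, at entrywise distance at most 1 from [S]; the
    comparison costs b, and b^-1 log(1 + p) is the value of [lse] at the origin. *)
Lemma lse_max_expectation d (T : measurableType d) (P : probability T R)
    (X : 'I_p -> T -> R) S b : gaussian_cf P X S -> 0 < b ->
  (forall j k, `|S j k| <= 1) ->
  \int[P]_w lse b (fun=> 0) (X ^~ w) <= b^-1 * ln (1 + p%:R) + b.
Proof.
move=> gX b0 S1.
have g0 : gaussian_cf P (fun (_ : 'I_p) (_ : T) => 0 : R) (fun _ _ => 0).
  split=> //.
  - by move=> j; exact: integrable_cst.
  - move=> a c; have -> : \sum_j \sum_k a j * a k * 0 = 0.
      by rewrite big1// => j _; rewrite big1// => k _; rewrite mulr0.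
    rewrite mul0r oppr0 expR0 mulr1 -[RHS](Rintegral_prob_cst P).
    by apply: eq_Rintegral => w _; rewrite big1 ?add0r// => j _; rewrite mulr0.
have := @lse_comparison _ _ _ _ _ _ _ _ _ _ b (fun=> 0) 1 gX g0 b0 ler01.
rewrite mul1r lerBlDl Rintegral_prob_cst => H.
apply: (le_trans (H _)) => [j k|]; first by rewrite subr0.
rewrite lerD2r; apply: (le_trans (lse_le _ _ b0)).
by rewrite !big1 ?addr0// => j _; rewrite normr0.
Qed.

(** Stein's inequality for the clipped function, with the Hessian bounded below by [lse_hessian_ge],
    in the limit L = n + 1. The left side is bounded by a constant and the right side by sum_j |X
    j|. *)
Lemma softmax_stein d (T : measurableType d) (P : probability T R)
    (X : 'I_p -> T -> R) S b mu : gaussian_cf P X S -> 0 < b ->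
  (forall j, S j j = 1) -> (forall j k, `|S j k| <= 1) ->
  \int[P]_w (b * ((1 + expsum b mu (X ^~ w))^-1 * \sum_j softmax b mu (X ^~ w) j)) <=
  \int[P]_w (\sum_j X j w * softmax b mu (X ^~ w) j).
Proof.
move=> gX b0 Sjj S1; have [mX iX _] := gX.
pose lhs n w := b * ((1 + expsum b mu (clip n.+1%:R (X ^~ w)))^-1 *
   \sum_j softmax b mu (clip n.+1%:R (X ^~ w)) j * cos (X j w / n.+1%:R) ^+ 2) - n.+1%:R^-1.
pose rhs n w := \sum_j X j w * (softmax b mu (clip n.+1%:R (X ^~ w)) j * cos (X j w / n.+1%:R)).
have mclip n j : measurable_fun setT (fun w => clip n.+1%:R (X ^~ w) j) by exact: measurable_clip.
have msm n j : measurable_fun setT (fun w => softmax b mu (clip n.+1%:R (X ^~ w)) j).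
  exact: (measurable_softmax (mclip n)).
have mlhs n : measurable_fun setT (lhs n).
  apply: measurable_funB => //; apply: measurable_funM => //; apply: measurable_funM.
    exact: (measurable_inv_expsum1 (mclip n)).
  apply: measurable_sum => j; apply: measurable_funM; first exact: msm.
  by apply: measurable_funX; exact: measurable_cos_clip.
have mrhs n : measurable_fun setT (rhs n).
  apply: measurable_sum => j; apply: measurable_funM => //.
  by apply: measurable_funM; [exact: msm|exact: measurable_cos_clip].
have sm1 n w j : `|softmax b mu (clip n.+1%:R (X ^~ w)) j| <= 1.
  rewrite ger0_norm ?softmax_ge0// (le_trans _ (sum_softmax_le1 b mu (clip n.+1%:R (X ^~ w))))//.
  by rewrite (bigD1 j)//= lerDl sumr_ge0// => i _; exact: softmax_ge0.
have lb n w : `|lhs n w| <= b * p%:R + 1.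
  apply: le_trans (ler_normB _ _) _; apply: lerD; last first.
    by rewrite ger0_norm ?invr_ge0// invf_le1// ler1n.
  rewrite normrM (gtr0_norm b0) ler_pM2l// normrM -[leRHS]mul1r ler_pM//.
    rewrite ger0_norm; last by rewrite invr_ge0 ltW// expsum1_gt0.
    by rewrite invf_le1 ?expsum1_gt0// lerDl expsum_ge0.
  apply: le_trans (ler_norm_sum _ _ _) _.
  apply: (@le_trans _ _ (\sum_(j < p) 1)); last by rewrite sumr_const card_ord.
  by apply: ler_sum => j _; rewrite normrM mulr_ile1// normrX exprn_ile1// cos_max.
have rb n w : `|rhs n w| <= \sum_j `|X j w|.
  apply: le_trans (ler_norm_sum _ _ _) _; apply: ler_sum => j _.
  by rewrite normrM ler_piMr// normrM mulr_ile1// cos_max.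
have cl w : lhs n w @[n --> \oo] -->
    b * ((1 + expsum b mu (X ^~ w))^-1 * \sum_j softmax b mu (X ^~ w) j).
  rewrite -[X in _ --> X]subr0; apply: cvgB; last exact: cvg_harmonic.
  apply: cvgM; first exact: cvg_cst.
  apply: cvgM; first by apply: inv_expsum1_cvg => j; exact: clip_cvg.
  apply: cvg_sumr => j; rewrite -[X in _ --> X]mulr1; apply: cvgM.
    by apply: softmax_cvg => i; exact: clip_cvg.
  rewrite -[X in _ --> X](mulr1 1); under eq_fun do rewrite expr2.
  by apply: cvgM; exact: (cos_clip_cvg (X ^~ w)).
have cr w : rhs n w @[n --> \oo] --> \sum_j X j w * softmax b mu (X ^~ w) j.
  apply: cvg_sumr => j; apply: cvgM; first exact: cvg_cst.
  rewrite -[X in _ --> X]mulr1; apply: cvgM.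
    by apply: softmax_cvg => i; exact: clip_cvg.
  exact: (cos_clip_cvg (X ^~ w)).
have [_ Ll] := Rintegral_dominated mlhs cl (integrable_cst P (b * p%:R + 1)) lb.
have iA : P.-integrable setT (EFin \o (fun w => \sum_j `|X j w|)).
  by apply: integrable_sum_seq => j; exact: integrable_norm (iX j).
have [_ Lr] := Rintegral_dominated mrhs cr iA rb.
apply: (ler_cvg_to Ll Lr); apply: nearW => n.
have n0 : 0 < n.+1%:R :> R by rewrite ltr0n.
pose f2 (j k : 'I_p) (x : 'I_p -> R) := b * ((k == j)%:R * (softmax b mu (clip n.+1%:R x) j * cos (x j / n.+1%:R) ^+ 2)
        - softmax b mu (clip n.+1%:R x) j * softmax b mu (clip n.+1%:R x) k *
          (cos (x j / n.+1%:R) * cos (x k / n.+1%:R)))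
      - (k == j)%:R * (softmax b mu (clip n.+1%:R x) j * (sin (x j / n.+1%:R) / n.+1%:R)).
have mf2 j k : measurable_fun setT (fun w => f2 j k (X ^~ w)).
  apply: measurable_funB; apply: measurable_funM => //.
    apply: measurable_funB; last first.
      by apply: measurable_funM; apply: measurable_funM => //; exact: measurable_cos_clip.
    apply: measurable_funM => //; apply: measurable_funM => //.
    by apply: measurable_funX; exact: measurable_cos_clip.
  apply: measurable_funM => //; apply: measurable_funM => //.
  have := measurable_sin_affine n.+1%:R^-1 0 (mX j).
  by under eq_fun do rewrite addr0 mulrC.
have F := trig_limit_lse mu b0 n0.
have [M HM] := trig_limit_bounded F.
apply: le_trans (trig_limit_stein gX F _ mf2); last first.
  by move=> j; apply: measurable_funM; [exact: msm|exact: measurable_cos_clip].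
apply: le_Rintegral => //.
- by apply: (@integrable_ub _ _ _ _ _ (b * p%:R + 1)).
- apply: integrable_sum_seq => j; apply: integrable_sum_seq => k.
  apply: integrableZ; apply: (@integrable_ub _ _ _ _ _ M); first exact: mf2.
  by move=> w; have [_ _ h] := HM (X ^~ w); exact: h.
- by move=> w _; exact: lse_hessian_ge.
Qed.

End gaussian_limits.

(** * Anti-concentration and comparison of Gaussian maxima *)

Section vmax_lemmas.
Context {R : realType} {p : nat}.
Hypothesis p0 : (0 < p)%N.
Implicit Types f : 'I_p -> R.

Lemma vmax_leP f t : reflect (forall j, f j <= t) (vmax f <= t).
Proof.
apply: (iffP idP) => [ft j|ft]; first exact: le_trans (vmax_ub f j) ft.
by have [j ->] := vmax_attained f p0.
Qed.

Lemma vmax_gtP f t : reflect (exists j, t < f j) (t < vmax f).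
Proof.
apply: (iffP idP) => [|[j tf]]; last exact: lt_le_trans tf (vmax_ub f j).
by have [j ->] := vmax_attained f p0; exists j.
Qed.

Lemma measurable_vmax d (T : measurableType d) (Z : 'I_p -> T -> R) :
  (forall j, measurable_fun setT (Z j)) ->
  measurable_fun setT (fun w => vmax (Z ^~ w)).
Proof.
move=> mZ; pose j0 := Ordinal p0.
have -> : (fun w => vmax (Z ^~ w)) = (fun w => \big[Num.max/Z j0 w]_(j < p) Z j w).
  apply/funext => w; apply/le_anti/andP; split.
    by have [j ->] := vmax_attained (Z ^~ w) p0; apply: (le_bigmax _ (Z ^~ w)).
  by apply: bigmax_le => [|j _]; exact: (vmax_ub (Z ^~ w)).
elim: (index_enum _) => [|j r IH].
  by under eq_fun do rewrite big_nil; exact: mZ.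
by under eq_fun do rewrite big_cons; exact: measurable_maxr.
Qed.

End vmax_lemmas.

Section anti_concentration.
Context {R : realType} {p : nat}.
Hypothesis p0 : (0 < p)%N.
Context d (T : measurableType d) (P : probability T R).
Implicit Types (X : 'I_p -> T -> R) (S : 'I_p -> 'I_p -> R).

Lemma fine_probability_le (A : set T) (f : T -> R) : measurable A ->
  P.-integrable setT (EFin \o f) -> (forall w, \1_A w <= f w) ->
  fine (P A) <= \int[P]_w f w.
Proof.
move=> mA jf Af.
rewrite -[A in P A]setIT -integral_indic//.
by apply: le_Rintegral => //; exact: integrable_indic.
Qed.

(** A combination of the X j with weights of sum at most 1 lies below any smoothing of (max X)^+.
    The parameter b' is separate from b so that b can grow at fixed b'. *)
Lemma softmax_density_le X S b mu b' : gaussian_cf P X S -> 0 < b -> 0 < b' ->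
  (forall j, S j j = 1) -> (forall j k, `|S j k| <= 1) ->
  \int[P]_w (b * ((1 + expsum b mu (X ^~ w))^-1 * \sum_j softmax b mu (X ^~ w) j)) <=
  b'^-1 * ln (1 + p%:R) + b'.
Proof.
move=> gX b0 b'0 Sjj S1; have [mX iX _] := gX.
apply: le_trans (softmax_stein mu gX b0 Sjj S1) _.
apply: le_trans (lse_max_expectation gX b'0 S1).
have [il _] := lse_clip_cvg (fun=> 0) b'0 mX iX.
apply: le_Rintegral => //.
  apply: integrable_sum_seq => j; apply: (integrable_mul_bounded gX).
    exact: measurable_softmax.
  move=> w; rewrite ger0_norm ?softmax_ge0//.
  apply: le_trans (sum_softmax_le1 b mu (X ^~ w)).
  by rewrite (bigD1 j)//= lerDl sumr_ge0// => i _; exact: softmax_ge0.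
move=> w _.
have l0 := lse_ge0 (fun=> 0) (X ^~ w) b'0.
apply: (@le_trans _ _ ((\sum_j softmax b mu (X ^~ w) j) * lse b' (fun=> 0) (X ^~ w))).
  rewrite mulr_suml; apply: ler_sum => j _; rewrite mulrC ler_wpM2l ?softmax_ge0//.
  by have := lse_ge (fun=> 0) (X ^~ w) j b'0; rewrite addr0.
by rewrite ler_piMl// sum_softmax_le1.
Qed.

Lemma expsum_shift b mu (x : 'I_p -> R) h :
  expsum b (fun j => mu j - h) x = expR (- (b * h)) * expsum b mu x.
Proof.
rewrite mulr_sumr; apply: eq_bigr => j _; rewrite -expRD; congr expR; ring.
Qed.

Lemma inv_expsum1_bounds b mu (x : 'I_p -> R) : 0 <= (1 + expsum b mu x)^-1 <= 1.
Proof.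
rewrite invr_ge0 (ltW (expsum1_gt0 _ _ _))/= invf_le1 ?expsum1_gt0//.
by rewrite lerDl expsum_ge0.
Qed.

Lemma integrable_inv_expsum1 X b mu : (forall j, measurable_fun setT (X j)) ->
  P.-integrable setT (EFin \o (fun w => (1 + expsum b mu (X ^~ w))^-1)).
Proof.
move=> mX; apply: (@integrable_ub _ _ _ _ _ 1); first exact: measurable_inv_expsum1.
by move=> w; have /andP[h0 h1] := inv_expsum1_bounds b mu (X ^~ w); rewrite ger0_norm.
Qed.

(** Here 1 / (1 + E) is a soft indicator of a nonpositive maximum. Lowering all coordinates by h
    divides E by q = exp(b h), and the increment (q - 1) E / ((q + E)(1 + E)) is at most (q - 1) / b
    times the smoothed density, as q >= 1. That factor exceeds h for h > 0, which
    [inv_expsum1_increment] repairs. *)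
Lemma inv_expsum1_step X b mu h B : (forall j, measurable_fun setT (X j)) ->
  0 < b -> 0 <= h ->
  \int[P]_w (b * ((1 + expsum b mu (X ^~ w))^-1 * \sum_j softmax b mu (X ^~ w) j)) <= B ->
  \int[P]_w (1 + expsum b (fun j => mu j - h) (X ^~ w))^-1 -
  \int[P]_w (1 + expsum b mu (X ^~ w))^-1 <= (expR (b * h) - 1) / b * B.
Proof.
move=> mX b0 h0 HB.
have e1 : 1 <= expR (b * h) by rewrite -[leLHS]expR0 ler_expR mulr_ge0// ltW.
have k0 : 0 <= (expR (b * h) - 1) / b by rewrite divr_ge0 ?subr_ge0 ?(ltW b0).
apply: le_trans (ler_wpM2l k0 HB).
have i1 := integrable_inv_expsum1 b mu mX.
have i2 := integrable_inv_expsum1 b (fun j => mu j - h) mX.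
have i3 : P.-integrable setT (EFin \o (fun w =>
    b * ((1 + expsum b mu (X ^~ w))^-1 * \sum_j softmax b mu (X ^~ w) j))).
  apply: integrableZ; apply: (@integrable_ub _ _ _ _ _ 1).
    apply: measurable_funM; first exact: measurable_inv_expsum1.
    by apply: measurable_sum => j; exact: measurable_softmax.
  move=> w; have /andP[h1 h2] := inv_expsum1_bounds b mu (X ^~ w).
  rewrite normrM mulr_ile1// ger0_norm ?sum_softmax_le1//.
  by apply: sumr_ge0 => j _; exact: softmax_ge0.
rewrite -RintegralB// -RintegralZl//; apply: le_Rintegral => //.
- by have := integrableB measurableT i2 i1; apply: eq_integrable.
- exact: integrableZ.
move=> w _; rewrite expsum_shift sum_softmax expRN.
set s := expsum b mu _; set q := expR (b * h).
have s0 : 0 <= s by exact: expsum_ge0.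
have q0 : 0 < q by exact: expR_gt0.
have s1 : 0 < 1 + s by rewrite ltr_pwDl.
have sq : 0 < q + s by rewrite ltr_wpDr.
have -> : (1 + q^-1 * s)^-1 - (1 + s)^-1 = (q - 1) * s / ((q + s) * (1 + s)).
  by field; rewrite !gt_eqF.
have -> : (q - 1) / b * (b * ((1 + s)^-1 * (1 - (1 + s)^-1))) =
   (q - 1) * s / ((1 + s) * (1 + s)) by field; rewrite !gt_eqF.
rewrite ler_wpM2l ?mulr_ge0 ?subr_ge0//.
rewrite lef_pV2 ?posrE ?mulr_gt0//.
by rewrite ler_pM2r// lerD2r.
Qed.

(** Cutting h into N steps replaces exp(b h) - 1 by N (exp u - 1) with u = b h / N, and (exp u -
    1)(1 - u) <= u. The increment is at most 1, so the factor 1 - u costs at most u. *)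
Lemma inv_expsum1_increment X b B mu h : (forall j, measurable_fun setT (X j)) ->
  0 < b -> 0 <= h ->
  (forall mu, \int[P]_w (b * ((1 + expsum b mu (X ^~ w))^-1 *
     \sum_j softmax b mu (X ^~ w) j)) <= B) ->
  \int[P]_w (1 + expsum b (fun j => mu j - h) (X ^~ w))^-1 -
  \int[P]_w (1 + expsum b mu (X ^~ w))^-1 <= h * B.
Proof.
move=> mX b0 h0 HB.
pose phi s := \int[P]_w (1 + expsum b (fun j => mu j - s) (X ^~ w))^-1.
have B0 : 0 <= B.
  apply: le_trans (HB mu); apply: Rintegral_ge0 => w _.
  rewrite mulr_ge0 ?(ltW b0)// mulr_ge0//; first by have /andP[] := inv_expsum1_bounds b mu (X ^~ w).
  by apply: sumr_ge0 => j _; exact: softmax_ge0.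
have phi01 s : 0 <= phi s <= 1.
  apply/andP; split.
    by apply: Rintegral_ge0 => w _; have /andP[] := inv_expsum1_bounds b (fun j => mu j - s) (X ^~ w).
  apply: Rintegral_le_cst; first exact: integrable_inv_expsum1.
  by move=> w; have /andP[] := inv_expsum1_bounds b (fun j => mu j - s) (X ^~ w).
have step s v : 0 <= v -> phi (s + v) - phi s <= (expR (b * v) - 1) / b * B.
  move=> v0; rewrite /phi.
  have -> : (fun j => mu j - (s + v)) = (fun j => mu j - s - v).
    by apply/funext => j; ring.
  exact: inv_expsum1_step mX b0 v0 (HB (fun j => mu j - s)).
suff main : phi h - phi 0 <= h * B.
  by move: main; rewrite /phi; under [fun j => mu j - 0]eq_fun do rewrite subr0.
apply/ler_addgt0Pr => e e0.
(* This size of N ensures both u <= 1 and u <= e. *)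
have [N [N0 NE]] : exists N, 0 < N%:R :> R /\ b * h * (1 + e^-1) <= N%:R.
  exists (Num.truncn (b * h * (1 + e^-1))).+1; split; first by rewrite ltr0n.
  by rewrite ltW// truncnS_gt.
have bh0 : 0 <= b * h by rewrite mulr_ge0// ltW.
have ei0 : 0 < e^-1 by rewrite invr_gt0.
pose u := b * h / N%:R.
have u0 : 0 <= u by rewrite divr_ge0// ltW.
have u1 : u <= 1.
  rewrite ler_pdivrMr// mul1r (le_trans _ NE)// ler_peMr// lerDl ltW//.
have ue : u <= e.
  rewrite ler_pdivrMr// -ler_pdivrMl// (le_trans _ NE)// mulrC ler_wpM2l//.
  by rewrite lerDr.
have tel : phi h - phi 0 <= N%:R * ((expR u - 1) / b * B).
  pose f i := phi (i%:R * (h / N%:R)).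
  have fN : f N = phi h by rewrite /f; congr phi; field; rewrite gt_eqF.
  have f0 : f 0%N = phi 0 by rewrite /f mul0r.
  rewrite -fN -f0 -(telescope_sumr f (leq0n N)) mulr_natl -[X in _ *+ X]subn0.
  rewrite -sumr_const_nat; apply: ler_sum => i _.
  have hN : 0 <= h / N%:R by rewrite divr_ge0// ltW.
  have := step (i%:R * (h / N%:R)) _ hN.
  have -> : i%:R * (h / N%:R) + h / N%:R = i.+1%:R * (h / N%:R).
    by rewrite -natr1 mulrDl mul1r.
  by rewrite (mulrA b) -/u.
have eu : (expR u - 1) * (1 - u) <= u.
  have : expR (- u) >= 1 - u by rewrite -[X in 1 + X]/(- u) expR_ge1Dx.
  rewrite expRN -(ler_pM2l (expR_gt0 u)) divff ?gt_eqF ?expR_gt0//; lra.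
have diff1 : phi h - phi 0 <= 1.
  by have /andP[? ?] := phi01 h; have /andP[? ?] := phi01 0; lra.
have key : (phi h - phi 0) * (1 - u) <= h * B.
  apply: (@le_trans _ _ (N%:R * ((expR u - 1) / b * B) * (1 - u))).
    by rewrite ler_wpM2r// subr_ge0.
  have -> : N%:R * ((expR u - 1) / b * B) * (1 - u) =
    N%:R * B / b * ((expR u - 1) * (1 - u)) by field; rewrite gt_eqF.
  have -> : h * B = N%:R * B / b * u by rewrite /u; field; rewrite !gt_eqF.
  by rewrite ler_wpM2l// divr_ge0 ?mulr_ge0 ?(ltW N0) ?(ltW b0).
have : (phi h - phi 0) * u <= u by rewrite ler_piMl.
lra.
Qed.

(** The indicator of 0 < max <= h is at most g plus the difference of two soft indicators, at shifts
    [m1] (lower by h + g) and [m2] (higher by g). On the event the first sum of exponentials is at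
    most p exp(- b g) and the second at least exp(b g). *)
Lemma standard_anti_concentration X S b' mu h : gaussian_cf P X S ->
  (forall j, S j j = 1) -> (forall j k, `|S j k| <= 1) -> 0 < b' -> 0 <= h ->
  fine (P [set w | 0 < vmax (fun j => X j w + mu j) <= h]) <=
  h * (b'^-1 * ln (1 + p%:R) + b').
Proof.
move=> gX Sjj S1 b'0 h0; have [mX _ _] := gX.
set B := b'^-1 * _ + b'.
have B0 : 0 < B.
  rewrite ltr_wpDl// mulr_ge0 ?invr_ge0 ?(ltW b'0)// ln_ge0//.
  by rewrite lerDl.
apply/ler_addgt0Pr => e e0; pose g := e / (2 * B + 1).
have B1 : 0 < 2 * B + 1 by rewrite addr_gt0// mulr_gt0.
have g0 : 0 < g by rewrite divr_gt0.
have gE : 2 * g * B + g = e.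
  rewrite (_ : 2 * g * B + g = g * (2 * B + 1)); last by ring.
  by rewrite /g divfK ?gt_eqF.
(* Chosen so that p + 1 = g (b g) <= g exp(b g), which bounds the total sandwich error (p + 1) exp(-
   b g) by g. *)
pose b := (p%:R + 1) / g ^+ 2.
have p1 : 0 < p%:R + 1 :> R by rewrite ltr_wpDl.
have b0 : 0 < b by rewrite divr_gt0// exprn_gt0.
have bg : (p%:R + 1) * expR (- (b * g)) <= g.
  rewrite expRN ler_pdivrMr ?expR_gt0//.
  have -> : p%:R + 1 = g * (b * g) by rewrite /b; field; rewrite gt_eqF.
  by rewrite ler_pM2l// (le_trans _ (expR_ge1Dx _))// lerDr.
have HB m := softmax_density_le m gX b0 b'0 Sjj S1.
pose m1 j := (mu j + g) - (h + 2 * g); pose m2 j := mu j + g.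
have i1 := integrable_inv_expsum1 b m1 mX.
have i2 := integrable_inv_expsum1 b m2 mX.
have inc : \int[P]_w (1 + expsum b m1 (X ^~ w))^-1 -
   \int[P]_w (1 + expsum b m2 (X ^~ w))^-1 <= (h + 2 * g) * B.
  by apply: inv_expsum1_increment => //; rewrite addr_ge0// mulr_ge0// ltW.
have mM : measurable_fun setT (fun w => vmax (fun j => X j w + mu j)).
  apply: (@measurable_vmax _ _ p0 _ _ (fun j w => X j w + mu j)) => j.
  exact: measurable_funD.
have mA : measurable [set w | 0 < vmax (fun j => X j w + mu j) <= h].
  rewrite (_ : [set w | _] = (fun w => vmax (fun j => X j w + mu j)) @^-1` `]0, h]); last first.
    by apply/seteqP; split => w /=; rewrite in_itv.
  by rewrite -[X in measurable X]setTI; exact: mM.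
have i3 : P.-integrable setT (EFin \o (fun w =>
    (1 + expsum b m1 (X ^~ w))^-1 - (1 + expsum b m2 (X ^~ w))^-1)).
  by have := integrableB measurableT i1 i2; apply: eq_integrable.
apply: le_trans (fine_probability_le mA (integrableDR i3 (integrable_cst P g)) _) _; last first.
  rewrite RintegralD//; last exact: integrable_cst.
  rewrite RintegralB// Rintegral_prob_cst; lra.
move=> w; apply: (@le_trans _ _ (\1_[set w | 0 < vmax (fun j => X j w + mu j) <= h] w)) => //.
set s1 := expsum b m1 _; set s2 := expsum b m2 _.
have s10 : 0 <= s1 by exact: expsum_ge0.
have s20 : 0 <= s2 by exact: expsum_ge0.
rewrite indicE; have [|_] := boolP (w \in _); last first.
  rewrite addr_ge0 ?(ltW g0)// subr_ge0 lef_pV2 ?posrE ?ltr_pwDl// lerD2l.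
  rewrite /s1 /m1 expsum_shift ler_piMl// -[leRHS]expR0 ler_expR oppr_le0.
  by rewrite mulr_ge0 ?(ltW b0)// addr_ge0// mulr_ge0// ltW.
rewrite inE /= => /andP[/(vmax_gtP p0)[j Xj] /(vmax_leP p0) Xh].
have l1 : s1 <= p%:R * expR (- (b * g)).
  apply: (@le_trans _ _ (\sum_(j < p) expR (- (b * g)))).
    apply: ler_sum => k _; rewrite ler_expR -mulrN ler_pM2l// /m1.
    by have := Xh k; lra.
  by rewrite sumr_const card_ord mulr_natl.
have l2 : expR (b * g) <= s2.
  rewrite /s2 /expsum (bigD1 j)//= ler_wpDr//.
    by apply: sumr_ge0 => k _; exact: expR_ge0.
  by rewrite ler_expR ler_pM2l// /m2 addrA lerDr ltW.
have a1 : 1 - s1 <= (1 + s1)^-1.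
  rewrite -[leRHS]mul1r ler_pdivlMr ?ltr_pwDl//.
  have : 0 <= s1 * s1 by rewrite mulr_ge0.
  lra.
have a2 : (1 + s2)^-1 <= expR (- (b * g)).
  rewrite expRN lef_pV2 ?posrE ?expR_gt0 ?ltr_pwDl//.
  by rewrite (le_trans l2)// lerDr.
rewrite /= ; lra.
Qed.

Lemma gaussian_cf_qf_ge0 X S a : gaussian_cf P X S -> 0 <= qf S a.
Proof.
move=> gX; have [mX _ cf] := gX.
have H : expR (- (qf S a / 2)) <= 1.
  have := cf a 0; rewrite cos0 mul1r => <-; apply: Rintegral_le_cst.
    apply: (@integrable_ub _ _ _ _ _ 1); last by move=> w; exact: cos_max.
    exact: (measurable_cos_dotv gX).
  by move=> w; rewrite (le_trans (ler_norm _))// cos_max.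
move: H; rewrite -[leRHS]expR0 ler_expR oppr_le0 pmulr_lge0//.
Qed.

(** Scaling (X j - t) by its own standard deviation keeps its sign and sends the upper bound h to h
    / sigma_j <= h / sqrt(c), so the event falls into the unit-variance event with level 0. *)
Lemma gaussian_anti_concentration X S b' c t h : gaussian_cf P X S ->
  (forall j k, S j k = S k j) -> 0 < c -> (forall j, c <= S j j) ->
  0 < b' -> 0 <= h ->
  fine (P [set w | t < vmax (fun j => X j w) <= t + h]) <=
  h / Num.sqrt c * (b'^-1 * ln (1 + p%:R) + b').
Proof.
move=> gX Ssym c0 cS b'0 h0; have [mX _ _] := gX.
pose sg j := Num.sqrt (S j j).
have S0 j : 0 < S j j by apply: lt_le_trans (cS j).
have sg0 j : 0 < sg j by rewrite sqrtr_gt0.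
have sgE j : sg j ^+ 2 = S j j by rewrite sqr_sqrtr// ltW.
have sc0 : 0 < Num.sqrt c by rewrite sqrtr_gt0.
pose S' j k := (sg j)^-1 * (sg k)^-1 * S j k.
have gU : gaussian_cf P (fun j w => (sg j)^-1 * X j w) S'.
  exact: (gaussian_cf_scale (fun j => (sg j)^-1) gX).
have Sjj j : S' j j = 1 by rewrite /S' -sgE; field; rewrite gt_eqF.
have S'sym j k : S' j k = S' k j by rewrite /S' Ssym; ring.
have S1 j k : `|S' j k| <= 1.
  have [->|jk] := eqVneq j k; first by rewrite Sjj normr1.
  (* Nonnegativity of the quadratic form at e_j + e_k and e_j - e_k gives |S' j k| <= 1. *)
  have q2 (v : R) : qf S' (fun i => (i == j)%:R + (i == k)%:R * v) =
      1 + 2 * v * S' j k + v ^+ 2.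
    have sumd (F : 'I_p -> R) : \sum_i ((i == j)%:R + (i == k)%:R * v) * F i = F j + v * F k.
      under eq_bigr do rewrite mulrDl -mulrA.
      by rewrite big_split /= !sum_delta.
    rewrite /qf; under eq_bigr do under eq_bigr do rewrite -mulrA.
    under eq_bigr do rewrite -mulr_sumr sumd.
    by rewrite sumd !Sjj (S'sym k j); ring.
  have := gaussian_cf_qf_ge0 (fun i => (i == j)%:R + (i == k)%:R * 1) gU.
  have := gaussian_cf_qf_ge0 (fun i => (i == j)%:R + (i == k)%:R * -1) gU.
  by rewrite !q2 ler_norml => h1 h2; apply/andP; split; lra.
pose mu j := - t / sg j.
have hc0 : 0 <= h / Num.sqrt c by rewrite divr_ge0// ltW.
apply: le_trans (standard_anti_concentration mu gU Sjj S1 b'0 hc0).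
have mset (Z : 'I_p -> T -> R) u v : (forall j, measurable_fun setT (Z j)) ->
    measurable [set w | u < vmax (fun j => Z j w) <= v].
  move=> mZ; rewrite (_ : [set w | _] = (fun w => vmax (Z ^~ w)) @^-1` `]u, v]); last first.
    by apply/seteqP; split => w /=; rewrite in_itv.
  by rewrite -[X in measurable X]setTI; apply: (measurable_vmax p0 mZ).
have m1 := mset X t (t + h) mX.
have m2 : measurable [set w | 0 < vmax (fun j => (sg j)^-1 * X j w + mu j) <= h / Num.sqrt c].
  apply: (mset (fun j w => (sg j)^-1 * X j w + mu j)) => j.
  by apply: measurable_funD => //; exact: measurable_funM.
rewrite fine_le ?fin_num_measure// le_measure ?inE//.
have ZE j w : (sg j)^-1 * X j w + mu j = (X j w - t) / sg j by rewrite /mu; ring.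
move=> w /= /andP[/(vmax_gtP p0)[j tX] /(vmax_leP p0) Xh].
apply/andP; split.
  by apply/(vmax_gtP p0); exists j; rewrite ZE divr_gt0// subr_gt0.
apply/(vmax_leP p0) => k; rewrite ZE.
have csg : Num.sqrt c <= sg k by rewrite ler_sqrt// ltW.
apply: (@le_trans _ _ (h / sg k)).
  by rewrite ler_pM2r ?invr_gt0// lerBlDl.
by rewrite ler_wpM2l// lef_pV2 ?posrE.
Qed.

End anti_concentration.

(** * Comparison of the distributions of two Gaussian maxima *)

Section gaussian_comparison.
Context {R : realType} {p : nat}.
Hypothesis p0 : (0 < p)%N.
Implicit Types (x : 'I_p -> R) (S : 'I_p -> 'I_p -> R).

(* [ramp b dl s] is the average over s' in [s, s + dl] of the smoothed
   indicator x |-> sum_j softmax_j of {max x > s'}. *)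
Definition ramp (b dl s : R) x : R :=
  (lse b (fun=> - s) x - lse b (fun=> - (s + dl)) x) / dl.

Lemma rampE b dl s x : 0 < b -> 0 < dl ->
  b * dl * ramp b dl s x =
  ln (1 + expsum b (fun=> - s) x) - ln (1 + expR (- (b * dl)) * expsum b (fun=> - s) x).
Proof.
move=> b0 dl0; rewrite /ramp /lse -expsum_shift.
have -> : (fun=> - (s + dl)) = (fun j : 'I_p => - s - dl) by apply/funext => j; ring.
by field; rewrite !gt_eqF.
Qed.

Lemma ramp_bounds b dl s x : 0 < b -> 0 < dl -> 0 <= ramp b dl s x <= 1.
Proof.
move=> b0 dl0; have bdl : 0 < b * dl by rewrite mulr_gt0.
set S := expsum b (fun=> - s) x.
have S0 : 0 <= S by exact: expsum_ge0.
have q0 : 0 < expR (- (b * dl)) by exact: expR_gt0.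
have q1 : expR (- (b * dl)) <= 1 by rewrite -[leRHS]expR0 ler_expR oppr_le0 ltW.
have s1 : 0 < 1 + S by rewrite ltr_pwDl.
have s2 : 0 < 1 + expR (- (b * dl)) * S by rewrite ltr_pwDl// mulr_ge0// ltW.
apply/andP; split.
  rewrite -(pmulr_rge0 _ bdl) rampE//.
  by rewrite subr_ge0 ler_ln ?posrE// lerD2l ler_piMl.
rewrite -(ler_pM2l bdl) mulr1 rampE//.
rewrite lerBlDr -[X in _ <= X + _](expRK (b * dl)) -lnM ?posrE ?expR_gt0// ler_ln ?posrE ?mulr_gt0 ?expR_gt0//.
rewrite mulrDr mulr1 mulrA -expRD subrr expR0 mul1r lerD2r.
by rewrite -[leLHS]expR0 ler_expR ltW.
Qed.

(** With q = exp(- b dl), e = exp(- b g) and S the sum of exponentials, the claim becomes 1 + q S <=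
    (1 + S) q exp(e). Since q S e >= 1, it holds even with 1 + e in place of exp(e). *)
Lemma ramp_gt b dl s g x : 0 < b -> 0 < dl -> s + dl + g < vmax x ->
  1 - expR (- (b * g)) / (b * dl) <= ramp b dl s x.
Proof.
move=> b0 dl0 /(vmax_gtP p0)[j xj].
have bdl : 0 < b * dl by rewrite mulr_gt0.
rewrite -(ler_pM2l bdl) rampE// mulrBr mulr1 mulrCA divff ?gt_eqF// mulr1.
set S := expsum b (fun=> - s) x; set q := expR (- (b * dl)).
have q0 : 0 < q by exact: expR_gt0.
have S0 : 0 <= S by exact: expsum_ge0.
have SG : expR (b * (dl + g)) <= S.
  rewrite /S /expsum (bigD1 j)//= ler_wpDr//.
    by apply: sumr_ge0 => k _; exact: expR_ge0.
  by rewrite ler_expR ler_pM2l//; lra.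
have s1 : 0 < 1 + S by rewrite ltr_pwDl.
have s2 : 0 < 1 + q * S by rewrite ltr_pwDl// mulr_ge0// ltW.
set e := expR (- (b * g)).
rewrite lerBrDr -lerBrDl opprB addrA -[X in ln _ + X]expRK -[X in _ - X]expRK.
rewrite -lnM ?posrE ?expR_gt0// -ln_div ?posrE ?mulr_gt0 ?expR_gt0//.
rewrite ler_ln ?posrE ?divr_gt0 ?mulr_gt0 ?expR_gt0// -expRN -/q.
have e0 : 0 < e by exact: expR_gt0.
have qSe : 1 <= q * S * e.
  have -> : 1 = q * expR (b * (dl + g)) * e :> R.
    by rewrite /q /e -!expRD -[LHS]expR0; congr expR; ring.
  by rewrite ler_pM2r// ler_pM2l.
apply: (@le_trans _ _ ((1 + S) * (1 + e) * q)); last first.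
  by rewrite ler_pM2r// ler_pM2l// expR_ge1Dx.
have : 0 <= q * e by rewrite mulr_ge0// ltW.
lra.
Qed.

Lemma ramp_le b dl s g x : 0 < b -> 0 < dl -> vmax x <= s - g ->
  ramp b dl s x <= p%:R * expR (- (b * g)) / (b * dl).
Proof.
move=> b0 dl0 /(vmax_leP p0) xs.
have bdl : 0 < b * dl by rewrite mulr_gt0.
rewrite -(ler_pM2l bdl) rampE// mulrCA divff ?gt_eqF// mulr1.
set S := expsum b (fun=> - s) x.
have S0 : 0 <= S by exact: expsum_ge0.
have Sp : S <= p%:R * expR (- (b * g)).
  apply: (@le_trans _ _ (\sum_(j < p) expR (- (b * g)))).
    by apply: ler_sum => k _; rewrite ler_expR -mulrN ler_pM2l//; have := xs k; lra.
  by rewrite sumr_const card_ord mulr_natl.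
apply: le_trans Sp; rewrite lerBlDr.
have l0 : 0 <= ln (1 + expR (- (b * dl)) * S).
  by rewrite ln_ge0// lerDl mulr_ge0// ltW// expR_gt0.
apply: (@le_trans _ _ S); last by rewrite lerDl.
rewrite -ler_expR lnK ?posrE ?ltr_pwDl//; exact: expR_ge1Dx.
Qed.

Lemma measurable_vmax_gt d (T : measurableType d) (Z : 'I_p -> T -> R) t :
  (forall j, measurable_fun setT (Z j)) ->
  measurable [set w | t < vmax (fun j => Z j w)].
Proof.
move=> mZ; rewrite (_ : [set w | _] = (fun w => vmax (Z ^~ w)) @^-1` `]t, +oo[); last first.
  by apply/seteqP; split => w /=; rewrite in_itv/= andbT.
by rewrite -[X in measurable X]setTI; apply: (measurable_vmax p0 mZ).
Qed.

Lemma measurable_vmax_le d (T : measurableType d) (Z : 'I_p -> T -> R) t :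
  (forall j, measurable_fun setT (Z j)) ->
  measurable [set w | vmax (fun j => Z j w) <= t].
Proof.
move=> mZ; rewrite (_ : [set w | _] = (fun w => vmax (Z ^~ w)) @^-1` `]-oo, t]); last first.
  by apply/seteqP; split => w /=; rewrite in_itv.
by rewrite -[X in measurable X]setTI; apply: (measurable_vmax p0 mZ).
Qed.

Lemma gaussian_max_gt_le d1 (T1 : measurableType d1) (P1 : probability T1 R)
    d2 (T2 : measurableType d2) (P2 : probability T2 R)
    (X : 'I_p -> T1 -> R) (Y : 'I_p -> T2 -> R) S1 S2 th b dl g t :
  gaussian_cf P1 X S1 -> gaussian_cf P2 Y S2 -> 0 <= th ->
  (forall j k, `|S1 j k - S2 j k| <= th) -> 0 < b -> 0 < dl ->
  fine (P1 [set w | t < vmax (fun j => X j w)]) <=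
  fine (P2 [set w | t - dl - 2 * g < vmax (fun j => Y j w)]) +
  (2 * th * b / dl + (p%:R + 1) * expR (- (b * g)) / (b * dl)).
Proof.
move=> gX gY th0 Sth b0 dl0.
have [mX iX _] := gX; have [mY iY _] := gY.
(* The ramp is near 1 above s + dl + g = t and near 0 below s - g = t - dl - 2 g. *)
pose s := t - dl - g; pose e1 := expR (- (b * g)) / (b * dl).
have e10 : 0 <= e1 by rewrite divr_ge0 ?expR_ge0// mulr_ge0// ltW.
have iR d (T : measurableType d) (P : probability T R) (Z : 'I_p -> T -> R) :
    (forall j, measurable_fun setT (Z j)) ->
    P.-integrable setT (EFin \o (fun w => ramp b dl s (Z ^~ w))).
  move=> mZ; apply: (@integrable_ub _ _ _ _ _ 1).
    by apply: measurable_funM => //; apply: measurable_funB; exact: measurable_lse.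
  by move=> w; have /andP[h0 h1] := ramp_bounds s (Z ^~ w) b0 dl0; rewrite ger0_norm.
have RE d (T : measurableType d) (P : probability T R) (Z : 'I_p -> T -> R) :
    (forall j, measurable_fun setT (Z j)) -> (forall j, P.-integrable setT (EFin \o Z j)) ->
    \int[P]_w ramp b dl s (Z ^~ w) = (\int[P]_w lse b (fun=> - s) (Z ^~ w) -
      \int[P]_w lse b (fun=> - (s + dl)) (Z ^~ w)) / dl.
  move=> mZ iZ.
  have [i1 _] := lse_clip_cvg (fun=> - s) b0 mZ iZ.
  have [i2 _] := lse_clip_cvg (fun=> - (s + dl)) b0 mZ iZ.
  have i12 : P.-integrable setT (EFin \o (fun w =>
      lse b (fun=> - s) (Z ^~ w) - lse b (fun=> - (s + dl)) (Z ^~ w))).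
    by have := integrableB measurableT i1 i2; apply: eq_integrable.
  by rewrite -RintegralB// -RintegralZr.
have step1 : fine (P1 [set w | t < vmax (fun j => X j w)]) <=
    \int[P1]_w ramp b dl s (X ^~ w) + e1.
  apply: le_trans (fine_probability_le (measurable_vmax_gt t mX)
     (integrableDR (iR _ _ P1 X mX) (integrable_cst P1 e1)) _) _; last first.
    by rewrite RintegralD ?Rintegral_prob_cst//; [exact: iR|exact: integrable_cst].
  move=> w; have /andP[h0 h1] := ramp_bounds s (X ^~ w) b0 dl0.
  rewrite indicE; have [|_] := boolP (w \in _); last by rewrite addr_ge0.
  rewrite inE /= => tw; rewrite -lerBlDr; apply: ramp_gt => //.
  by rewrite (_ : s + dl + g = t)// /s; ring.
have step2 : \int[P2]_w ramp b dl s (Y ^~ w) <=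
    fine (P2 [set w | t - dl - 2 * g < vmax (fun j => Y j w)]) + p%:R * e1.
  have mA := measurable_vmax_gt (t - dl - 2 * g) mY.
  set A := [set w | _] in mA *.
  have iA : P2.-integrable setT (EFin \o (\1_A : T2 -> R)) by exact: integrable_indic.
  have -> : fine (P2 A) = \int[P2]_w \1_A w by rewrite /Rintegral integral_indic// setIT.
  rewrite -[X in _ + X](Rintegral_prob_cst P2) -RintegralD//; last exact: integrable_cst.
  apply: le_Rintegral => //; first exact: iR.
    exact: integrableDR iA (integrable_cst _ _).
  move=> w _; have /andP[h0 h1] := ramp_bounds s (Y ^~ w) b0 dl0.
  rewrite indicE; have [_|] := boolP (w \in _).
    by rewrite (le_trans h1)// lerDl mulr_ge0.
  rewrite notin_setE /A /= => /negP; rewrite -leNgt => Yw.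
  rewrite add0r mulrA; apply: ramp_le => //.
  by rewrite (_ : s - g = t - dl - 2 * g)// /s; ring.
(* The ramp is a difference of two [lse], so the comparison is used once in each direction, each
   time at cost th b / dl. *)
have step3 : \int[P1]_w ramp b dl s (X ^~ w) <=
    \int[P2]_w ramp b dl s (Y ^~ w) + 2 * th * b / dl.
  rewrite !RE// -mulrDl ler_pM2r ?invr_gt0//.
  have h1 := lse_comparison (fun=> - s) gX gY b0 th0 Sth.
  have Sth' j k : `|S2 j k - S1 j k| <= th by rewrite distrC.
  have h2 := lse_comparison (fun=> - (s + dl)) gY gX b0 th0 Sth'.
  move: h1 h2; do 4 move: (Rintegral _ _ _) => ?.
  by move=> h1 h2; clear -h1 h2; lra.
rewrite (_ : (p%:R + 1) * expR (- (b * g)) / (b * dl) = p%:R * e1 + e1); last first.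
  by rewrite /e1; ring.
apply: le_trans step1 _.
rewrite addrA [leRHS]addrA lerD2r addrAC.
by apply: le_trans step3 _; rewrite lerD2r.
Qed.

Lemma fine_vmax_le d (T : measurableType d) (P : probability T R)
    (Z : 'I_p -> T -> R) t : (forall j, measurable_fun setT (Z j)) ->
  fine (P [set w | vmax (fun j => Z j w) <= t]) =
  1 - fine (P [set w | t < vmax (fun j => Z j w)]).
Proof.
move=> mZ; have mA := measurable_vmax_gt t mZ.
have -> : [set w | vmax (fun j => Z j w) <= t] = ~` [set w | t < vmax (fun j => Z j w)].
  by apply/seteqP; split => w /=; rewrite leNgt => /negP.
by rewrite probability_setC// fineB ?fin_num_measure.
Qed.

Lemma fine_vmax_le_diff d (T : measurableType d) (P : probability T R)
    (Z : 'I_p -> T -> R) t h : (forall j, measurable_fun setT (Z j)) -> 0 <= h ->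
  fine (P [set w | vmax (fun j => Z j w) <= t + h]) =
  fine (P [set w | vmax (fun j => Z j w) <= t]) +
  fine (P [set w | t < vmax (fun j => Z j w) <= t + h]).
Proof.
move=> mZ h0.
have m1 := measurable_vmax_le t mZ.
have m2 : measurable [set w | t < vmax (fun j => Z j w) <= t + h].
  rewrite (_ : [set w | _] = [set w | t < vmax (fun j => Z j w)] `&`
     [set w | vmax (fun j => Z j w) <= t + h]); last first.
    by apply/seteqP; split => w /= => [/andP[]|[-> ->]].
  by apply: measurableI; [exact: measurable_vmax_gt|exact: measurable_vmax_le].
rewrite -fineD ?fin_num_measure// -measureU//; last first.
  apply/seteqP; split => w //= [wt /andP[tw _]]; move: wt; by rewrite leNgt tw.
congr (fine (P _)); apply/seteqP; split => w /=.
  by move=> wh; have [|tw] := leP (vmax (fun j => Z j w)) t; [left|right; rewrite wh].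
by move=> [wt|/andP[]//]; rewrite (le_trans wt)// lerDl.
Qed.

(** With g = dl the threshold moves by 3 dl, and in both directions this move is charged to Y. Hence
    X may have a degenerate covariance, as the bootstrap vector does. *)
Lemma gaussian_max_comparison d1 (T1 : measurableType d1) (P1 : probability T1 R)
    d2 (T2 : measurableType d2) (P2 : probability T2 R)
    (X : 'I_p -> T1 -> R) (Y : 'I_p -> T2 -> R) S1 S2 th b dl K t :
  gaussian_cf P1 X S1 -> gaussian_cf P2 Y S2 -> 0 <= th ->
  (forall j k, `|S1 j k - S2 j k| <= th) -> 0 < b -> 0 < dl ->
  (forall t h, 0 <= h -> fine (P2 [set w | t < vmax (fun j => Y j w) <= t + h]) <= h * K) ->
  `|fine (P1 [set w | vmax (fun j => X j w) <= t]) -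
    fine (P2 [set w | vmax (fun j => Y j w) <= t])| <=
  3 * dl * K + (2 * th * b / dl + (p%:R + 1) * expR (- (b * dl)) / (b * dl)).
Proof.
move=> gX gY th0 Sth b0 dl0 HK.
have [mX _ _] := gX; have [mY _ _] := gY.
have Sth' j k : `|S2 j k - S1 j k| <= th by rewrite distrC.
have dl3 : 0 <= 3 * dl by rewrite mulr_ge0// ltW.
rewrite ler_norml; apply/andP; split.
- have := gaussian_max_gt_le dl t gX gY th0 Sth b0 dl0.
  have := fine_vmax_le_diff P2 (t - 3 * dl) mY dl3.
  have := HK (t - 3 * dl) _ dl3.
  rewrite subrK (_ : t - dl - 2 * dl = t - 3 * dl); last by ring.
  rewrite !fine_vmax_le//; lra.
- have := gaussian_max_gt_le dl (t + 3 * dl) gY gX th0 Sth' b0 dl0.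
  have := fine_vmax_le_diff P2 t mY dl3.
  have := HK t _ dl3.
  rewrite (_ : t + 3 * dl - dl - 2 * dl = t); last by ring.
  rewrite !fine_vmax_le//; lra.
Qed.

End gaussian_comparison.

Section gaussian_pi_bound.
Context {R : realType} {p : nat}.
Hypothesis p1 : (1 < p)%N.

Lemma gaussian_max_pi_bound d1 (T1 : measurableType d1) (P1 : probability T1 R)
    d2 (T2 : measurableType d2) (P2 : probability T2 R)
    (X : 'I_p -> T1 -> R) (Y : 'I_p -> T2 -> R) S1 S2 th c t :
  gaussian_cf P1 X S1 -> gaussian_cf P2 Y S2 -> 0 < th ->
  (forall j k, `|S1 j k - S2 j k| <= th) ->
  (forall j k, S2 j k = S2 k j) -> 0 < c -> (forall j, c <= S2 j j) ->
  `|fine (P1 [set w | vmax (fun j => X j w) <= t]) -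
    fine (P2 [set w | vmax (fun j => Y j w) <= t])| <=
  pi_bound (4 + 9 / Num.sqrt c) p th.
Proof.
move=> gX gY th0 Sth Ssym c0 cS.
have p0 : (0 < p)%N by exact: ltnW.
have pR : 0 < p%:R :> R by rewrite ltr0n.
have [mX _ _] := gX; have [mY _ _] := gY.
have sc0 : 0 < Num.sqrt c by rewrite sqrtr_gt0.
pose l := Num.max 1 (ln (p%:R / th)).
have l1 : 1 <= l by rewrite le_max lexx.
have l0 : 0 < l by apply: lt_le_trans l1.
(* All quantities are monomials in these two roots (A^3 = th, B^6 = l), and the target is a multiple
   of A B^4. *)
pose A := th `^ (1 / 3); pose B := l `^ (1 / 6).
have A0 : 0 < A by rewrite powR_gt0.
have B1 : 1 <= B.
  apply: (@le_trans _ _ (1 `^ (1 / 6))); first by rewrite powR1.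
    by rewrite ge0_ler_powR// ?nnegrE ?ler01 ?(ltW l0)// divr_ge0.
have B0 : 0 < B by apply: lt_le_trans B1.
have AE : A ^+ 3 = th.
  by rewrite -powR_mulrn ?(ltW A0)// -powRrM (_ : 1 / 3 * 3%:R = 1) ?powRr1 ?(ltW th0)//; field.
have BE : B ^+ 6 = l.
  by rewrite -powR_mulrn ?(ltW B0)// -powRrM (_ : 1 / 6 * 6%:R = 1) ?powRr1 ?(ltW l0)//; field.
have B4E : l `^ (2 / 3) = B ^+ 4.
  by rewrite -powR_mulrn ?(ltW B0)// -powRrM (_ : 1 / 6 * 4%:R = 2 / 3)//; field.
rewrite /pi_bound -/l -/A B4E.
set C := 4 + _.
have C4 : 4 <= C by rewrite lerDl divr_ge0// ltW.
have B41 : 1 <= B ^+ 4 by rewrite exprn_ege1.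
(* For th >= 1 the bound is at least 4, beyond any difference of probabilities. For th < 1 one has
   log p <= l and th <= A. *)
have [th1|th1] := leP 1 th.
  have A1 : 1 <= A.
    apply: (@le_trans _ _ (1 `^ (1 / 3))); first by rewrite powR1.
    by rewrite ge0_ler_powR// ?nnegrE ?ler01 ?(ltW th0)// divr_ge0.
  apply: (@le_trans _ _ 1); last first.
    by rewrite mulr_ege1// mulr_ege1// (le_trans _ C4)// ler1n.
  have pr01 d (T : measurableType d) (P : probability T R) (E : set T) :
      measurable E -> 0 <= fine (P E) <= 1.
    move=> mE; rewrite fine_ge0//= -lee_fin fineK ?fin_num_measure//.
    exact: probability_le1.
  have /andP[a1 a2] := pr01 _ _ P1 _ (measurable_vmax_le p0 t mX).
  have /andP[a3 a4] := pr01 _ _ P2 _ (measurable_vmax_le p0 t mY).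
  by rewrite ler_norml; apply/andP; split; lra.
pose dl := A * B; pose b := l / dl.
have dl0 : 0 < dl by rewrite mulr_gt0.
have b0 : 0 < b by rewrite divr_gt0.
have bdl : b * dl = l by rewrite /b divfK// gt_eqF.
(* Anti-concentration with b' = B^3 = sqrt(l). As log(1 + p) <= 2 log p <= 2 l, K is at most 3 B^3 /
   sqrt(c); with the displacement 3 dl this makes the 9 of the constant. The two remaining errors
   are at most 2 A B^4 each and make the 4. *)
pose K := (Num.sqrt c)^-1 * ((B ^+ 3)^-1 * ln (1 + p%:R) + B ^+ 3).
have B30 : 0 < B ^+ 3 by rewrite exprn_gt0.
have HK t' h : 0 <= h ->
    fine (P2 [set w | t' < vmax (fun j => Y j w) <= t' + h]) <= h * K.
  move=> h0; have := gaussian_anti_concentration p0 t' gY Ssym c0 cS B30 h0.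
  by rewrite /K mulrA.
apply: le_trans (gaussian_max_comparison p0 t gX gY (ltW th0) Sth b0 dl0 HK) _.
have lnp : ln (p%:R) <= l.
  rewrite le_max; apply/orP; right; rewrite ler_ln ?posrE ?divr_gt0//.
  by rewrite ler_pdivlMr// ler_piMr ?(ltW pR)// ltW.
have ln1p : ln (1 + p%:R) <= 2 * l.
  apply: (@le_trans _ _ (2 * ln p%:R)); last by rewrite ler_pM2l.
  rewrite mulr_natl -lnXn// ler_ln ?posrE ?exprn_gt0 ?ltr_pwDl//.
  rewrite nat1r -natrX ler_nat.
  rewrite -mulnn; apply: leq_trans (leq_mul p1 (leqnn p)).
  by rewrite mul2n -addnn; exact: (leq_add p0 (leqnn p)).
have sB : expR (- (b * dl)) <= th / p%:R.
  rewrite bdl -[th / p%:R]lnK ?posrE ?divr_gt0// ler_expR.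
  by rewrite -[th / _]invf_div lnV ?posrE ?divr_gt0// lerN2 le_max lexx orbT.
have A1 : A <= 1.
  rewrite leNgt; apply/negP => A1; move: th1; rewrite -AE ltNge.
  by rewrite exprn_ege1// ltW.
have t1 : 3 * dl * K <= 9 / Num.sqrt c * A * B ^+ 4.
  have KB : K <= (Num.sqrt c)^-1 * (3 * B ^+ 3).
    rewrite /K ler_pM2l ?invr_gt0// (_ : 3 * B ^+ 3 = (B ^+ 3)^-1 * (2 * l) + B ^+ 3).
      by rewrite lerD2r ler_pM2l// invr_gt0.
    by rewrite -BE; field; rewrite gt_eqF.
  apply: le_trans (ler_wpM2l _ KB) _; first by rewrite mulr_ge0// ltW.
  by rewrite le_eqVlt; apply/orP; left; apply/eqP; rewrite /dl; ring.
have t2 : 2 * th * b / dl = 2 * A * B ^+ 4.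
  by rewrite /b /dl -AE -BE; field; rewrite !gt_eqF.
have t3 : (p%:R + 1) * expR (- (b * dl)) / (b * dl) <= 2 * A * B ^+ 4.
  rewrite bdl ler_pdivrMr//.
  apply: (@le_trans _ _ (2 * A)); last first.
    rewrite -[leRHS]mulrA; apply: ler_peMr; first by rewrite mulr_ge0// ltW.
    exact: mulr_ege1.
  apply: (@le_trans _ _ ((p%:R + 1) * (th / p%:R))).
    by rewrite bdl in sB; rewrite ler_pM2l// ltr_wpDl.
  rewrite mulrA ler_pdivrMr// -AE.
  have A3 : A ^+ 3 <= A by rewrite exprS ler_piMr ?(ltW A0)// exprn_ile1// ltW.
  have p2 : p%:R + 1 <= 2 * p%:R :> R by rewrite mulr2n mulrDl !mul1r lerD2l ler1n.
  rewrite [leRHS]mulrAC; apply: ler_pM => //; by rewrite ?exprn_ge0 ?addr_ge0 ?(ltW A0).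
rewrite t2 /C (_ : (4 + 9 / Num.sqrt c) * A * B ^+ 4 =
   9 / Num.sqrt c * A * B ^+ 4 + (2 * A * B ^+ 4 + 2 * A * B ^+ 4)); last by ring.
by rewrite lerD// lerD2l.
Qed.

End gaussian_pi_bound.

(** * Gaussian sums and bootstrap quantiles *)

Section gaussian_sums.
Context d (T : measurableType d) (R : realType) (P : probability T R).

Lemma second_momentE p (X : T -> p.-tuple R) j k :
  second_moment P X j k = \int[P]_w (tnth (X w) j * tnth (X w) k).
Proof. by rewrite /second_moment unlock. Qed.

Lemma second_moment_sym p (X : T -> p.-tuple R) j k :
  second_moment P X j k = second_moment P X k j.
Proof. by rewrite !second_momentE; apply: eq_Rintegral => w _; rewrite mulrC. Qed.

Lemma second_moment_psd p (X : {RV P >-> p.-tuple R}) (a : 'I_p -> R) :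
  (forall j, component X j \in Lfun P 2%:E) ->
  0 <= \sum_j \sum_k a j * a k * second_moment P X j k.
Proof.
move=> LX.
have iX j k : P.-integrable setT (EFin \o (fun w => tnth (X w) j * tnth (X w) k)).
  by have /Lfun1_integrable := Lfun2_mul_Lfun1 (LX j) (LX k); apply: eq_integrable.
have -> : \sum_j \sum_k a j * a k * second_moment P X j k =
    \int[P]_w (\sum_j a j * tnth (X w) j) ^+ 2.
  transitivity (\int[P]_w \sum_j \sum_k a j * a k * (tnth (X w) j * tnth (X w) k)).
    rewrite Rintegral_sum; last first.
      by move=> j; apply: integrable_sum_seq => k; exact: integrableZ.
    apply: eq_bigr => j _; rewrite Rintegral_sum; last by move=> k; exact: integrableZ.
    by apply: eq_bigr => k _; rewrite second_momentE RintegralZl.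
  apply: eq_Rintegral => w _; rewrite expr2 mulr_suml; apply: eq_bigr => j _.
  by rewrite mulr_sumr; apply: eq_bigr => k _; ring.
by apply: Rintegral_ge0 => w _; exact: sqr_ge0.
Qed.

Lemma measurable_component p (X : {RV P >-> p.-tuple R}) j :
  measurable_fun setT (fun w => tnth (X w) j).
Proof. exact: (measurableT_comp (measurable_tnth j) (measurable_funPT X)). Qed.

Lemma centered_gaussian_cf p (Y X : {RV P >-> p.-tuple R}) :
  (forall j, component X j \in Lfun P 2%:E) ->
  centered_gaussian P Y (\matrix_(j, k) second_moment P X j k) ->
  gaussian_cf P (fun j w => tnth (Y w) j) (second_moment P X).
Proof.
move=> LX GY; apply: normal_law_gaussian_cf.
- by move=> j; exact: measurable_component.
- by move=> a; exact: second_moment_psd.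
- move=> a; have := GY (\row_j a j).
  have -> : (fun w => \sum_j (\row_j a j) 0 j * tnth (Y w) j) =
            (fun w => \sum_j a j * tnth (Y w) j).
    by apply/funext => w; apply: eq_bigr => j _; rewrite mxE.
  congr (has_law _ _ (normal_law _ _)).
  rewrite !mxE exchange_big; apply: eq_bigr => k _ /=.
  rewrite !mxE mulr_suml; apply: eq_bigr => j _; rewrite !mxE; ring.
Qed.

Lemma gaussian_sum_cf n p (x y : 'I_n -> {RV P >-> p.-tuple R}) :
  mutually_independent P (fun i => y i : T -> p.-tuple R) ->
  (forall i j, component (x i) j \in Lfun P 2%:E) ->
  (forall i, centered_gaussian P (y i) (\matrix_(j, k) second_moment P (x i) j k)) ->
  gaussian_cf P (fun j w => (Num.sqrt n%:R)^-1 * \sum_(i < n) tnth (y i w) j)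
    (fun j k => average (fun i => second_moment P (x i) j k)).
Proof.
move=> indy Lx Gy.
have my i : measurable_fun setT (y i : T -> p.-tuple R) by [].
have G := independent_sum_gaussian_cf indy my
  (fun i j => @measurable_tnth _ _ p j) (fun i => centered_gaussian_cf (Lx i) (Gy i)).
have := gaussian_cf_scale (fun=> (Num.sqrt n%:R)^-1) G.
congr gaussian_cf; apply/funext => j; apply/funext => k.
by rewrite /average -invfM -expr2 sqr_sqrtr.
Qed.

(** With the data frozen in [v], the multiplier sum is exactly Gaussian and its covariance is the
    empirical second moment matrix, at entrywise distance at most Delta from that of Z0. *)
Lemma multiplier_sum_cf n p (e : 'I_n -> {RV P >-> R}) (v : 'I_n -> 'I_p -> R) :
  mutually_independent P (fun i => e i : T -> R) ->
  (forall i, has_law P (e i) (normal_prob 0 1)) ->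
  gaussian_cf P (fun j w => (Num.sqrt n%:R)^-1 * \sum_(i < n) v i j * e i w)
    (fun j k => average (fun i => v i j * v i k)).
Proof.
move=> inde Ge.
have me i : measurable_fun setT (e i : T -> R) by [].
have Ge' i : has_law P (e i) (normal_law 0 1).
  by move=> A mA; rewrite Ge// /normal_law oner_eq0 sqrtr1.
have nl i := normal_law_integral _ _ (me i) ler01 (Ge' i).
have G i : gaussian_cf P (fun j w => v i j * e i w) (fun j k => v i j * v i k).
  split=> [j|j|a b].
  - exact: measurable_funM.
  - by apply: integrableZ; have [] := nl 0 0 i.
  - have -> : \sum_j \sum_k a j * a k * (v i j * v i k) = (\sum_j a j * v i j) ^+ 2.
      rewrite expr2 mulr_suml; apply: eq_bigr => j _.
      by rewrite mulr_sumr; apply: eq_bigr => k _; ring.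
    have [_] := nl (\sum_j a j * v i j) b i; rewrite mulr1 => <-.
    apply: eq_Rintegral => w _; congr (cos (_ + _)).
    by rewrite mulr_suml; apply: eq_bigr => j _; rewrite mulrA.
have mg i j : measurable_fun setT (fun z : R => v i j * z) by exact: measurable_funM.
have := gaussian_cf_scale (fun=> (Num.sqrt n%:R)^-1)
  (independent_sum_gaussian_cf inde me mg G).
congr gaussian_cf; apply/funext => j; apply/funext => k.
by rewrite /average -invfM -expr2 sqr_sqrtr.
Qed.

End gaussian_sums.

Section quantiles.
Context {R : realType}.

(** The set defining the quantile is closed upwards, nonempty and bounded below by the limits of the
    distribution function, and it contains its infimum by right continuity. Quantiles are later
    handled only through this equivalence. *)
Lemma quantile_leP d (T : measurableType d) (P : probability T R) (M : T -> R)
    (alpha t : R) : measurable_fun setT M -> 0 < alpha < 1 ->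
  (quantile (fun t => P [set w | M w <= t]) alpha <= t) =
  (alpha <= fine (P [set w | M w <= t])).
Proof.
move=> mM /andP[a0 a1].
pose X : {RV P >-> R} := mfun_Sub (mem_set mM : M \in mfun).
have cE u : cdf X u = P [set w | M w <= u].
  rewrite /cdf /distribution /pushforward.
  by rewrite (_ : X @^-1` _ = [set w | M w <= u]).
pose F u := fine (P [set w | M w <= u]).
have FE u : (F u)%:E = cdf X u.
  by rewrite cE fineK// -cE fin_num_measure.
have Fnd u v : u <= v -> F u <= F v.
  by move=> uv; rewrite -lee_fin !FE; exact: cdf_nondecreasing.
set S := [set u | (alpha%:E <= P [set w | (M w <= u)%R])%E].
have SE u : S u = (alpha <= F u) by rewrite /S /= -cE -FE lee_fin.
have S0 : S !=set0.
  have : F u @[u --> +oo] --> (1 : R).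
    by apply: fine_cvg; under eq_fun do rewrite -cE; exact: cvg_cdfy1.
  move=> /cvgrPdist_lt /(_ (1 - alpha)); rewrite subr_gt0 => /(_ a1) H.
  near (pinfty_nbhs R) => u; exists u; rewrite SE.
  have : `|1 - F u| < 1 - alpha by near: u.
  move=> /(le_lt_trans (ler_norm _)); lra.
have Slb : has_lbound S.
  have : F u @[u --> -oo] --> (0 : R).
    by apply: fine_cvg; under eq_fun do rewrite -cE; exact: cvg_cdfNy0.
  move=> /cvgrPdist_lt /(_ alpha a0) H.
  near (ninfty_nbhs R) => u; exists u => v; rewrite SE => av.
  rewrite leNgt; apply/negP => /ltW /Fnd vu.
  have : `|0 - F u| < alpha by near: u.
  rewrite sub0r normrN => /(le_lt_trans (ler_norm _)); lra.
have Sinf : S (inf S).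
  have rc : F u @[u --> (inf S)^'+] --> F (inf S).
    apply: fine_cvg; rewrite fineK -?cE ?fin_num_measure//.
    by under eq_fun do rewrite -cE; exact: cdf_right_continuous.
  rewrite SE; apply: (cvgr_to_ge rc); near=> u.
  have : inf S < u by near: u; exact: nbhs_right_gt.
  by move=> /(inf_lt S0)[v + /ltW /Fnd]; rewrite SE; exact: le_trans.
apply/idP/idP => [qt|at_].
  by rewrite -/(F t) (le_trans _ (Fnd _ _ qt))//; move: Sinf; rewrite SE.
have St : S t by rewrite SE.
exact: (ge_inf Slb St).
Unshelve. all: by end_near. Qed.

Lemma measurable_fun_le_sublevels d (T : measurableType d) (f : T -> R) :
  (forall t, measurable [set w | f w <= t]) -> measurable_fun setT f.
Proof.
move=> mf mD; apply: (measurability _ (RGenOInfty.measurableE R)) => //.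
move=> /= _ [_ [t ->] <-]; rewrite setTI.
have -> : f @^-1` `]t, +oo[ = ~` [set w | f w <= t].
  by apply/seteqP; split => w /=; rewrite in_itv/= andbT ltNge => /negP.
exact: measurableC.
Qed.

Lemma probability_setY_le d (T : measurableType d) (P : probability T R) (A B : set T) :
  measurable A -> measurable B -> `|fine (P A) - fine (P B)| <= fine (P (A `+` B)).
Proof.
move=> mA mB.
have mAB : measurable (A `+` B).
  by rewrite /setY; apply: measurableU; exact: measurableD.
have half (C D : set T) : measurable C -> measurable D -> measurable (C `+` D) ->
    fine (P C) <= fine (P D) + fine (P (C `+` D)).
  move=> mC mD mCD; rewrite -fineD ?fin_num_measure//.
  rewrite fine_le ?fin_num_measure ?fin_numD ?fin_num_measure//.
  apply: le_trans (measureU2 _ _ _) => //; rewrite le_measure ?inE//.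
    exact: measurableU.
  move=> w Cw; have [Dw|Dw] := pselect (D w); [by left|by right; left].
have h1 := half _ _ mA mB mAB.
have mBA : measurable (B `+` A).
  by rewrite /setY; apply: measurableU; exact: measurableD.
have h2 := half _ _ mB mA mBA.
have E : B `+` A = A `+` B by rewrite /setY setUC.
rewrite E in h2.
by rewrite ler_norml; apply/andP; split; lra.
Qed.

End quantiles.

Section bootstrap_measurability.
Context d (T : measurableType d) (R : realType) (P : probability T R).
Context (n p : nat) (x : 'I_n -> {RV P >-> p.-tuple R}) (e : 'I_n -> {RV P >-> R}).
Hypothesis p0 : (0 < p)%N.

Lemma measurable_max_stat :
  measurable_fun setT (max_stat (fun i => x i : T -> p.-tuple R)).
Proof.
apply: (@measurable_vmax _ _ p0 _ _
  (fun j w => (Num.sqrt n%:R)^-1 * \sum_(i < n) tnth (x i w) j)) => j.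
apply: measurable_funM => //; apply: measurable_sum => i.
exact: measurable_component.
Qed.

Lemma measurable_W0_le (w : T) t : measurable
  [set w' | W0 (fun i => x i : T -> p.-tuple R) (fun i => e i : T -> R) w w' <= t].
Proof.
apply: (@measurable_vmax_le _ _ p0 _ _
  (fun j w' => (Num.sqrt n%:R)^-1 * \sum_(i < n) tnth (x i w) j * e i w')) => j.
apply: measurable_funM => //; apply: measurable_sum => i.
exact: measurable_funM.
Qed.

(** The conditional probability is the measure of a section of a measurable subset of T * T, one
    factor for the data and one for the multipliers. *)
Lemma measurable_Pe_W0_le t : measurable_fun setT
  (fun w => Pe_W0_le P (fun i => x i : T -> p.-tuple R) (fun i => e i : T -> R) w t).
Proof.
pose A := [set z : T * T | vmax (fun j =>
  (Num.sqrt n%:R)^-1 * \sum_(i < n) tnth (x i z.1) j * e i z.2) <= t].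
have mA : measurable A.
  apply: (@measurable_vmax_le _ _ p0 _ _
    (fun j z => (Num.sqrt n%:R)^-1 * \sum_(i < n) tnth (x i z.1) j * e i z.2)) => j.
  apply: measurable_funM => //; apply: measurable_sum => i.
  apply: measurable_funM; last exact: measurableT_comp.
  by apply: (measurableT_comp (measurable_component (x i) j)).
have := measurable_fun_xsection P mA; congr measurable_fun.
apply/funext => w; rewrite /Pe_W0_le /=; congr (P _).
by apply/seteqP; split => w' /=; rewrite /xsection /= inE.
Qed.

Lemma measurable_cW0 alpha : 0 < alpha < 1 -> measurable_fun setT
  (cW0 P (fun i => x i : T -> p.-tuple R) (fun i => e i : T -> R) alpha).
Proof.
move=> a01; apply: measurable_fun_le_sublevels => t.
set F := fun w => Pe_W0_le P (fun i => x i : T -> p.-tuple R) (fun i => e i : T -> R) w t.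
rewrite (_ : [set w | _] = [set w | (alpha%:E <= F w)%E]); last first.
  apply/seteqP; split => w /=; rewrite /cW0 /Pe_W0_le quantile_leP//.
  - by rewrite -lee_fin fineK// fin_num_measure//; exact: measurable_W0_le.
  - by apply: measurable_fun_le_sublevels => u; exact: measurable_W0_le.
  - by rewrite -lee_fin fineK// fin_num_measure//; exact: measurable_W0_le.
  - by apply: measurable_fun_le_sublevels => u; exact: measurable_W0_le.
rewrite -[X in measurable X]setTI.
by apply: emeasurable_fun_c_infty => //; exact: measurable_Pe_W0_le.
Qed.

Lemma measurable_Delta : measurable_fun setT (Delta P (fun i => x i : T -> p.-tuple R)).
Proof.
have mbig (I : Type) (r : seq I) (f : I -> T -> R) :
    (forall i, measurable_fun setT (f i)) ->
    measurable_fun setT (fun w => \big[Num.max/0]_(i <- r) f i w).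
  move=> mf; elim: r => [|i r IH].
    by under eq_fun do rewrite big_nil; exact: measurable_cst.
  by under eq_fun do rewrite big_cons; exact: measurable_maxr.
apply: (mbig _ _ _) => j; apply: (mbig _ _ _) => k.
apply: measurableT_comp => //; apply: measurable_funB => //.
apply: measurable_funM => //; apply: measurable_sum => i.
by apply: measurable_funM; exact: measurable_component.
Qed.

Lemma Delta_ge w j k :
  `|average (fun i => tnth (x i w) j * tnth (x i w) k)
    - average (fun i => second_moment P (x i) j k)| <=
  Delta P (fun i => x i : T -> p.-tuple R) w.
Proof.
rewrite /Delta; apply: le_trans (le_bigmax _ _ j).
exact: (le_bigmax _ (fun k => `|average (fun i => tnth (x i w) j * tnth (x i w) k)
    - average (fun i => second_moment P (x i) j k)|) k).
Qed.

End bootstrap_measurability.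

Theorem theorem3p1 (R : realType) (c1 C1 : R) (hc1 : 0 < c1) (hC1 : c1 < C1) :
  exists C2 : R, 0 < C2 /\
  forall (n p : nat) (d : measure_display) (T : measurableType d)
    (P : probability T R)
    (x y : 'I_n -> {RV P >-> p.-tuple R}) (e : 'I_n -> {RV P >-> R}),
  (1 <= n)%N -> (3 <= p)%N ->
  mutually_independent P (fun i => x i : T -> p.-tuple R) ->
  (forall i j, component (x i) j \in Lfun P 2%:E) ->
  (forall i j, ('E_P[component (x i) j] = 0)%E) ->
  mutually_independent P (fun i => y i : T -> p.-tuple R) ->
  (forall i, centered_gaussian P (y i)
     (\matrix_(j, k) second_moment P (x i) j k)) ->
  mutually_independent P (fun i => e i : T -> R) ->
  (forall i, has_law P (e i) (normal_prob 0 1)) ->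
  independent P (fun w => [tuple e i w | i < n])
                (fun w => [tuple x i w | i < n]) ->
  (forall j, c1 <= average (fun i => second_moment P (x i) j j) <= C1) ->
  (forall theta : R, 0 < theta ->
     (rho_ominus P x y e <=
      2%:E * (rho P x y + (pi_bound C2 p theta)%:E
              + P [set w | (theta < Delta P x w)%R]))%E) /\
  (ereal_sup [set `|P [set w | (max_stat x w <= cW0 P x e alpha w)%R]
                    - alpha%:E|%E
             | alpha in [set alpha : R | (0 < alpha < 1)%R]]
   <= rho_ominus P x y e + rho P x y)%E.
Proof.
exists (4 + 9 / Num.sqrt c1); split.
  by rewrite ltr_pwDl// divr_ge0// sqrtr_ge0.
move=> n p d T P x y e n1 p3 _ Lx _ indy Gy inde Ge _ c1C1.
have p1 : (1 < p)%N by exact: ltnW.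
have p0 : (0 < p)%N by exact: ltnW.
pose S j k := average (fun i => second_moment P (x i) j k).
have gZ := gaussian_sum_cf indy Lx Gy.
have [mZ _ _] := gZ.
have Ssym j k : S j k = S k j.
  by rewrite /S /average; congr (_ * _); apply: eq_bigr => i _; exact: second_moment_sym.
have cS j : c1 <= S j j by have /andP[] := c1C1 j.
pose T0 := max_stat (fun i => x i : T -> p.-tuple R).
pose Z0 := max_stat (fun i => y i : T -> p.-tuple R).
have mT0 : measurable_fun setT T0 by exact: measurable_max_stat.
have mZ0 : measurable_fun setT Z0 by exact: measurable_max_stat.
have mle (f g : T -> R) : measurable_fun setT f -> measurable_fun setT g ->
    measurable [set w | f w <= g w].
  by move=> mf mg; rewrite -[X in measurable X]setTI; exact: measurable_fun_le.
have mlec (f : T -> R) c : measurable_fun setT f -> measurable [set w | f w <= c].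
  by move=> mf; apply: mle.
pose FT t := fine (P [set w | T0 w <= t]).
pose FZ t := fine (P [set w | Z0 w <= t]).
have PE A : measurable A -> P A = (fine (P A))%:E.
  by move=> mA; rewrite fineK// fin_num_measure.
have p01 A : measurable A -> 0 <= fine (P A) <= 1.
  move=> mA; rewrite fine_ge0//= -lee_fin -PE//.
  exact: probability_le1.
have distE t : (`|P [set w | (T0 w <= t)%R] - P [set w | (Z0 w <= t)%R]| =
    `|FT t - FZ t|%:E)%E.
  by rewrite (PE _ (mlec _ t mT0)) (PE _ (mlec _ t mZ0)).
have [r rE] : exists r, rho P x y = r%:E.
  exists (fine (rho P x y)); rewrite fineK//.
  have rho0 : (0 <= rho P x y)%E.
    apply: le_ereal_sup_tmp.
    exists (`|P [set w | (T0 w <= 0)%R] - P [set w | (Z0 w <= 0)%R]|)%E => //.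
  rewrite ge0_fin_numE//; apply: (@le_lt_trans _ _ 1%E); last exact: ltry.
  apply: ge_ereal_sup => _ [t _ <-]; rewrite distE lee_fin ler_norml.
  have /andP[] := p01 _ (mlec _ t mT0); have /andP[] := p01 _ (mlec _ t mZ0).
  by rewrite -/(FT t) -/(FZ t) => *; apply/andP; split; lra.
have hr t : `|FT t - FZ t| <= r.
  by rewrite -lee_fin -distE -rE; apply: ereal_sup_ubound; exists t.
have r0 : 0 <= r by exact: le_trans (hr 0).
(* Anti-concentration with b' = 1. Any finite Lipschitz constant for [FZ] serves here, since only FZ
   (cZ0 a) = a is drawn from it: just left of the quantile [FZ] is below a, and it cannot jump. *)
pose K := (Num.sqrt c1)^-1 * (1^-1 * ln (1 + p%:R) + 1).
have FZlip t h : 0 <= h -> FZ (t + h) <= FZ t + h * K.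
  move=> h0; rewrite /FZ /Z0 (fine_vmax_le_diff p0 P t mZ h0) lerD2l.
  by rewrite /K mulrA; apply: (gaussian_anti_concentration p0 t gZ Ssym hc1 cS ltr01 h0).
have cZP a t : 0 < a < 1 -> (cZ0 P y a <= t) = (a <= FZ t).
  by move=> a01; exact: quantile_leP.
have cZE a : 0 < a < 1 -> FZ (cZ0 P y a) = a.
  move=> a01; apply/le_anti; rewrite -cZP// lexx andbT.
  have K0 : 0 < K.
    rewrite mulr_gt0 ?invr_gt0 ?sqrtr_gt0// ltr_wpDl// invr1 mul1r ln_ge0//.
    by rewrite lerDl.
  apply/ler_addgt0Pr => v v0.
  have h0 : 0 < v / K by rewrite divr_gt0.
  have := FZlip (cZ0 P y a - v / K) _ (ltW h0); rewrite subrK divfK ?gt_eqF//.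
  move=> H; apply: (le_trans H); rewrite lerD2r ltW// ltNge -cZP// -ltNge.
  by rewrite ltrBlDr ltrDl.
have mD a : 0 < a < 1 -> measurable [set w | T0 w <= cW0 P x e a w].
  by move=> a01; apply: mle => //; exact: measurable_cW0.
split.
- move=> th th0; set pid := [set w | th < Delta P x w].
  have mpid : measurable pid.
    rewrite (_ : pid = ~` [set w | Delta P x w <= th]); last first.
      by apply/seteqP; split => w /=; rewrite /pid /= ltNge => /negP.
    by apply: measurableC; apply: mlec; exact: measurable_Delta.
  set pi := pi_bound _ p th.
  have pi0 : 0 <= pi.
    apply: mulr_ge0; last exact: powR_ge0.
    apply: mulr_ge0; last exact: powR_ge0.
    by apply: addr_ge0 => //; apply: divr_ge0 => //; exact: sqrtr_ge0.
  have HW w t : Delta P x w <= th ->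
      `|fine (Pe_W0_le P (fun i => x i : T -> p.-tuple R) (fun i => e i : T -> R) w t) - FZ t| <= pi.
    move=> Dw; have gW := multiplier_sum_cf (fun i j => tnth (x i w) j) inde Ge.
    apply: (gaussian_max_pi_bound p1 t gW gZ th0 _ Ssym hc1 cS) => j k.
    exact: le_trans (Delta_ge x w j k) Dw.
  have cWP a w t : 0 < a < 1 -> (cW0 P x e a w <= t) =
      (a <= fine (Pe_W0_le P (fun i => x i : T -> p.-tuple R) (fun i => e i : T -> R) w t)).
    move=> a01; apply: quantile_leP => //.
    by apply: measurable_fun_le_sublevels => u; exact: measurable_W0_le.
  suff main a : 0 < a < 1 ->
      fine (P ([set w | T0 w <= cW0 P x e a w] `+` [set w | T0 w <= cZ0 P y a])) <=
      fine (P pid) + 2 * pi + 2 * r.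
    rewrite rE (PE _ mpid) -!EFinD -EFinM.
    apply: ge_ereal_sup => _ [a a01 <-].
    have mY : measurable ([set w | T0 w <= cW0 P x e a w] `+` [set w | T0 w <= cZ0 P y a]).
      by rewrite /setY; apply: measurableU; apply: measurableD; (exact: mD || exact: mlec).
    rewrite (PE _ mY) lee_fin; apply: (le_trans (main a a01)).
    have /andP[] := p01 _ mpid; lra.
  move=> a01; have /andP[a0 a1] := a01.
  apply/ler_addgt0Pr => v v0; pose h := v / 2.
  have h0 : 0 < h by rewrite divr_gt0.
  pose u := a + pi + h; pose l := a - pi - h.
  (* A level outside (0, 1) has no meaningful quantile. For u >= 1 the set [U] is the whole space
     and for l <= 0 the set [L] is empty, so that u + r and l - r still bound their
     probabilities. *)
  pose U := [set w | u < 1 -> T0 w <= cZ0 P y u].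
  pose L := [set w | 0 < l /\ T0 w <= cZ0 P y l].
  have u0 : 0 < u by rewrite /u addr_gt0// ltr_pwDl.
  have l1 : l < 1 by rewrite /l; lra.
  have mU : measurable U.
    have [u1|u1] := ltP u 1.
      by rewrite (_ : U = [set w | T0 w <= cZ0 P y u]); [exact: mlec|apply/seteqP; split=> w /=; rewrite /U/=; tauto].
    rewrite (_ : U = setT)//; apply/seteqP; split=> w //= _; rewrite /U /= => u1'.
    by move: u1; rewrite leNgt u1'.
  have mL : measurable L.
    have [l0|l0] := ltP 0 l.
      by rewrite (_ : L = [set w | T0 w <= cZ0 P y l]); [exact: mlec|apply/seteqP; split=> w /=; rewrite /L/=; tauto].
    rewrite (_ : L = set0)//; apply/seteqP; split=> w //= [l0' _].
    by move: l0; rewrite leNgt l0'.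
  have LU : L `<=` U.
    move=> w [l0 Tl] u1; apply: (le_trans Tl); rewrite cZP ?l0// cZE ?u0//.
    by rewrite /u /l; lra.
  have PU : fine (P U) <= u + r.
    have [u1|u1] := ltP u 1.
      rewrite (_ : U = [set w | T0 w <= cZ0 P y u]); last first.
        by apply/seteqP; split=> w /=; rewrite /U/=; tauto.
      have := hr (cZ0 P y u); rewrite cZE ?u0// ler_norml => /andP[_].
      by rewrite /FT; lra.
    by have /andP[_] := p01 _ mU; lra.
  have PL : l - r <= fine (P L).
    have [l0|l0] := ltP 0 l.
      rewrite (_ : L = [set w | T0 w <= cZ0 P y l]); last first.
        by apply/seteqP; split=> w /=; rewrite /L/=; tauto.
      have := hr (cZ0 P y l); rewrite cZE ?l0// ler_norml => /andP[+ _].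
      by rewrite /FT; lra.
    by have /andP[+ _] := p01 _ mL; lra.
  have mUL : measurable (U `\` L) by exact: measurableD.
  have PUL : fine (P (U `\` L)) = fine (P U) - fine (P L).
    rewrite measureD//; last by rewrite -ge0_fin_numE// fin_num_measure.
    by rewrite setIidr// fineB// fin_num_measure.
  have mY : measurable ([set w | T0 w <= cW0 P x e a w] `+` [set w | T0 w <= cZ0 P y a]).
    by rewrite /setY; apply: measurableU; apply: measurableD; (exact: mD || exact: mlec).
  have sub : [set w | T0 w <= cW0 P x e a w] `+` [set w | T0 w <= cZ0 P y a]
      `<=` pid `|` (U `\` L).
    move=> w Hw; have [Dw|Dw] := ltP th (Delta P x w); [by left|right].
    have HWw t := HW w t Dw.
    (* T0 lies between the two critical values, in one order or the other. Closeness of the two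
       distribution functions places [cW0] between the Z0-quantiles at l and u whenever these
       exist. *)
    case: Hw => [[/= TW /negP]|[/= TZ /negP]]; rewrite -ltNge => Tlt.
    - split.
        move=> u1; rewrite leNgt; apply/negP => cT.
        have : ~~ (cW0 P x e a w <= cZ0 P y u) by rewrite -ltNge (lt_le_trans cT).
        rewrite cWP// -ltNge => Fa.
        have := HWw (cZ0 P y u); rewrite cZE ?u0// ler_norml => /andP[+ _].
        by rewrite /u; lra.
      move=> [l0 Tl]; move: Tlt; rewrite ltNge (le_trans Tl)// cZP ?l0// cZE//.
      by rewrite /l; lra.
    - split.
        move=> u1; apply: (le_trans TZ); rewrite cZP// cZE ?u0// /u.
        by rewrite -addrA lerDl addr_ge0// ltW.
      move=> [l0 Tl].
      have aF : a <= fine (Pe_W0_le P (fun i => x i : T -> p.-tuple R)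
          (fun i => e i : T -> R) w (cW0 P x e a w)) by rewrite -cWP.
      have := HWw (cW0 P x e a w); rewrite ler_norml => /andP[_ FF].
      have : cZ0 P y l <= cW0 P x e a w by rewrite cZP ?l0// /l; lra.
      by move=> /(le_trans Tl); rewrite leNgt Tlt.
  have : fine (P ([set w | T0 w <= cW0 P x e a w] `+` [set w | T0 w <= cZ0 P y a])) <=
      fine (P pid) + fine (P (U `\` L)).
    rewrite -fineD ?fin_num_measure//.
    rewrite fine_le ?fin_num_measure ?fin_numD ?fin_num_measure//.
    apply: le_trans (measureU2 _ _ _) => //.
    by rewrite le_measure ?inE//; exact: measurableU.
  have hE : h + h = v by rewrite /h -splitr.
  rewrite PUL => /le_trans; apply.
  by move: PU PL; rewrite /u /l; lra.
- apply: ge_ereal_sup => _ [a a01 <-].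
  have mA := mD a a01; have mB := mlec _ (cZ0 P y a) mT0.
  pose D := [set w | T0 w <= cW0 P x e a w] `+` [set w | T0 w <= cZ0 P y a].
  have sup : (P D <= rho_ominus P x y e)%E by apply: ereal_sup_ubound; exists a.
  have mY : measurable D.
    by rewrite /setY; apply: measurableU; apply: measurableD.
  rewrite rE; apply: le_trans (leeD sup (lexx _)).
  rewrite (PE _ mY) (PE _ mA) -EFinB -EFinD lee_fin.
  have h1 := probability_setY_le P mA mB.
  (* Continuity of [FZ] gives P(Z0 <= cZ0 a) = a exactly, so P(T0 <= cZ0 a) is within r of a. *)
  have h2 := hr (cZ0 P y a); rewrite cZE// in h2.
  rewrite -[_ - a](subrKA (fine (P [set w | T0 w <= cZ0 P y a]))).
  by apply: (le_trans (ler_normD _ _)); exact: lerD.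
Qed.
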